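(* Let $m\ge 2$ be an integer and write $m-1=2^{i_1}+2^{i_2}+\cdots+2^{i_k}$ with $i_1<i_2<\cdots<i_k$ (so $k$ is the number of ones in the binary expansion of $m-1$); set $\alpha(m-1)=(k-1)^2$. Then $\mathcal{N}(G_m,2)$ is homotopy equivalent to a wedge of $2$-dimensional spheres. More precisely, \[\mathcal{N}(G_m,2)\simeq \mathcal{N}(G_{m-1},2)\vee\bigvee_{\alpha(m-1)}\mathbb{S}^2.\]
   Context: For an integer $m\ge 1$, $G_m$ is the graph whose vertices are the integers $0,1,\ldots,m-1$, viewed as binary strings, two vertices being adjacent if and only if their binary representations differ in exactly one position (equivalently, $G_m$ is the induced subgraph of a sufficiently large hypercube graph on these $m$ binary strings). For a finite simple connected graph $G$ and a real number $r\ge 0$, the Čech complex $\mathcal{N}(G,r)$ is the simplicial complex with vertex set $V(G)$ in which a finite nonempty set $\sigma\subseteq V(G)$ is a simplex if and only if the closed balls of radius $\frac r2$ centered at the vertices of $\sigma$ have a common point, the balls being taken in the geometric realization of $G$ equipped with the shortest path metric in which each edge is isometric to $[0,1]$. An empty wedge of spheres means a contractible space. *)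

(* Defs.v *)
From HB Require Import structures.
From mathcomp Require Import all_boot all_order all_algebra.
From mathcomp Require Import all_classical all_reals all_analysis.
From mathcomp Require Import homotopy.

Set Implicit Arguments.
Unset Strict Implicit.
Unset Printing Implicit Defensive.

Import Order.TTheory GRing.Theory Num.Theory.
Import numFieldNormedType.Exports.

Local Open Scope classical_set_scope.
Local Open Scope ring_scope.

(** * The graphs [G_m] *)

Definition bit (n p : nat) : bool := odd (n %/ 2 ^ p).

(* Bits at positions [p >= m] of numbers below [m] all vanish, since
   [m < 2 ^ m], so ranging over the positions [p < m] loses nothing. *)
Definition bingraph (m : nat) : rel 'I_m :=
  fun u v => #|[pred p : 'I_m | bit u p != bit v p]| == 1%N.
Arguments bingraph m u v : clear implicits.

Lemma bingraph_sym m : symmetric (bingraph m).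
Proof.
move=> u v; rewrite /bingraph; congr (_ == _).
by apply: eq_card => p; rewrite !inE eq_sym.
Qed.

Lemma bingraph_irrefl m : irreflexive (bingraph m).
Proof.
move=> u; rewrite /bingraph (_ : #|_| = 0%N) //.
by apply: eq_card0 => p; rewrite !inE eqxx.
Qed.

(** * Geometric realizations

    A simplicial complex on the vertices [0, ..., n-1] is given by the set of
    its simplices; vertex [v] is realized as the [v]-th basis vector of
    [R^n]. *)

Definition geom_simplex (R : realType) (n : nat) (s : {set 'I_n}) :
    set 'rV[R]_n :=
  [set x | [/\ forall i, 0 <= x 0 i, \sum_i x 0 i = 1 &
               forall i, i \notin s -> x 0 i = 0]].

Definition realization (R : realType) (n : nat) (K : set {set 'I_n}) :
    set 'rV[R]_n :=
  \bigcup_(s in K) @geom_simplex R n s.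

Definition graph_complex (n : nat) (e : rel 'I_n) : set {set 'I_n} :=
  [set s | (exists v, s = finset.set1 v) \/
           (exists u v, e u v /\ s = [set u; v]%SET)].

Definition same_edge (R : realType) (n : nat) (e : rel 'I_n)
    (x y : 'rV[R]_n) : Prop :=
  exists u v, [/\ e u v, geom_simplex [set u; v]%SET x &
                         geom_simplex [set u; v]%SET y].

(* [edge_path e x y l]: a piecewise linear path of length [l] from [x] to [y]
   in the realization of the graph. The norm on ['rV[R]_n] is the sup norm, so
   between the points [(1 - t) u + t v] and [(1 - t') u + t' v] of an edge
   [{u, v}] it gives [`|t - t'|]: each edge is isometric to [[0, 1]]. *)
Inductive edge_path (R : realType) (n : nat) (e : rel 'I_n) :
    'rV[R]_n -> 'rV[R]_n -> R -> Prop :=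
| edge_path_nil x : edge_path e x x 0
| edge_path_cons x y z l :
    same_edge e x y -> edge_path e y z l -> edge_path e x z (`|y - x| + l).

Definition graph_dist (R : realType) (n : nat) (e : rel 'I_n)
    (x y : 'rV[R]_n) : \bar R :=
  ereal_inf [set l%:E | l in edge_path e x y].

Definition graph_closed_ball (R : realType) (n : nat) (e : rel 'I_n)
    (x : 'rV[R]_n) (r : R) : set 'rV[R]_n :=
  [set p | realization (graph_complex e) p /\ (graph_dist e x p <= r%:E)%E].

Definition cech (R : realType) (n : nat) (e : rel 'I_n) (r : R) :
    set {set 'I_n} :=
  [set s | s != finset.set0 /\
           exists p, forall v, v \in s ->
             graph_closed_ball e (delta_mx 0 v) (r / 2) p].

(* The space N(G_m, 2). *)
Definition cechG2 (R : realType) (m : nat) : topologicalType :=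
  set_type (@realization R m (cech (bingraph m) (2 : R))).

(** * Wedges of spheres *)

Definition sphere (R : realType) (d : nat) : set 'rV[R]_d.+1 :=
  [set x | \sum_i x 0 i ^+ 2 = 1].
Arguments sphere R d : clear implicits.

Lemma sphere_delta (R : realType) (d : nat) :
  (delta_mx 0 0 : 'rV[R]_d.+1) \in sphere R d.
Proof.
rewrite inE /sphere /= (bigD1 0) //= big1 ?addr0 ?mxE ?expr1n // => i /negPf i0.
by rewrite mxE i0 andbF expr0n.
Qed.

Definition sphere_pt (R : realType) (d : nat) : sphere R d :=
  SigSub (sphere_delta R d).

(* The wedge of the pointed space [(X, x0)], which is the component of index
   [None], and of [n] copies of the [d]-sphere. *)
Definition wedge_spheres_family (R : realType) (d n : nat)
    (X : topologicalType) (i : option 'I_n) : topologicalType :=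
  if i is Some _ then set_type (sphere R d) else X.

Definition wedge_spheres_pt (R : realType) (d n : nat)
    (X : topologicalType) (x0 : X) (i : option 'I_n) :
    wedge_spheres_family R d X i :=
  if i is Some _ return wedge_spheres_family R d X i
  then sphere_pt R d else x0.

Definition wedge_spheres (R : realType) (d n : nat)
    (X : topologicalType) (x0 : X) : topologicalType :=
  wedge (@wedge_spheres_pt R d n X x0).

(* A one-point component is neutral for the wedge; it makes the wedge of no
   sphere a point rather than the empty space. *)
Definition bouquet (R : realType) (d n : nat) : topologicalType :=
  @wedge_spheres R d n (discrete_topology unit) tt.

(** * Homotopy equivalence *)

Definition homotopic (R : realType) (X Y : topologicalType) (f g : X -> Y) :
    Prop :=
  exists H : X * R -> Y,
    [/\ {within [set: X] `*` `[0, 1], continuous H},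
        forall x, H (x, 0) = f x & forall x, H (x, 1) = g x].

Definition homotopy_equivalent (R : realType) (X Y : topologicalType) : Prop :=
  exists (f : X -> Y) (g : Y -> X),
    [/\ continuous f, continuous g,
        homotopic R (g \o f) idfun & homotopic R (f \o g) idfun].

(* Main.v *)
(** Two facts reduce the theorem to combinatorics. At scale 2 the simplices of
    the Čech complex are the nonempty subsets of closed neighbourhoods [N[c]]
    (any midpoint witness can be moved to a vertex). And passing from [m - 1] to
    [m] vertices adds the vertex [v = m - 1], whose neighbours [w] are obtained
    by deleting one of the [k] ones of [v].

    Two neighbours [w], [w'] of [v] have exactly one further common neighbour
    [u(w, w')], and no vertex other than [v] is adjacent to three of them. Fix
    the smallest neighbour [w0]. Collapsing the new simplices by toggling single
    vertices leaves a complex [B] that consists of [A] together with [(k - 1)^2]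
    triangles: [{v, w, w'}] for [w < w'] distinct from [w0], and
    [{v, u(w1, w), w}] for [w1 < w]. The complex [A] in turn collapses onto the
    old complex. The boundary of each triangle is null-homotopic in [A]: the
    triple [w, w', w''] is coned off from the vertex of the 3-cube opposite to
    [v], and the other boundaries reduce to such triples through [w0]. Attaching
    a triangle along a null-homotopic boundary amounts to wedging on a 2-sphere.

    All homotopies fix the base point, so that the equivalences can be wedged
    with spheres and composed; this gives the bouquet by induction on [m]. *)

(* The number $(k-1)^2$ is a cycle rank. The simplices through [v] form a cone over the link of [v].
   Once N[v] is thinned to pairs of neighbours, this link collapses to a connected graph: the
   complete graph on the k neighbours of [v], a path w - u(w, w') - w' for every pair, and pendant
   vertices. Without the pendant ones it has k + C(k,2) vertices and 3 C(k,2) edges, so its cycle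
   rank is 2 C(k,2) - k + 1 = (k-1)^2. A spanning tree consists of the edges from [w0] to the other
   neighbours and of one edge from each remaining vertex to the smallest neighbour of [v] adjacent
   to it. Up to collapses, A is the old complex with a cone over this contractible tree. Each edge
   off the tree yields one triangle: C(k-1,2) of them join two neighbours of [v], and C(k,2) join
   some u(w1, w) to the larger neighbour w. The topological part is done by formulas. Maps are
   defined on whole planes and for all times, with clamping, so that continuity reduces to closed
   pieces agreeing on overlaps; triangles are treated in radial coordinates about their
   barycentre. *)
Require Import Defs.
From HB Require Import structures.
From mathcomp Require Import all_boot all_order all_algebra.
From mathcomp Require Import all_classical all_reals all_analysis.
From mathcomp Require Import homotopy.
From mathcomp Require Import ring lra zify.

Set Implicit Arguments.
Unset Strict Implicit.
Unset Printing Implicit Defensive.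

Import Order.TTheory GRing.Theory Num.Theory.
Import numFieldNormedType.Exports.

Local Open Scope classical_set_scope.
Local Open Scope ring_scope.

(** * Continuous maps *)

(* A rigid head symbol for [continuous], so that the tactic [cts] can match
   on the shape of the function. *)
Definition cts (X Y : topologicalType) (f : X -> Y) : Prop := continuous f.

Section Cts.
Context {X Y Z : topologicalType}.

Lemma cts_id : cts (fun x : X => x).
Proof. by move=> x. Qed.

Lemma cts_cst (y : Y) : cts (fun _ : X => y).
Proof. by move=> x; exact: cvg_cst. Qed.

Lemma cts_comp (g : Y -> Z) (f : X -> Y) :
  cts g -> cts f -> cts (fun x => g (f x)).
Proof. by move=> cg cf x; apply: continuous_comp; [exact: cf|exact: cg]. Qed.

Lemma cts_pair (f : X -> Y) (g : X -> Z) :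
  cts f -> cts g -> cts (fun x => (f x, g x)).
Proof. by move=> cf cg x; apply: cvg_pair; [exact: cf|exact: cg]. Qed.

Lemma cts_fst (f : X -> Y * Z) : cts f -> cts (fun x => (f x).1).
Proof. by move=> cf x; apply: continuous_comp; [exact: cf|exact: cvg_fst]. Qed.

Lemma cts_snd (f : X -> Y * Z) : cts f -> cts (fun x => (f x).2).
Proof. by move=> cf x; apply: continuous_comp; [exact: cf|exact: cvg_snd]. Qed.

End Cts.

Section CtsReal.
Context {R : realType} {X : topologicalType}.
Implicit Types f g : X -> R.

Lemma ctsD f g : cts f -> cts g -> cts (fun x => f x + g x).
Proof. by move=> cf cg x; apply: cvgD; [exact: cf|exact: cg]. Qed.

Lemma ctsN f : cts f -> cts (fun x => - f x).
Proof. by move=> cf x; apply: cvgN; exact: cf. Qed.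

Lemma ctsM f g : cts f -> cts g -> cts (fun x => f x * g x).
Proof. by move=> cf cg x; apply: cvgM; [exact: cf|exact: cg]. Qed.

Lemma ctsV f : (forall x, f x != 0) -> cts f -> cts (fun x => (f x)^-1).
Proof. by move=> f0 cf x; apply: cvgV => //; exact: cf. Qed.

Lemma ctsX f n : cts f -> cts (fun x => f x ^+ n).
Proof.
move=> cf; elim: n => [|n IH]; first exact: (@cts_cst _ _ (1 : R)).
by under eq_fun do rewrite exprS; exact: ctsM.
Qed.

Lemma cts_max f g : cts f -> cts g -> cts (fun x => Num.max (f x) (g x)).
Proof. by move=> cf cg x; apply: continuous_max; [exact: cf|exact: cg]. Qed.

Lemma cts_min f g : cts f -> cts g -> cts (fun x => Num.min (f x) (g x)).
Proof. by move=> cf cg x; apply: continuous_min; [exact: cf|exact: cg]. Qed.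

Lemma cts_sqrt f : cts f -> cts (fun x => Num.sqrt (f x)).
Proof.
by move=> cf; apply: (@cts_comp _ _ _ Num.sqrt) => //; exact: sqrt_continuous.
Qed.

Lemma cts_sum (I : Type) (r : seq I) (P : pred I) (F : I -> X -> R) :
  (forall i, cts (F i)) -> cts (fun x => \sum_(i <- r | P i) F i x).
Proof.
move=> cF; elim: r => [|i r IH].
  by under eq_fun do rewrite big_nil; exact: cts_cst.
under eq_fun do rewrite big_cons.
by case: (P i) => //; exact: ctsD.
Qed.

Lemma cts_big_max (I : Type) (r : seq I) (P : pred I) (F : I -> X -> R) (a : R) :
  (forall i, cts (F i)) -> cts (fun x => \big[Num.max/a]_(i <- r | P i) F i x).
Proof.
move=> cF; elim: r => [|i r IH].
  by under eq_fun do rewrite big_nil; exact: cts_cst.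
under eq_fun do rewrite big_cons.
by case: (P i) => //; exact: cts_max.
Qed.

Lemma cts_big_min (I : Type) (r : seq I) (P : pred I) (F : I -> X -> R) (a : R) :
  (forall i, cts (F i)) -> cts (fun x => \big[Num.min/a]_(i <- r | P i) F i x).
Proof.
move=> cF; elim: r => [|i r IH].
  by under eq_fun do rewrite big_nil; exact: cts_cst.
under eq_fun do rewrite big_cons.
by case: (P i) => //; exact: cts_min.
Qed.

Lemma cts_entry n (f : X -> 'rV[R]_n) i : cts f -> cts (fun x => f x ord0 i).
Proof.
move=> cf; apply: (@cts_comp _ _ _ (fun M : 'rV[R]_n => M ord0 i)) => //.
exact: coord_continuous.
Qed.

Lemma cts_row n (f : X -> 'I_n -> R) :
  (forall i, cts (f ^~ i)) -> cts (fun x => \row_i f x i : 'rV[R]_n).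
Proof.
move=> cf x U [P PU PsubU].
suff: nbhs x (fun y => forall i, P ord0 i (f y i)).
  apply: filterS => y Py; apply: PsubU => i j.
  by rewrite (ord1 i) mxE.
apply: filter_forall => i; apply: (cf i).
by have := PU ord0 i; rewrite mxE.
Qed.

End CtsReal.

Lemma cts_val {X : topologicalType} (A : set X) : cts (fun x : set_type A => \val x).
Proof. exact: initial_continuous. Qed.

Lemma cts_sub {X Y : topologicalType} (A : set X) (f : Y -> set_type A) :
  cts (fun y => \val (f y)) -> cts f.
Proof. by move=> cf; apply: continuous_comp_initial. Qed.

(** Nonvanishing of a denominator is left as a goal unless a hypothesis states it. *)
Ltac cts_step :=
  match goal with
  | |- forall _, cts _ => intro
  | H : ?P |- ?P => exact H
  | |- cts fst => exact (@cts_fst _ _ _ (fun x => x) cts_id)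
  | |- cts snd => exact (@cts_snd _ _ _ (fun x => x) cts_id)
  | |- cts (fun _ => ?y) => exact (@cts_cst _ _ y)
  | |- cts (fun x => x) => exact cts_id
  | |- cts (fun x => (@?f x) + (@?g x)) => refine (@ctsD _ _ f g _ _)
  | |- cts (fun x => (@?f x) * (@?g x)) => refine (@ctsM _ _ f g _ _)
  | |- cts (fun x => - (@?f x)) => refine (@ctsN _ _ f _)
  | |- cts (fun x => (@?f x) ^+ ?n) => refine (@ctsX _ _ f n _)
  | |- cts (fun x => (@?f x)^-1) => refine (@ctsV _ _ f _ _)
  | |- cts (fun x => Num.max (@?f x) (@?g x)) => refine (@cts_max _ _ f g _ _)
  | |- cts (fun x => Num.min (@?f x) (@?g x)) => refine (@cts_min _ _ f g _ _)
  | |- cts (fun x => Num.sqrt (@?f x)) => refine (@cts_sqrt _ _ f _)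
  | |- cts (fun x => (@?f x, @?g x)) => refine (@cts_pair _ _ _ f g _ _)
  | |- cts (fun x => (@?f x).1) => refine (@cts_fst _ _ _ f _)
  | |- cts (fun x => (@?f x).2) => refine (@cts_snd _ _ _ f _)
  | |- cts (fun x => fun_of_matrix (@?f x) _ ?i) =>
      refine (@cts_entry _ _ _ f i _)
  | H : cts ?F |- cts (fun x => ?F (@?f x)) => refine (@cts_comp _ _ _ F f H _)
  end.
Ltac cts := repeat cts_step.

Section Glue.
Context {X Y : topologicalType}.

Lemma cts_closed2 (A B : set X) (f : X -> Y) : closed A -> closed B ->
  (forall x, A x \/ B x) -> {within A, continuous f} ->
  {within B, continuous f} -> cts f.
Proof.
move=> cA cB AB fA fB; apply/continuous_subspace_setT.
rewrite (_ : setT = A `|` B); first exact: withinU_continuous.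
by apply/seteqP; split=> x // _; exact: AB.
Qed.

Lemma within_eq (A : set X) (f g : X -> Y) : cts g ->
  (forall x, A x -> f x = g x) -> {within A, continuous f}.
Proof.
move=> cg fg; apply: (@subspace_eq_continuous _ _ _ g); last exact: continuous_subspaceT.
by move=> x /set_mem Ax; rewrite /from_subspace fg.
Qed.

Lemma cts_glue2 (A B : set X) (f g h : X -> Y) : closed A -> closed B ->
  (forall x, A x \/ B x) -> cts f -> cts g -> (forall x, A x -> h x = f x) ->
  (forall x, B x -> h x = g x) -> cts h.
Proof.
move=> cA cB AB cf cg hf hg.
by apply: (cts_closed2 cA cB AB); [exact: within_eq cf _|exact: within_eq cg _].
Qed.

(** Pasting with one distinguished piece: [A] will be the old space and the [C i] the attached
    cells. The induction also carries closedness of the partial unions, which pasting the next piece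
    requires. *)
Lemma cts_closed_fin (I : finType) (C : I -> set X) (A : set X) (f : X -> Y) :
  closed A -> (forall i, closed (C i)) ->
  (forall x, A x \/ exists i, C i x) -> {within A, continuous f} ->
  (forall i, {within C i, continuous f}) -> cts f.
Proof.
move=> cA cC cov fA fC.
suff H (s : seq I) : {within A `|` \big[setU/set0]_(i <- s) C i, continuous f} /\
    closed (A `|` \big[setU/set0]_(i <- s) C i).
  have [] := H (index_enum I); rewrite (_ : A `|` _ = setT).
    by move=> cf _; exact: (continuous_subspace_setT f).2 cf.
  apply/seteqP; split=> x // _; have [|[i Ci]] := cov x; [by left|right].
  by rewrite -bigcup_seq; exists i => //=; rewrite mem_index_enum.
elim: s => [|i s [IH1 IH2]]; first by rewrite big_nil setU0.
rewrite big_cons setUCA; split; last exact: closedU.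
exact: withinU_continuous.
Qed.

End Glue.

Lemma within_sub (X Y : topologicalType) (A : set X) (f : X -> Y) :
  cts (fun a : set_type A => f (\val a)) -> {within A, continuous f}.
Proof. by move=> cf; apply/subspace_sigL_continuousP. Qed.

Section Closed.
Context {R : realType} {X : topologicalType}.

Lemma closed_le_fun (f g : X -> R) : cts f -> cts g -> closed [set x | f x <= g x].
Proof.
move=> cf cg; rewrite (_ : [set x | _] = (fun x => g x - f x) @^-1` [set y | 0 <= y]).
  apply: closed_comp; last exact: closed_ge.
  by move=> x _; exact: (ctsD cg (ctsN cf)).
by apply/seteqP; split=> x /=; rewrite subr_ge0.
Qed.

Lemma cts_ifle {Y : topologicalType} (a b : X -> R) (f g : X -> Y) :
  cts a -> cts b -> cts f -> cts g -> (forall x, a x = b x -> f x = g x) ->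
  cts (fun x => if a x <= b x then f x else g x).
Proof.
move=> ca cb cf cg fg; apply: (@cts_glue2 _ _ [set x | a x <= b x] [set x | b x <= a x] f g) => //.
- exact: closed_le_fun.
- exact: closed_le_fun.
- by move=> x; apply/orP/le_total.
- by move=> x /= ->.
- move=> x /= ba; case: ifPn => // ab; apply: fg; apply/eqP.
  by rewrite eq_le ab ba.
Qed.

End Closed.

(** * Pointed homotopy equivalences *)

(* Homotopies are required to be continuous on all of [X * R], which loses
   nothing since the time parameter can be clamped to [[0, 1]]. *)
Definition phom (R : realType) (X Y : topologicalType) (x0 : X) (f g : X -> Y) :=
  exists H : X * R -> Y, [/\ cts H, forall x, H (x, 0) = f x,
    forall x, H (x, 1) = g x & forall t, H (x0, t) = f x0].

Definition phe (R : realType) (X Y : topologicalType) (x : X) (y : Y) :=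
  exists (f : X -> Y) (g : Y -> X), [/\ cts f, cts g, f x = y /\ g y = x,
    phom R x (fun a => g (f a)) (fun a => a) &
    phom R y (fun b => f (g b)) (fun b => b)].

Section PointedHomotopy.
Context {R : realType}.
Implicit Types X Y Z W : topologicalType.

Lemma phom_eq X Y (x0 : X) (f g : X -> Y) : cts f -> f =1 g -> phom R x0 f g.
Proof.
move=> cf fg; exists (fun z => f z.1); split=> //.
exact: (cts_comp cf (cts_fst cts_id)).
Qed.

Lemma phom_trans X Y (x0 : X) (f g h : X -> Y) :
  phom R x0 f g -> phom R x0 g h -> phom R x0 f h.
Proof.
move=> [H1 [cH1 H10 H11 H1x]] [H2 [cH2 H20 H21 H2x]].
exists (fun z => if z.2 <= 2^-1 then H1 (z.1, 2 * z.2) else H2 (z.1, 2 * z.2 - 1)).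
split=> /=.
- apply: cts_ifle; cts.
  by move=> [x t] /= ->; rewrite mulfV // subrr H11 H20.
- by move=> x; rewrite invr_ge0 ler0n mulr0 H10.
- move=> x; rewrite ifF; last by apply/negbTE; rewrite -ltNge; lra.
  by rewrite (_ : 2 * 1 - 1 = 1) ?H21 //; lra.
- by move=> t; case: ifP => _; rewrite ?H1x // H2x -H11 H1x.
Qed.

Lemma phom_comp X Y Z W (z0 : Z) (x0 : X) (k : Z -> X) (f g : X -> Y) (h : Y -> W) :
  cts k -> k z0 = x0 -> cts h -> phom R x0 f g ->
  phom R z0 (fun z => h (f (k z))) (fun z => h (g (k z))).
Proof.
move=> ck kz ch [H [cH H0 H1 Hx]].
exists (fun z => h (H (k z.1, z.2))); split=> [|x|x|t] /=.
- by cts.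
- by rewrite H0.
- by rewrite H1.
- by rewrite kz Hx.
Qed.

Lemma phe_trans Y X Z (y : Y) (x : X) (z : Z) :
  phe R x y -> phe R y z -> phe R x z.
Proof.
move=> [f [g [cf cg [fx gy] h1 h2]]] [f' [g' [cf' cg' [fy gz] h1' h2']]].
exists (fun a => f' (f a)), (fun a => g (g' a)); split.
- exact: cts_comp.
- exact: cts_comp.
- by rewrite fx fy gz gy.
- exact: phom_trans (phom_comp cf fx cg h1') h1.
- exact: phom_trans (phom_comp cg' gz cf' h2) h2'.
Qed.

Lemma phe_homeo X Y (x : X) (y : Y) (f : X -> Y) (g : Y -> X) :
  cts f -> cts g -> cancel f g -> cancel g f -> f x = y -> phe R x y.
Proof.
move=> cf cg fg gf fx; exists f, g; split=> //.
- by rewrite -fx fg.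
- by apply: phom_eq => //; exact: cts_comp.
- by apply: phom_eq => //; exact: cts_comp.
Qed.

Lemma phom_homotopic X Y (x : X) (f g : X -> Y) : phom R x f g -> homotopic R f g.
Proof.
by move=> [H [cH H0 H1 _]]; exists H; split=> //; exact: continuous_subspaceT.
Qed.

Lemma phe_homotopy_equivalent X Y (x : X) (y : Y) :
  phe R x y -> homotopy_equivalent R X Y.
Proof.
move=> [f [g [cf cg _ h1 h2]]]; exists f, g.
by split=> //; apply: phom_homotopic; [exact: h1|exact: h2].
Qed.

End PointedHomotopy.

(** * Wedges of spheres *)

Lemma sub_hausdorff (X : topologicalType) (A : set X) :
  hausdorff_space X -> hausdorff_space (set_type A).
Proof.
move=> hX x y xy; apply: val_inj; apply: hX => U V Ux Vy.
have [z [Uz Vz]] := xy _ _ (cts_val Ux) (cts_val Vy).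
by exists (\val z).
Qed.

Section WedgeSpheres.
Context {R : realType} {d n : nat} {X : topologicalType} (x0 : X).
Local Notation W := (@wedge_spheres R d n X x0).
Local Notation p0 := (@wedge_spheres_pt R d n X x0).

Definition wbase (x : X) : W := wedge_lift p0 (i := None) x.
Definition wsph (l : 'I_n) (s : set_type (sphere R d)) : W :=
  wedge_lift p0 (i := Some l) s.

Lemma wbase_cts : cts wbase.
Proof. exact: (@wedge_lift_continuous _ _ p0 None). Qed.

Lemma wsph_cts l : cts (wsph l).
Proof. exact: (@wedge_lift_continuous _ _ p0 (Some l)). Qed.

Lemma wsph_pt l : wsph l (sphere_pt R d) = wbase x0.
Proof. exact: (@wedge_liftE _ _ p0 None x0 (Some l) (sphere_pt R d)). Qed.

Lemma wedge_spheres_ind (P : W -> Prop) :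
  (forall x, P (wbase x)) -> (forall l s, P (wsph l s)) -> forall w, P w.
Proof.
move=> Pb Ps w.
have : (\bigcup_i (@wedge_lift _ _ p0 i) @` setT) w by rewrite wedgeTE.
by case=> -[l|] _ [z _ <-]; [exact: Ps|exact: Pb].
Qed.

Section Fun.
Context {Z : topologicalType} (k : X -> Z) (s : 'I_n -> set_type (sphere R d) -> Z).

Definition wfam (i : option 'I_n) : wedge_spheres_family R d X i -> Z :=
  match i with Some l => s l | None => k end.

Definition wfun : W -> Z := wedge_fun wfam.

Hypothesis sk : forall l, s l (sphere_pt R d) = k x0.

Let wfam_pt i j : wfam (p0 i) = wfam (p0 j).
Proof. by case: i => [i|]; case: j => [j|] //=; rewrite !sk. Qed.

Lemma wfun_base x : wfun (wbase x) = k x.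
Proof. exact: (@wedge_lift_funE _ _ p0 _ wfam None). Qed.

Lemma wfun_sph l z : wfun (wsph l z) = s l z.
Proof. exact: (@wedge_lift_funE _ _ p0 _ wfam (Some l)). Qed.

Lemma wfun_cts : cts k -> (forall l, cts (s l)) -> cts wfun.
Proof.
by move=> ck cs; apply: wedge_fun_continuous => // -[l|]; [exact: cs|exact: ck].
Qed.

End Fun.

Lemma sphere_hausdorff : hausdorff_space (set_type (sphere R d)).
Proof. exact/sub_hausdorff/norm_hausdorff. Qed.

Lemma wedge_spheres_hausdorff : hausdorff_space X -> hausdorff_space W.
Proof.
by move=> hX; apply: wedge_hausdorff => -[l|]; [exact: sphere_hausdorff|].
Qed.

(** Homotopies on a wedge must be continuous in point and time jointly, which continuity at each
    time does not give. The joint criterion asks for finitely many components and closed base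
    points; Hausdorffness of [X] supplies the latter. *)
Lemma wfun_joint (Z : topologicalType) (k : X * R -> Z)
    (s : 'I_n -> set_type (sphere R d) * R -> Z) :
  hausdorff_space X -> cts k -> (forall l, cts (s l)) ->
  (forall l t, s l (sphere_pt R d, t) = k (x0, t)) ->
  exists H : W * R -> Z, [/\ cts H, forall x t, H (wbase x, t) = k (x, t) &
    forall l z t, H (wsph l z, t) = s l (z, t)].
Proof.
move=> hX ck cs sk.
pose K i (t : R) := @wfam Z (fun x => k (x, t)) (fun l z => s l (z, t)) i.
have Kpt t i j : K i t (p0 i) = K j t (p0 j).
  by case: i => [i|]; case: j => [j|] //=; rewrite !sk.
exists (fun z => wedge_fun (p0 := p0) (K ^~ z.2) z.1); split.
(* The joint criterion takes time as its first variable, hence the swap of coordinates. *)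
- suff : continuous (uncurry (fun t => wedge_fun (p0 := p0) (K^~ t))).
    move=> cK; apply: (@cts_comp _ _ _ _ (fun z : W * R => (z.2, z.1)) cK).
    by cts.
  apply: wedge_fun_joint_continuous => //.
  + exact: finite_finset.
  + case=> [l|]; apply: accessible_closed_set1; apply: hausdorff_accessible => //.
    exact: sphere_hausdorff.
  + case=> [l|].
    * rewrite (_ : uncurry _ = fun z => s l (z.2, z.1)); last by apply/funext => -[].
      by apply: (@cts_comp _ _ _ (s l) (fun z => (z.2, z.1))); cts.
    * rewrite (_ : uncurry _ = fun z => k (z.2, z.1)); last by apply/funext => -[].
      by apply: (@cts_comp _ _ _ k (fun z => (z.2, z.1))); cts.
- by move=> x t; rewrite /= (@wedge_lift_funE _ _ p0 _ (K^~ t) None).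
- by move=> l z t; rewrite /= (@wedge_lift_funE _ _ p0 _ (K^~ t) (Some l)).
Qed.

End WedgeSpheres.

Arguments wbase {R d n X} x0.
Arguments wsph {R d n X} x0.

Section WedgeMap.
Context {R : realType} {d n : nat}.

(** The homotopy on the base component and the stationary one on the spheres agree at the wedge
    point precisely because the former fixes the base point. *)
Lemma phe_wedge_spheres (X Y : topologicalType) (x : X) (y : Y) :
  hausdorff_space X -> hausdorff_space Y -> phe R x y ->
  phe R (@wbase R d n X x x) (@wbase R d n Y y y).
Proof.
move=> hX hY [f [g [cf cg [fx gy] h1 h2]]].
(* One half of the equivalence, used for the pair [f], [g] and again with the roles exchanged. *)
have main (A B : topologicalType) (a : A) (b : B) (p : A -> B) (q : B -> A) :
    hausdorff_space A -> cts p -> cts q -> p a = b -> q b = a ->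
    phom R a (fun z => q (p z)) (fun z => z) ->
    let P := @wfun R d n A a _ (fun z => wbase b (p z)) (wsph b) in
    let Q := @wfun R d n B b _ (fun z => wbase a (q z)) (wsph a) in
    [/\ cts P, P (wbase a a) = wbase b b,
       Q (wbase b b) = wbase a a & phom R (wbase a a) (fun z => Q (P z)) (fun z => z)].
  move=> hA cp cq pa qb [H [cH H0 H1 Ha]] P Q.
  have sk l : wsph b l (sphere_pt R d) = wbase b (p a) by rewrite wsph_pt pa.
  have sk' l : wsph a l (sphere_pt R d) = wbase a (q b) by rewrite wsph_pt qb.
  have Pb z : P (wbase a z) = wbase b (p z) by rewrite /P wfun_base.
  have Qb z : Q (wbase b z) = wbase a (q z) by rewrite /Q wfun_base.
  have Ps l z : P (wsph a l z) = wsph b l z by rewrite /P wfun_sph.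
  have Qs l z : Q (wsph b l z) = wsph a l z by rewrite /Q wfun_sph.
  split; rewrite ?Pb ?Qb ?pa ?qb //.
    apply: wfun_cts => //; first exact: cts_comp (@wbase_cts _ _ _ _ _) cp.
    by move=> l; exact: wsph_cts.
  have [|l|l|G [cG Gb Gs]] := @wfun_joint R d n A a _ (fun z => wbase a (H z))
      (fun l z => wsph a l z.1) hA.
  - exact: cts_comp (@wbase_cts _ _ _ _ _) cH.
  - by apply: (cts_comp (@wsph_cts _ _ _ _ _ l)); cts.
  - by move=> t; rewrite /= wsph_pt Ha pa qb.
  exists G; split=> //.
  - by apply: wedge_spheres_ind => [z|l z]; rewrite ?Gb ?Gs ?Pb ?Ps ?Qb ?Qs ?H0.
  - by apply: wedge_spheres_ind => [z|l z]; rewrite ?Gb ?Gs ?H1.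
  - by move=> t; rewrite Gb Ha Pb Qb pa.
have [cP Pb Qb hP] := main _ _ x y f g hX cf cg fx gy h1.
have [cQ _ _ hQ] := main _ _ y x g f hY cg cf gy fx h2.
by eexists; eexists; split; [exact: cP|exact: cQ|split; [exact: Pb|exact: Qb]|exact: hP|exact: hQ].
Qed.

End WedgeMap.

Section Bouquet.
Context {R : realType} {d : nat}.

Definition bouquet_pt n : bouquet R d n :=
  @wbase R d n (discrete_topology unit) tt tt.

Lemma bouquet_hausdorff n : hausdorff_space (bouquet R d n).
Proof. exact/wedge_spheres_hausdorff/discrete_hausdorff. Qed.

(** A homeomorphism: the base component of a bouquet is a single point, so the spheres of both
    levels are merely reindexed along ['I_(n + a)]. *)
Lemma phe_bouquet_add n a :
  phe R (@wbase R d a _ (bouquet_pt n) (bouquet_pt n)) (bouquet_pt (n + a)).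
Proof.
pose u : discrete_topology unit := tt.
pose f0 : bouquet R d n -> bouquet R d (n + a) :=
  wfun (x0 := u) (fun=> bouquet_pt (n + a)) (fun l => wsph u (lshift a l)).
pose f : @wedge_spheres R d a _ (bouquet_pt n) -> bouquet R d (n + a) :=
  wfun f0 (fun l => wsph u (rshift n l)).
pose gs (l : 'I_(n + a)) (z : set_type (sphere R d)) :
    @wedge_spheres R d a _ (bouquet_pt n) :=
  match fintype.split l with
  | inl j => wbase (bouquet_pt n) (wsph u j z)
  | inr j => wsph (bouquet_pt n) j z end.
pose g : bouquet R d (n + a) -> @wedge_spheres R d a _ (bouquet_pt n) :=
  wfun (x0 := u) (fun=> wbase (bouquet_pt n) (bouquet_pt n)) gs.
have skf0 (l : 'I_n) : wsph u (lshift a l) (sphere_pt R d) = bouquet_pt (n + a).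
  exact: wsph_pt.
have f0b x : f0 (wbase u x) = bouquet_pt (n + a) by rewrite /f0 wfun_base.
have skf (l : 'I_a) : wsph u (rshift n l) (sphere_pt R d) = f0 (bouquet_pt n).
  by rewrite /bouquet_pt f0b wsph_pt.
have f0s l z : f0 (wsph u l z) = wsph u (lshift a l) z by rewrite /f0 wfun_sph.
have skg l : gs l (sphere_pt R d) = wbase (bouquet_pt n) (bouquet_pt n).
  by rewrite /gs; case: (fintype.split l) => j; rewrite wsph_pt.
have fb z : f (wbase (bouquet_pt n) z) = f0 z by rewrite /f wfun_base.
have fs l z : f (wsph (bouquet_pt n) l z) = wsph u (rshift n l) z.
  by rewrite /f wfun_sph.
have gb x : g (wbase u x) = wbase (bouquet_pt n) (bouquet_pt n).
  by rewrite /g wfun_base.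
have gsE l z : g (wsph u l z) = gs l z by rewrite /g wfun_sph.
apply: (@phe_homeo _ _ _ _ _ f g).
- apply: wfun_cts => // [|l]; last exact: wsph_cts.
  by apply: wfun_cts => // [|l]; [exact: cts_cst|exact: wsph_cts].
- apply: wfun_cts => // [|l]; first exact: cts_cst.
  rewrite /gs; case: (fintype.split l) => j; last exact: wsph_cts.
  exact: cts_comp (@wbase_cts _ _ _ _ _) (@wsph_cts _ _ _ _ _ j).
- apply: wedge_spheres_ind => [|l z]; last first.
    by rewrite fs gsE /gs (unsplitK (inr l)).
  apply: wedge_spheres_ind => [[]|l z]; first by rewrite fb f0b gb.
  by rewrite fb f0s gsE /gs (unsplitK (inl l)).
- apply: wedge_spheres_ind => [[]|l z]; first by rewrite gb fb f0b.
  rewrite gsE /gs; have := splitK l.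
  by case: (fintype.split l) => j /= <-; rewrite ?fb ?f0s ?fs.
- by rewrite fb f0b.
Qed.

End Bouquet.

(** * The gauge of a triangle *)

Lemma sum3_eq0 (R : realType) (a b c : R) : a ^+ 2 + b ^+ 2 + c ^+ 2 = 0 ->
  [/\ a = 0, b = 0 & c = 0].
Proof. by move=> h; split; nra. Qed.

Section Gauge.
Context {R : realType}.
Implicit Types y : R * R.

(* The barycentric coordinates [1/3 + y.1], [1/3 + y.2], [1/3 - y.1 - y.2] are
   all nonnegative iff [rho y <= 1]. *)
Definition rho y : R := 3 * Num.max (Num.max (- y.1) (- y.2)) (y.1 + y.2).
Definition sc (a : R) y : R * R := (a * y.1, a * y.2).
(** Radial retraction of the plane onto the triangle [rho <= 1]; it extends maps defined on the
    closed cell to the whole plane. *)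
Definition clamp y : R * R := sc (Num.max 1 (rho y))^-1 y.
Definition nsq y : R := y.1 ^+ 2 + y.2 ^+ 2.

Lemma rho_ge0 y : 0 <= rho y.
Proof. by rewrite /rho /Num.max; case: (ltP (- y.1)) => ?; case: ltP => ?; lra. Qed.

Lemma rho_sc a y : 0 <= a -> rho (sc a y) = a * rho y.
Proof.
move=> a0; rewrite /rho /= -!mulrN -mulrDr -!maxr_pMr //; first by rewrite mulrCA.
Qed.

(** By homogeneity this says that the triangle [rho <= 1] lies in the Euclidean unit disc. It lets
    the equator of the sphere, the unit circle, be sent to the boundary of the triangle by
    [clamp]. *)
Lemma nsq_le_rho y : nsq y <= rho y ^+ 2.
Proof.
rewrite /rho /nsq /Num.max; case: y => a b /=.
by case: (ltP (- a)) => ?; case: ltP => ?; nra.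
Qed.

Lemma nsq_ge0 y : 0 <= nsq y.
Proof. by rewrite /nsq addr_ge0 ?sqr_ge0. Qed.

Lemma nsq_eq0 y : nsq y = 0 -> y = (0, 0).
Proof. by case: y => a b; rewrite /nsq /= => h; congr pair; nra. Qed.

Lemma rho0 : rho (0, 0) = 0.
Proof. by rewrite /rho /= addr0 oppr0 maxxx maxxx mulr0. Qed.

Lemma rho_ge1 y : 1 <= nsq y -> 1 <= rho y.
Proof. by move=> h; have := nsq_le_rho y; have := rho_ge0 y; nra. Qed.

Lemma sc1 y : sc 1 y = y.
Proof. by case: y => a b; rewrite /sc /= !mul1r. Qed.

Lemma sc0 y : sc 0 y = (0, 0).
Proof. by rewrite /sc !mul0r. Qed.

Lemma scA a b y : sc a (sc b y) = sc (a * b) y.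
Proof. by rewrite /sc /= !mulrA. Qed.

Lemma clamp_id y : rho y <= 1 -> clamp y = y.
Proof. by move=> h; rewrite /clamp max_l // invr1 sc1. Qed.

Lemma rho_clamp1 y : 1 <= rho y -> rho (clamp y) = 1.
Proof.
move=> h; rewrite /clamp max_r // rho_sc ?invr_ge0 ?rho_ge0 // mulVf //.
by rewrite gt_eqF //; lra.
Qed.

Lemma rho_clamp_le1 y : rho (clamp y) <= 1.
Proof.
by have [h|/ltW h] := leP (rho y) 1; [rewrite clamp_id|rewrite rho_clamp1].
Qed.

Lemma clamp_sc a y : 1 <= a -> 1 <= rho y -> clamp (sc a y) = clamp y.
Proof.
move=> a1 h; have a0 : 0 < a by lra.
rewrite /clamp rho_sc ?ltW // !max_r //; last by nra.
by rewrite scA invfM mulrAC mulVf ?mul1r // gt_eqF.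
Qed.

Lemma rho_cts : cts rho.
Proof. by rewrite /rho; cts. Qed.

Lemma nsq_cts : cts nsq.
Proof. by rewrite /nsq; cts. Qed.

Lemma cts_sc (X : topologicalType) (a : X -> R) (y : X -> R * R) :
  cts a -> cts y -> cts (fun x => sc (a x) (y x)).
Proof. by move=> ca cy; rewrite /sc; cts. Qed.

Lemma clamp_cts : cts clamp.
Proof.
have := rho_cts; move=> ?.
apply: cts_sc; cts => x.
by rewrite gt_eqF // lt_max ltr01.
Qed.

(** * The sphere as a quotient of the triangle *)

Definition mk3 (a b c : R) : 'rV[R]_3 := \row_i nth 0 [:: a; b; c] i.
Definition i0 : 'I_3 := ord0.
Definition i1 : 'I_3 := @Ordinal 3 1 isT.
Definition i2 : 'I_3 := @Ordinal 3 2 isT.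

Lemma row3P (u v : 'rV[R]_3) : u ord0 i0 = v ord0 i0 -> u ord0 i1 = v ord0 i1 ->
  u ord0 i2 = v ord0 i2 -> u = v.
Proof.
move=> h0 h1 h2; apply/rowP => i.
have [-> //|[-> //|-> //]] : i = i0 \/ (i = i1 \/ i = i2).
by case: i => -[|[|[|//]]] hi; [left|right; left|right; right]; apply: val_inj.
Qed.

Lemma sum3 (f : 'I_3 -> R) : \sum_i f i = f i0 + f i1 + f i2.
Proof.
rewrite !big_ord_recl big_ord0 addr0 -addrA.
by congr (f _ + (f _ + f _)); apply: val_inj.
Qed.

Lemma cts_mk3 (X : topologicalType) (a b c : X -> R) : cts a -> cts b -> cts c ->
  cts (fun x => mk3 (a x) (b x) (c x)).
Proof. by move=> ca cb cc; apply: cts_row => -[[|[|[|//]]] hi] /=. Qed.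

(** [qvec y] is the inverse stereographic projection of [y / gap y] from the pole (1, 0, 0), in
    homogeneous form so that [gap y = 0] is allowed. The barycentre goes to the opposite pole, and
    all points with [rho y >= 1/2] go to the base point. *)
Definition gap y : R := Num.max 0 (1 - 2 * rho y).
Definition qden y : R := nsq y + gap y ^+ 2.
Definition qvec y : 'rV[R]_3 := mk3 ((nsq y - gap y ^+ 2) / qden y)
  (2 * gap y / qden y * y.1) (2 * gap y / qden y * y.2).

Lemma qden_gt0 y : 0 < qden y.
Proof.
rewrite /qden; have := nsq_ge0 y; rewrite le_eqVlt => /predU1P[/esym h|h].
  by rewrite h (nsq_eq0 h) /gap rho0 max_r; lra.
by rewrite ltr_pwDl // sqr_ge0.
Qed.

Lemma gap_cts : cts gap.
Proof. by rewrite /gap; have := rho_cts; move=> ?; cts. Qed.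

Lemma qden_cts : cts qden.
Proof. by rewrite /qden; have := gap_cts; have := nsq_cts; move=> ? ?; cts. Qed.

Lemma qvec_sphere y : qvec y \in sphere R 2.
Proof.
rewrite inE /sphere /= sum3 !mxE /=.
have := qden_gt0 y; rewrite /qden /nsq => h.
by field; rewrite gt_eqF.
Qed.

Definition qmap y : set_type (sphere R 2) := SigSub (qvec_sphere y).

Lemma qmap_cts : cts qmap.
Proof.
apply: cts_sub => /=; have := gap_cts; have := nsq_cts; have := qden_cts.
have qV y : qden y != 0 by rewrite gt_eqF // qden_gt0.
by move=> ? ? ?; apply: cts_mk3; cts.
Qed.

Lemma sphere_pt_vec : \val (sphere_pt R 2) = mk3 1 0 0.
Proof. by apply: row3P; rewrite !mxE. Qed.

Lemma qmap_pt y : 2^-1 <= rho y -> qmap y = sphere_pt R 2.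
Proof.
move=> h; apply: val_inj; rewrite sphere_pt_vec /= /qvec.
have g0 : gap y = 0 by rewrite /gap max_l //; lra.
have := qden_gt0 y; rewrite /qden g0 !mulr0 !mul0r expr0n subr0 addr0 => h'.
by rewrite divff // gt_eqF.
Qed.

End Gauge.

(** * Attaching triangles along null-homotopic boundaries *)

Section Attach.
Context {R : realType} {n : nat} {X Y : topologicalType} (x0 : X).
(** [Y] is [X] with the cells [C l] attached; [c l] parametrizes a cell by the whole plane through
    [clamp], and [d l] reads the coordinates back. [Psi l] fills the boundary of the cell inside
    [X], with centre at the base point. The left inverse [j] is arbitrary off the range of [i], so
    its continuity is only assumed, in [cj], along maps into that range. *)
Variables (i : X -> Y) (j : Y -> X) (C : 'I_n -> set Y).
Variables (c : 'I_n -> R * R -> Y) (d : 'I_n -> Y -> R * R).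
Variable Psi : 'I_n -> R * R -> X.

Hypothesis hX : hausdorff_space X.
Hypothesis ci : cts i.
Hypothesis jK : cancel i j.
Hypothesis cj : forall (T : topologicalType) (p : T -> Y), cts p ->
  (forall t, range i (p t)) -> cts (fun t => j (p t)).
Hypothesis closed_i : closed (range i).
Hypothesis closed_C : forall l, closed (C l).
Hypothesis cover : forall y, range i y \/ exists l, C l y.
Hypothesis disj : forall l l' y, C l y -> C l' y -> l != l' -> range i y.
Hypothesis cc : forall l, cts (c l).
Hypothesis cd : forall l, cts (d l).
Hypothesis cC : forall l y, C l (c l y).
Hypothesis dK : forall l y, C l y -> c l (d l y) = y.
Hypothesis cK : forall l y, d l (c l y) = clamp y.
Hypothesis bd : forall l x, C l (i x) -> rho (d l (i x)) = 1.
Hypothesis cPsi : forall l, cts (Psi l).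
Hypothesis Psi0 : forall l, Psi l (0, 0) = x0.
Hypothesis Psi1 : forall l y, 1 <= rho y -> i (Psi l y) = c l y.

Lemma c_clamp l y : c l (clamp y) = c l y.
Proof. by rewrite -(cK l) dK. Qed.

Lemma rho_d l y : C l y -> rho (d l y) <= 1.
Proof. by move=> Cy; rewrite -(dK Cy) cK rho_clamp_le1. Qed.

Lemma c_sc l a y : 1 <= a -> 1 <= rho y -> c l (sc a y) = c l y.
Proof. by move=> a1 y1; rewrite -c_clamp clamp_sc // c_clamp. Qed.

Lemma Psi_clamp l y : Psi l (clamp y) = Psi l y.
Proof.
have [h|/ltW h] := leP (rho y) 1; first by rewrite clamp_id.
by apply: (can_inj jK); rewrite !Psi1 ?c_clamp // rho_clamp1.
Qed.

(** Compatibility is needed only between a cell and [X]: by [disj] two different cells meet inside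
    [X]. The time parameter is carried along so that the same lemma produces maps and homotopies. *)
Lemma attach_glue (Z : topologicalType) (k : X * R -> Z)
    (h : 'I_n -> (R * R) * R -> Z) :
  cts k -> (forall l, cts (h l)) ->
  (forall l x t, C l (i x) -> h l (d l (i x), t) = k (x, t)) ->
  exists H : Y * R -> Z, [/\ cts H, forall x t, H (i x, t) = k (x, t) &
    forall l y t, C l y -> H (y, t) = h l (d l y, t)].
Proof.
move=> ck ch hk.
(* The last branch is a dummy value, excluded by [cover]. *)
pose H (z : Y * R) := if pselect (range i z.1) then k (j z.1, z.2)
  else if [pick l | `[<C l z.1>]] is Some l then h l (d l z.1, z.2) else k (x0, z.2).
have Hi x t : H (i x, t) = k (x, t).
  by rewrite /H /=; case: pselect => [r|[]]; [rewrite jK|exists x].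
have HC l y t : C l y -> H (y, t) = h l (d l y, t).
  move=> Cy; have [[x _ xy]|ny] := pselect (range i y).
    by rewrite -xy Hi hk // xy.
  rewrite /H /=; case: pselect => // r; case: pickP => [l' /asboolP Cl'|/(_ l)].
    by have [->//|ll'] := eqVneq l' l; case: ny; exact: disj ll'.
  by move/asboolPn.
exists H; split=> //.
have c1 (A : set Y) : closed A -> closed [set z : Y * R | A z.1].
  move=> cA; apply: (@closed_comp _ _ fst) => // z _.
  exact: (@cts_fst _ _ _ (fun z => z) cts_id).
apply: (@cts_closed_fin _ _ _ (fun l => [set z | C l z.1]) [set z | range i z.1]).
- exact: c1.
- by move=> l; exact: c1.
- by move=> z; exact: cover.
- apply: within_sub.
  rewrite (_ : (fun a => _) = fun a => k (j (\val a).1, (\val a).2)).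
    apply: (cts_comp ck); apply: cts_pair.
      apply: cj; first exact/cts_fst/cts_val.
      by move=> a; have := valP a; rewrite inE.
    exact/cts_snd/cts_val.
  apply/funext => -[[y t] /= ya]; have := ya; rewrite inE /= => -[x _ <-].
  by rewrite Hi jK.
- move=> l; apply: (@within_eq _ _ _ _ (fun z => h l (d l z.1, z.2))).
    by have [hl dl] := (ch l, @cd l); cts.
  by move=> [y t] /=; exact: HC.
Qed.

(** * The comparison maps between the attached space and the wedge, and their homotopies *)

Let W := @wedge_spheres R 2 n X x0.
Let half : R := 2^-1.

(* The inner half of a cell wraps around the sphere; on the outer half [Psi]
   contracts the boundary to the base point. *)
Definition cell_out l (y : R * R) : W :=
  if rho y <= half then wsph x0 l (qmap y)
  else wbase x0 (Psi l (sc (2 * rho y - 1) y)).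

Lemma cell_out_cts l : cts (cell_out l).
Proof.
have rc := @rho_cts R; have qc := @qmap_cts R; have wc := @wsph_cts R 2 n X x0 l.
have wb := @wbase_cts R 2 n X x0; have Pc := @cPsi l.
apply: cts_ifle => //; first exact: cts_cst.
- exact: cts_comp wc qc.
- by apply: (cts_comp wb); apply: (cts_comp Pc); apply: cts_sc; cts.
- move=> y /= e; rewrite qmap_pt ?e // wsph_pt; congr wbase.
  by rewrite /half mulfV // subrr sc0 Psi0.
Qed.

(* The southern hemisphere goes to the cell, the northern one to its filling
   [Psi]. *)
Definition sph_in l (s : set_type (sphere R 2)) : Y :=
  let v := \val s in
  if v ord0 i0 <= 0 then c l (v ord0 i1, v ord0 i2)
  else i (Psi l (v ord0 i1, v ord0 i2)).

Lemma sphere_eq (s : set_type (sphere R 2)) :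
  (\val s) ord0 i0 ^+ 2 + nsq ((\val s) ord0 i1, (\val s) ord0 i2) = 1.
Proof. by have := valP s; rewrite inE /sphere /= sum3 /nsq /= addrA. Qed.

Lemma cts_sphere (l : 'I_3) : cts (fun s : set_type (sphere R 2) => (\val s) ord0 l).
Proof. exact/cts_entry/cts_val. Qed.

Lemma equator_rho (s : set_type (sphere R 2)) : (\val s) ord0 i0 = 0 ->
  1 <= rho ((\val s) ord0 i1, (\val s) ord0 i2).
Proof. by move=> e; apply: rho_ge1; have := sphere_eq s; rewrite e; lra. Qed.

Lemma sph_in_cts l : cts (sph_in l).
Proof.
have [c0 c1 c2] := And3 (@cts_sphere i0) (@cts_sphere i1) (@cts_sphere i2).
have [Cc Pc] := (@cc l, @cPsi l).
rewrite /sph_in; apply: cts_ifle => //; first exact: cts_cst.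
- by apply: (cts_comp Cc); apply: cts_pair.
- by apply: (cts_comp ci); apply: (cts_comp Pc); apply: cts_pair.
- by move=> s /equator_rho h; rewrite Psi1.
Qed.

Lemma sph_in_pt l : sph_in l (sphere_pt R 2) = i x0.
Proof.
rewrite /sph_in sphere_pt_vec !mxE /= ifF ?Psi0 //.
by apply/negbTE; rewrite -ltNge ltr01.
Qed.

(** Going from a cell to the wedge and back rescales it radially by [lam], then applies [c l] where
    [nsq y <= gap y ^+ 2] and [Psi l] elsewhere. The first summand is the factor in the lateral
    coordinates of [qvec], the second the factor of the outer half; at every point at least one of
    them vanishes. *)
Definition lam (y : R * R) : R := 2 * gap y / qden y + Num.max 0 (2 * rho y - 1).

Lemma lam_cts : cts lam.
Proof.
have rc := @rho_cts R; have gc := @gap_cts R; have qc := @qden_cts R.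
by rewrite /lam; cts => y; rewrite gt_eqF // qden_gt0.
Qed.

Lemma gap_ge0 (y : R * R) : 0 <= gap y.
Proof. by rewrite /gap le_max lexx. Qed.

Lemma lam_ge0 (y : R * R) : 0 <= lam y.
Proof.
rewrite /lam addr_ge0 ?le_max ?lexx // divr_ge0 ?mulr_ge0 ?gap_ge0 //.
by rewrite ltW // qden_gt0.
Qed.

(** On the preimage of the equator the rescaled point lies outside the open triangle, where [c l]
    and [Psi l] agree. There [lam y] is at least the inverse of [gap y], and [gap y <= rho y] since
    [nsq y <= rho y ^+ 2]. *)
Lemma rho_lam_eq (y : R * R) : nsq y = gap y ^+ 2 -> 1 <= lam y * rho y.
Proof.
move=> e; have g0 : 0 < gap y.
  have := qden_gt0 y; rewrite /qden e => h.
  by rewrite lt_neqAle gap_ge0 andbT; apply: contraTneq h => <-; rewrite expr0n addr0 ltxx.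
have gr : gap y <= rho y.
  by have := nsq_le_rho y; rewrite e ler_sqr // nnegrE ?rho_ge0 ?ltW.
have -> : lam y = (gap y)^-1 + Num.max 0 (2 * rho y - 1).
  rewrite /lam /qden e; congr (_ + _).
  have -> : gap y ^+ 2 + gap y ^+ 2 = 2 * gap y * gap y by ring.
  by rewrite invfM mulrA mulfV ?mul1r // mulf_neq0 // gt_eqF.
rewrite mulrDl ler_wpDr //; last by rewrite mulrC ler_pdivlMr ?mul1r.
by rewrite mulr_ge0 ?rho_ge0 // le_max lexx.
Qed.

Lemma lam_boundary (y : R * R) : rho y = 1 -> lam y = 1.
Proof.
move=> e; rewrite /lam /gap e [X in 2 * X]max_l; last by lra.
by rewrite mulr0 mul0r add0r max_r; lra.
Qed.

(** Here [1 - 2 * rho y <= gap y <= rho y]. This is the origin of the factor 3 in the homotopy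
    below: adding 3 to the scale pushes all these points out of the open triangle. *)
Lemma rho_outer (y : R * R) : gap y ^+ 2 < nsq y -> 1 <= 3 * rho y.
Proof.
move=> h; have := nsq_le_rho y; have := rho_ge0 y; have := gap_ge0 y.
have : 1 - 2 * rho y <= gap y by rewrite /gap le_max lexx orbT.
by nra.
Qed.

Lemma attach_phe : phe R (i x0) (@wbase R 2 n X x0 x0).
Proof.
have rc := @rho_cts R; have gc := @gap_cts R; have qc := @qden_cts R.
have nc := @nsq_cts R; have lc := lam_cts; have clc := @clamp_cts R.
have qmc := @qmap_cts R; have wb := @wbase_cts R 2 n X x0.
have wc := @wsph_cts R 2 n X x0.
have [c0 c1 c2] := And3 (@cts_sphere i0) (@cts_sphere i1) (@cts_sphere i2).
have [||l x t Cx|fH [cfH fHi fHC]] := @attach_glue W (fun z => wbase x0 z.1)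
    (fun l z => cell_out l z.1).
- by cts.
- by move=> l; have := @cell_out_cts l; move=> ?; cts.
- rewrite /cell_out /= (bd Cx) ifF; last by apply/negbTE; rewrite -ltNge /half; lra.
  congr wbase; apply: (can_inj jK).
  by rewrite (_ : 2 * 1 - 1 = 1) ?sc1 ?Psi1 ?(bd Cx) ?(dK Cx) //; lra.
pose f y := fH (y, 0).
have cf : cts f by rewrite /f; cts.
have fi x : f (i x) = wbase x0 x by exact: fHi.
have fC l y : C l y -> f y = cell_out l (d l y) by exact: fHC.
pose g : W -> Y := wfun i sph_in.
have skg l : sph_in l (sphere_pt R 2) = i x0 by exact: sph_in_pt.
have cg : cts g by apply: wfun_cts => // l; exact: sph_in_cts.
have gb x : g (wbase x0 x) = i x by rewrite /g wfun_base.
have gs l s : g (wsph x0 l s) = sph_in l s by rewrite /g wfun_sph.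
exists f, g; split=> //.
(* First stage: the scale grows from [lam] to [lam + 3]. At the end every point still sent through
   [Psi l] has gauge at least 1, so [Psi l] may be replaced by [c l]. *)
- pose st (z : (R * R) * R) := sc (lam z.1 + 3 * Num.max 0 z.2) z.1.
  have sC : cts st by apply: cts_sc; cts.
  pose cl (t : R) : R := Num.max 0 (Num.min 1 t).
  have clC : cts cl by rewrite /cl; cts.
  have [||l x t Cx|H1 [cH1 H1i H1C]] := @attach_glue Y (fun z => i z.1)
      (fun l z => if nsq z.1 <= gap z.1 ^+ 2 then c l (st z) else i (Psi l (st z))).
  + by cts.
  + move=> l; have [Cc Pc] := (@cc l, @cPsi l).
    apply: cts_ifle; cts.
    move=> [y t] /= /rho_lam_eq h; rewrite Psi1 //.
    have t0 : 0 <= Num.max 0 t by rewrite le_max lexx.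
    have := lam_ge0 y; have := rho_ge0 y => r0 l0.
    rewrite rho_sc; [nra|lra].
  + rewrite /= /st /= (lam_boundary (bd Cx)).
    have t0 : 0 <= Num.max 0 t by rewrite le_max lexx.
    have r1 := bd Cx.
    have h : 1 <= rho (sc (1 + 3 * Num.max 0 t) (d l (i x))).
      by rewrite rho_sc ?r1; lra.
    by case: ifP => _; rewrite ?Psi1 // c_sc ?dK //; lra.
  (* Second stage: only [c l] is left, and the scale is interpolated from [lam + 3] to 1. On the
     boundary the scale stays at least 1, so [c l] does not notice it. *)
  have [||l x t Cx|H2 [cH2 H2i H2C]] := @attach_glue Y (fun z => i z.1)
      (fun l z => c l (sc ((1 - cl z.2) * (lam z.1 + 3) + cl z.2) z.1)).
  + by cts.
  + by move=> l; have Cc := @cc l; apply: (cts_comp Cc); apply: cts_sc; cts.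
  + rewrite /= (lam_boundary (bd Cx)) c_sc ?(bd Cx) ?dK //.
    have : cl t <= 1 by rewrite /cl ge_max ler01 ge_min lexx.
    by lra.
  apply: (@phom_trans _ _ _ _ _ (fun y => H1 (y, 1))).
  + exists H1; split=> // [y|t]; last by rewrite H1i fi gb.
    have [[x _ <-]|[l Cy]] := cover y; first by rewrite H1i fi gb.
    rewrite (H1C _ _ _ Cy) (fC _ _ Cy) /st /= maxxx mulr0 addr0 /cell_out.
    set z := d l y.
    have [zh|zh] := leP (rho z) half.
      rewrite gs /sph_in /= !mxE /= pmulr_lle0 ?invr_gt0 ?qden_gt0 // subr_le0.
      rewrite /lam [Num.max 0 (2 * rho z - 1)]max_l ?addr0 //.
      by rewrite /half in zh; lra.
    rewrite gb ifF; last first.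
      rewrite /gap max_l; last by rewrite /half in zh; lra.
      rewrite expr0n; apply/negbTE; rewrite -ltNge lt_neqAle nsq_ge0 andbT.
      apply: contraTneq zh => /esym/nsq_eq0 ->.
      by rewrite rho0 -leNgt invr_ge0 ler0n.
    rewrite /lam /gap [Num.max 0 (1 - _)]max_l; last by rewrite /half in zh; lra.
    rewrite mulr0 mul0r add0r max_r //.
    by rewrite /half in zh; lra.
  + exists H2; split=> // [y|y|t]; last by rewrite H1i H2i.
      have [[x _ <-]|[l Cy]] := cover y; first by rewrite H1i H2i.
      rewrite (H1C _ _ _ Cy) (H2C _ _ _ Cy) /st /cl /=.
      rewrite min_r ?ler01 // maxxx subr0 mul1r addr0 max_r ?ler01 // mulr1.
      case: leP => // /rho_outer h; rewrite Psi1 // rho_sc.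
        by have := lam_ge0 (d l y); have := rho_ge0 (d l y); nra.
      by rewrite addr_ge0 ?lam_ge0.
    have [[x _ <-]|[l Cy]] := cover y; first by rewrite H2i.
    by rewrite (H2C _ _ _ Cy) /cl /= minxx max_r ?ler01 // subrr mul0r add0r sc1 dK.
(* The other composite, on a sphere of the wedge: [yy] projects to the equatorial disc and clamps it
   to the triangle. The first homotopy contracts everything lying in the base through [Psi l], which
   leaves the self-map [q] of the sphere; the second joins [q] to the identity. *)
- pose yy (s : set_type (sphere R 2)) := clamp ((\val s) ord0 i1, (\val s) ord0 i2).
  have cyy : cts yy by apply: (cts_comp clc); exact: cts_pair.
  have equ (s : set_type (sphere R 2)) : (\val s) ord0 i0 = 0 -> rho (yy s) = 1.
    by move=> /equator_rho h; rewrite /yy rho_clamp1.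
  have yypt : yy (sphere_pt R 2) = (0, 0).
    by rewrite /yy sphere_pt_vec !mxE /= clamp_id ?rho0.
  have ptv : (\val (sphere_pt R 2)) ord0 i0 = 1 by rewrite sphere_pt_vec mxE.
  pose q (s : set_type (sphere R 2)) :=
    if (\val s) ord0 i0 <= 0 then qmap (yy s) else sphere_pt R 2.
  have cq : cts q.
    apply: cts_ifle => //; try exact: cts_cst.
      exact: (cts_comp qmc).
    by move=> s /equ e; rewrite qmap_pt // e; lra.
  have [||l t|H1 [cH1 H1i H1C]] := @wfun_joint R 2 n X x0 W (fun z => wbase x0 z.1)
      (fun l z => if (\val z.1) ord0 i0 <= 0 then
         (if rho (yy z.1) <= half then wsph x0 l (qmap (yy z.1))
          else wbase x0 (Psi l (sc ((1 - z.2) * (2 * rho (yy z.1) - 1)) (yy z.1))))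
         else wbase x0 (Psi l (sc (1 - z.2) (yy z.1)))) hX.
  + by cts.
  + move=> l; have [wl Pc] := (wc l, @cPsi l).
    apply: cts_ifle.
    * exact: (cts_comp c0 (cts_fst cts_id)).
    * exact: cts_cst.
    * apply: cts_ifle; cts.
        by apply: cts_sc; cts.
      move=> z e; rewrite qmap_pt ?e // wsph_pt; congr wbase.
      by rewrite /half mulfV // subrr mulr0 sc0 Psi0.
    * by apply: (cts_comp wb); apply: (cts_comp Pc); apply: cts_sc; cts.
    * move=> z /equ e; rewrite e ifF; last by apply/negbTE; rewrite -ltNge /half; lra.
      by congr (wbase _ (Psi _ (sc _ _))); lra.
  + by rewrite /= ptv ifF ?yypt ?/sc /= ?mulr0 ?Psi0 //; apply/negbTE; rewrite -ltNge ltr01.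
  have H11 l s : H1 (wsph x0 l s, 1) = wsph x0 l (q s).
    rewrite H1C /= /q subrr mul0r sc0 Psi0; case: ifP => _; last by rewrite wsph_pt.
    by case: leP => // /ltW h; rewrite qmap_pt // wsph_pt.
  apply: (@phom_trans _ _ _ _ _ (fun y => H1 (y, 1))).
  + exists H1; split=> // [|t]; last by rewrite H1i gb fi.
    apply: wedge_spheres_ind => [x|l s]; first by rewrite H1i gb fi.
    rewrite H1C gs /sph_in /= subr0 !mul1r; case: leP => h.
      by rewrite (fC _ _ (cC _ _)) cK /cell_out -/(yy s).
    by rewrite fi sc1 /yy Psi_clamp.
  (* [q s] is never the antipode of [s], so the segment between them avoids the origin and can be
     normalized onto the sphere. *)
  + have antipode (z : set_type (sphere R 2) * R) :
        (1 - z.2) * (\val (q z.1)) ord0 i0 + z.2 * (\val z.1) ord0 i0 = 0 ->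
        (1 - z.2) * (\val (q z.1)) ord0 i1 + z.2 * (\val z.1) ord0 i1 = 0 ->
        (1 - z.2) * (\val (q z.1)) ord0 i2 + z.2 * (\val z.1) ord0 i2 = 0 -> False.
      case: z => s t /=; have := sphere_eq s; have := sphere_eq (q s).
      rewrite /nsq /= => e1 e2 a0 a1 a2; have th : t = half.
        (* Two unit vectors whose convex combination vanishes have equal weights. *)
        have h (a b u w v z : R) : (1 - t) * a + t * u = 0 -> (1 - t) * b + t * w = 0 ->
            (1 - t) * v + t * z = 0 -> a ^+ 2 + (b ^+ 2 + v ^+ 2) = 1 ->
            u ^+ 2 + (w ^+ 2 + z ^+ 2) = 1 -> t = half.
          move=> /addr0_eq h1 /addr0_eq h2 /addr0_eq h3 n1 n2.
          have : (1 - t) ^+ 2 * (a ^+ 2 + (b ^+ 2 + v ^+ 2)) =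
              t ^+ 2 * (u ^+ 2 + (w ^+ 2 + z ^+ 2)).
            by rewrite !mulrDr -!exprMn -h1 -h2 -h3 !sqrrN.
          by rewrite n1 n2 /half; lra.
        exact: h a0 a1 a2 e1 e2.
      have {a0 a1 a2} [a0 a1 a2] : [/\ (\val (q s)) ord0 i0 = - (\val s) ord0 i0,
          (\val (q s)) ord0 i1 = - (\val s) ord0 i1 &
          (\val (q s)) ord0 i2 = - (\val s) ord0 i2].
        by rewrite th /half in a0 a1 a2; split; lra.
      (* In the north [q s] is the pole itself. In the south the lateral coordinates of [q s] are
         nonnegative multiples of those of [s]; being opposite, they vanish, so [q s] is the south
         pole and [s] would be the north pole. *)
      move: a0 a1 a2; rewrite /q; case: leP => [s0|s0]; last by rewrite ptv; lra.
      rewrite /= !mxE /= => a0.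
      set k := 2 * _ / _; have k0 : 0 <= k.
        by rewrite divr_ge0 ?mulr_ge0 ?gap_ge0 ?ltW ?qden_gt0.
      rewrite /yy /clamp /sc /=; set b := (Num.max _ _)^-1.
      have b0 : 0 <= b by rewrite invr_ge0 le_max ler01.
      have kb0 := mulr_ge0 k0 b0.
      rewrite !mulrA => a1 a2.
      have {}a1 : (\val s) ord0 i1 = 0 by nra.
      have {}a2 : (\val s) ord0 i2 = 0 by nra.
      have n0 : nsq (0, 0) = 0 :> R by rewrite /nsq /= expr0n addr0.
      have g1 : gap (0, 0) = 1 :> R by rewrite /gap rho0 mulr0 subr0 max_r.
      move: a0; rewrite /yy a1 a2 clamp_id ?rho0 // /qden n0 g1 expr1n sub0r add0r.
      by rewrite divr1; lra.
    pose L (z : set_type (sphere R 2) * R) : 'I_3 -> R := fun k =>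
      (1 - z.2) * (\val (q z.1)) ord0 k + z.2 * (\val z.1) ord0 k.
    pose D z : R := L z i0 ^+ 2 + L z i1 ^+ 2 + L z i2 ^+ 2.
    have Dge0 z : 0 <= D z by rewrite /D !addr_ge0 // sqr_ge0.
    have D0 z : 0 < D z.
      rewrite lt_neqAle Dge0 andbT eq_sym; apply/negP => /eqP Dz.
      by have [] := sum3_eq0 Dz; exact: antipode.
    have sD z : Num.sqrt (D z) != 0 by rewrite gt_eqF // sqrtr_gt0.
    have nrm z : (mk3 (L z i0 / Num.sqrt (D z)) (L z i1 / Num.sqrt (D z))
        (L z i2 / Num.sqrt (D z))) \in sphere R 2.
      rewrite inE /sphere /= sum3 !mxE /= !expr_div_n sqr_sqrtr // -!mulrDl -/(D z).
      by rewrite divff // gt_eqF.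
    pose N z : set_type (sphere R 2) := SigSub (nrm z).
    have cL k : cts (fun z => L z k).
      have ck : cts (fun z : set_type (sphere R 2) * R => (\val z.1) ord0 k).
        exact: cts_comp (@cts_sphere k) (cts_fst cts_id).
      have cqk : cts (fun z : set_type (sphere R 2) * R => (\val (q z.1)) ord0 k).
        exact: cts_comp (@cts_sphere k) (cts_comp cq (cts_fst cts_id)).
      have c2' : cts (fun z : set_type (sphere R 2) * R => z.2) by cts.
      apply: ctsD; first (apply: ctsM; last exact: cqk).
        by cts.
      by apply: ctsM; [exact: c2'|exact: ck].
    have cN : cts N.
      have [cL0 cL1 cL2] := And3 (cL i0) (cL i1) (cL i2).
      by apply: cts_sub => /=; apply: cts_mk3; rewrite /D; cts.
    have NE z (v : set_type (sphere R 2)) : (forall k, L z k = (\val v) ord0 k) -> N z = v.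
      move=> e; have D1 : D z = 1.
        by rewrite /D !e; have := sphere_eq v; rewrite /nsq /= addrA.
      by apply: val_inj; apply: row3P; rewrite !mxE /= D1 sqrtr1 divr1.
    have qpt : q (sphere_pt R 2) = sphere_pt R 2.
      by rewrite /q ptv ifF //; apply/negbTE; rewrite -ltNge ltr01.
    have [||l t|H2 [cH2 H2i H2C]] := @wfun_joint R 2 n X x0 W (fun z => wbase x0 z.1)
      (fun l z => wsph x0 l (N z)) hX.
    * by cts.
    * by move=> l; have wl := wc l; cts.
    * rewrite -(wsph_pt x0 l); congr wsph; apply: NE => k.
      by rewrite /L /= qpt; ring.
    exists H2; split.
    * by [].
    * apply: wedge_spheres_ind => [x|l s]; first by rewrite H2i H1i.
      by rewrite H2C H11; congr wsph; apply: NE => k; rewrite /L /= subr0 mul1r mul0r addr0.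
    * apply: wedge_spheres_ind => [x|l s]; first by rewrite H2i.
      by rewrite H2C; congr wsph; apply: NE => k; rewrite /L /= subrr mul0r mul1r add0r.
    * by move=> t; rewrite H2i H1i.
Qed.

End Attach.

(** * Simplicial complexes and collapses *)

(** The deformation is a map of the ambient space, so the subspace topologies enter only through
    [cts_sub] and [cts_val]. *)
Lemma sdr_phe (R : realType) (T : topologicalType) (A B : set T) (phi : T * R -> T) :
  A `<=` B -> cts phi ->
  (forall x s, B x -> 0 <= s <= 1 -> B (phi (x, s))) ->
  (forall x, B x -> phi (x, 0) = x) -> (forall x, B x -> A (phi (x, 1))) ->
  (forall x s, A x -> phi (x, s) = x) ->
  forall x (xB : x \in B) (xA : x \in A),
    phe R (SigSub xB : set_type B) (SigSub xA : set_type A).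
Proof.
move=> AB cphi phiB phi0 phi1 phiA x xB xA.
pose cl (t : R) : R := Num.max 0 (Num.min 1 t).
have clC : cts cl by rewrite /cl; cts.
have cl01 t : 0 <= cl t <= 1.
  by rewrite /cl le_max lexx /= ge_max ler01 ge_min lexx.
have vB (z : set_type B) : B (\val z) by have := valP z; rewrite inE.
have vA (z : set_type A) : A (\val z) by have := valP z; rewrite inE.
have fP (z : set_type B) : phi (\val z, 1) \in A by rewrite inE; exact: phi1.
have gP (z : set_type A) : \val z \in B by rewrite inE; exact: AB.
(* Time is reversed because the required homotopy ends at the identity, and clamped because [B] is
   preserved only for times in [0, 1]. *)
have hP (z : set_type B * R) : phi (\val z.1, cl (1 - z.2)) \in B.
  by rewrite inE; apply: phiB.
exists (fun z => SigSub (fP z)), (fun z => SigSub (gP z)); split.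
- apply: cts_sub => /=; apply: (cts_comp cphi); apply: cts_pair; first exact: cts_val.
  by cts.
- by apply: cts_sub => /=; exact: cts_val.
- by split; apply: val_inj => //=; apply: phiA; exact/set_mem.
- exists (fun z => SigSub (hP z)); split.
  + apply: cts_sub => /=; apply: (cts_comp cphi); apply: cts_pair; last by cts.
    apply: (@cts_comp _ _ _ (fun z : set_type B => \val z)); first exact: cts_val.
    exact: (@cts_fst _ _ _ (fun z => z) cts_id).
  + move=> z; apply: val_inj => /=; congr (phi (_, _)).
    by rewrite /cl subr0 minxx max_r.
  + move=> z; apply: val_inj => /=; rewrite subrr /cl min_r // maxxx.
    exact: phi0 (vB z).
  + by move=> t; apply: val_inj => /=; rewrite !(phiA x _ (set_mem xA)).
- apply: phom_eq => [|z]; last by apply: val_inj => /=; exact: phiA (vA z).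
  apply: cts_sub => /=; apply: (cts_comp cphi); apply: cts_pair; last by cts.
  exact: cts_val.
Qed.

Section Complex.
Context {R : realType} {n : nat}.
Implicit Types (K : set {set 'I_n}) (x : 'rV[R]_n) (s t : {set 'I_n}).

Definition is_complex K := forall s t, K s -> t \subset s -> t != finset.set0 -> K t.

Definition supp x : {set 'I_n} := [set i | x ord0 i != 0]%SET.

Lemma supp_neq0 x : \sum_i x ord0 i = 1 -> supp x != finset.set0.
Proof.
move=> s1; apply/eqP => s0; have := oner_neq0 R; rewrite -s1 big1 ?eqxx // => i _.
by have : i \notin supp x; [rewrite s0 inE|rewrite inE negbK => /eqP].
Qed.

Lemma geom_simplexP s x : geom_simplex s x <->
  [/\ forall i, 0 <= x ord0 i, \sum_i x ord0 i = 1 & supp x \subset s].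
Proof.
split=> -[h0 h1 h2]; split=> //.
  by apply/fintype.subsetP => i; rewrite inE; apply: contraNT => /h2 ->.
move=> i si; apply/eqP; apply: contraNT si => xi.
by move/fintype.subsetP: h2; apply; rewrite inE.
Qed.

Lemma realizationP K x : is_complex K -> realization K x <->
  [/\ forall i, 0 <= x ord0 i, \sum_i x ord0 i = 1 & K (supp x)].
Proof.
move=> cK; split=> [[s Ks /geom_simplexP[h0 h1 h2]]|[h0 h1 h2]].
  by split=> //; apply: cK h2 _ => //; exact: supp_neq0.
by exists (supp x) => //; apply/geom_simplexP.
Qed.

Lemma delta_simplex s k : k \in s -> geom_simplex s (delta_mx 0 k : 'rV[R]_n).
Proof.
move=> ks; split=> [i||i].
- by rewrite mxE; case: (_ && _).
- rewrite (bigD1 k) //= mxE !eqxx big1 ?addr0 // => i /negbTE ik.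
  by rewrite mxE ik andbF.
- move=> si; rewrite mxE; case: (eqVneq i k) => [ik|_]; last by rewrite andbF.
  by rewrite ik ks in si.
Qed.

Lemma closed_geom_simplex s : closed (@geom_simplex R n s).
Proof.
have ce i : cts (fun x : 'rV[R]_n => x ord0 i) by exact/cts_entry/cts_id.
rewrite (_ : geom_simplex s = (\bigcap_i [set x | 0 <= x ord0 i]) `&`
  ([set x | \sum_i x ord0 i <= 1] `&` [set x | 1 <= \sum_i x ord0 i]) `&`
  (\bigcap_(i in [set i | i \notin s]) [set x | x ord0 i <= 0])).
  apply: closedI; first apply: closedI.
  - by apply: closed_bigI => i _; exact: (@closed_le_fun _ _ _ _ (@cts_cst _ R 0) (ce i)).
  - have cs : cts (fun x : 'rV[R]_n => \sum_i x ord0 i) by exact: cts_sum.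
    by apply: closedI; [apply: (@closed_le_fun _ _ _ _ cs (@cts_cst _ R 1))|
      apply: (@closed_le_fun _ _ _ _ (@cts_cst _ R 1) cs)].
  - by apply: closed_bigI => i _; exact: (@closed_le_fun _ _ _ _ (ce i) (@cts_cst _ R 0)).
apply/seteqP; split=> x /=.
  move=> [h0 h1 h2]; have {}h1 : \sum_i x ord0 i = 1 := h1.
  split; first (split; [by move=> i _; exact: h0|by split; rewrite /= h1]).
  by move=> i /= /h2 ->.
move=> [[h0 [h1 h1']] h2]; split.
- by move=> i; exact: h0.
- by apply/eqP; rewrite eq_le; apply/andP.
- by move=> i si; apply/eqP; rewrite eq_le h0 // h2.
Qed.

Lemma closed_realization K : closed (@realization R n K).
Proof.
apply: closed_bigcup; first exact: finite_finset.
by move=> s _; exact: closed_geom_simplex.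
Qed.

(** Only the pointed equivalence is kept of a deformation retraction, but for every base point of
    the smaller complex, so that collapses can be chained at one base point chosen in the last
    complex. *)
Definition sdr K K' := K' `<=` K /\
  forall x (h : x \in realization K) (h' : x \in realization K'),
    phe R (SigSub h : set_type (realization K)) (SigSub h' : set_type (realization K')).

Lemma realizationS K K' : K' `<=` K -> @realization R n K' `<=` realization K.
Proof. by move=> KK' x [s Ks xs]; exists s => //; exact: KK'. Qed.

Lemma sdr_trans K1 K K2 : sdr K K1 -> sdr K1 K2 -> sdr K K2.
Proof.
move=> [s1 p1] [s2 p2]; split; first exact: subset_trans s2 s1.
move=> x h h'; have h1 : x \in realization K1.
  by move: h'; rewrite !inE; exact: realizationS.
exact: phe_trans (p1 x h h1) (p2 x h1 h').
Qed.

Lemma sdr_refl K : sdr K K.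
Proof.
split=> // x h h'; rewrite (bool_irrelevance h' h).
by apply: (@phe_homeo _ _ _ _ _ (fun z => z) (fun z => z)) => //; exact: cts_id.
Qed.

(** * Collapsing by toggling one vertex *)

Section Collapse.
Variables (K K' : set {set 'I_n}) (a : 'I_n).
Hypothesis cK : is_complex K.
Hypothesis cK' : is_complex K'.
Hypothesis K'K : K' `<=` K.
Hypothesis K'a : K' (finset.set1 a).
Hypothesis tog : forall s, s != finset.set0 -> K s -> ~ K' s ->
  K (a |: s)%SET /\ ~ K' (s :\ a)%SET.

(** [far s x] is the time after which lowering at unit speed has killed every coordinate outside [s]
    and [a]. In [phi] the lost mass goes to the vertex [a]. *)
Let far s x : R := \big[Num.max/0]_(i | (i \notin s) && (i != a)) x ord0 i.
Let tau x : R := \big[Num.min/1]_(s | `[<K' s>]) far s x.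
Let lower x (t : R) i : R := Num.max 0 (x ord0 i - t * tau x).
Let phi (z : 'rV[R]_n * R) : 'rV[R]_n := \row_i
  if i == a then 1 - \sum_(k | k != a) lower z.1 z.2 k else lower z.1 z.2 i.

Let far_cts s : cts (far s).
Proof. by apply: cts_big_max => i; exact/cts_entry/cts_id. Qed.

Let tau_cts : cts tau.
Proof. exact: cts_big_min. Qed.

Let phi_cts : cts phi.
Proof.
have tc := tau_cts.
have lc i : cts (fun z : 'rV[R]_n * R => lower z.1 z.2 i) by rewrite /lower; cts.
apply: cts_row => i; case: (i == a) => //.
apply: ctsD; first exact: cts_cst.
by apply: ctsN; exact: cts_sum.
Qed.

Let far_ge0 s x : 0 <= far s x.
Proof. exact: bigmax_ge_id. Qed.

Let tau_ge0 x : 0 <= tau x.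
Proof. by rewrite /tau; elim/big_ind: _ => // u v u0 v0; rewrite le_min u0. Qed.

Let tau_le s x : K' s -> tau x <= far s x.
Proof. by move=> K's; rewrite /tau; apply: bigmin_inf (lexx _); exact/asboolP. Qed.

(** The seed 1 of the minimum does not interfere, since no coordinate exceeds 1; and the minimum
    ranges over a nonempty family because [K'] contains the vertex [a]. *)
Let tau_att x : (forall i, 0 <= x ord0 i) -> \sum_i x ord0 i = 1 ->
  exists2 s, K' s & tau x = far s x.
Proof.
move=> h0 h1; have Ka : `[<K' (finset.set1 a)>] by exact/asboolP.
have := @arg_minP _ _ _ _ (fun s => `[<K' s>]) (far ^~ x) Ka.
case=> s /asboolP K's smin; exists s => //; apply/eqP; rewrite eq_le tau_le //=.
apply: le_bigmin => //; apply: bigmax_le => // i _.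
by rewrite -h1 (bigD1 i) //= lerDl sumr_ge0.
Qed.

Let tau0 x : realization K' x -> tau x = 0.
Proof.
move=> /(realizationP _ cK')[h0 h1 h2]; apply/eqP.
rewrite eq_le tau_ge0 andbT (le_trans (tau_le _ h2)) //; apply: bigmax_le => // i.
by rewrite inE negbK => /andP[/eqP ->].
Qed.

Let phi_sum z : \sum_i phi z ord0 i = 1.
Proof.
rewrite (bigD1 a) //= mxE eqxx (eq_bigr (lower z.1 z.2)) ?subrK // => i /negbTE ia.
by rewrite mxE ia.
Qed.

Let phi_ge0 x (t : R) : (forall i, 0 <= x ord0 i) -> \sum_i x ord0 i = 1 -> 0 <= t ->
  forall i, 0 <= phi (x, t) ord0 i.
Proof.
move=> h0 h1 t0 i; rewrite mxE; case: eqP => _ /=; last by rewrite le_max lexx.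
rewrite subr_ge0 -h1 [leRHS](bigD1 a) //= ler_wpDl ?h0 //.
by apply: ler_sum => k _; rewrite ge_max h0 /= gerBl mulr_ge0.
Qed.

Let phi_supp x (t : R) : (forall i, 0 <= x ord0 i) -> 0 <= t ->
  supp (phi (x, t)) \subset (a |: supp x)%SET.
Proof.
move=> h0 t0; apply/fintype.subsetP => i; rewrite !inE mxE.
have [//|ia /=] := eqVneq i a; apply: contraNneq => xi.
by rewrite /lower xi sub0r max_l // oppr_le0 mulr_ge0.
Qed.

Let phi_id x (t : R) : (forall i, 0 <= x ord0 i) -> \sum_i x ord0 i = 1 -> t * tau x = 0 ->
  phi (x, t) = x.
Proof.
move=> h0 h1 tt; have lx i : lower x t i = x ord0 i by rewrite /lower tt subr0 max_r.
apply/rowP => i; rewrite mxE /= lx; case: eqP => [->|//].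
rewrite (eq_bigr (fun k => x ord0 k)) // -h1 (bigD1 a) //=; ring.
Qed.

Let phiK x (t : R) : realization K x -> 0 <= t -> realization K (phi (x, t)).
Proof.
move=> Kx t0; have [h0 h1 h2] := (realizationP _ cK).1 Kx.
apply/(realizationP _ cK); split; [exact: phi_ge0|exact: phi_sum|].
have [K's|nK's] := pselect (K' (supp x)).
  by rewrite phi_id // tau0 ?mulr0 //; apply/(realizationP _ cK').
have [Kas _] := tog (supp_neq0 h1) h2 nK's.
by apply: cK Kas (phi_supp h0 t0) _; exact/supp_neq0/phi_sum.
Qed.

Let phiK' x : realization K x -> realization K' (phi (x, 1)).
Proof.
move=> Kx; have [h0 h1 h2] := (realizationP _ cK).1 Kx.
apply/(realizationP _ cK'); split; [exact: phi_ge0|exact: phi_sum|].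
have p0 := supp_neq0 (phi_sum (x, 1)).
have [//|nK'] := pselect (K' (supp (phi (x, 1)))).
have [_ _ Kp] := (realizationP _ cK).1 (phiK Kx ler01).
(* Were the final support outside [K'], so would be the support without [a]. But the latter is
   contained in the minimizing simplex of [tau], or is empty, and then the support is [a] alone. *)
have [_ []] := tog p0 Kp nK'.
have [s K's ts] := tau_att h0 h1.
apply: cK' K's _ _.
  apply/fintype.subsetP => i; rewrite !inE mxE => /andP[ia]; rewrite (negbTE ia).
  apply: contraNT => si; rewrite /lower /= mul1r max_l // subr_le0 ts.
  by apply: (@le_bigmax_cond _ _ _ _ i); rewrite si.
apply: contra_notN nK' => /eqP e.
suff -> : supp (phi (x, 1)) = finset.set1 a by [].
apply/eqP; rewrite finset.eqEsubset -finset.setD_eq0 e eqxx /= finset.sub1set.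
have [i ip] := finset.set0Pn _ p0.
have [<- //|ia] := eqVneq i a.
by have := finset.in_set0 i; rewrite -e !inE ia => /negbT; rewrite inE in ip; rewrite ip.
Qed.

(* Lowering all coordinates but the one of [a] at unit speed keeps a point in
   [K] until its support reaches [K']; the hitting time [tau] is a min-max of
   coordinates, hence continuous. *)
Lemma collapse_sdr : sdr K K'.
Proof.
split=> //; apply: (@sdr_phe _ _ _ _ phi) => //.
- exact: realizationS.
- by move=> x t Kx /andP[t0 t1]; exact: phiK.
- by move=> x /(realizationP _ cK)[h0 h1 _]; rewrite phi_id ?mul0r.
- move=> x t K'x; have [h0 h1 h2] := (realizationP _ cK').1 K'x.
  by rewrite phi_id // tau0 ?mulr0.
Qed.

End Collapse.

(** One family [D w] is removed at a time. Since the families are disjoint, a simplex of [D w]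
    toggled at [w] cannot fall into the families still present, so each removal is a collapse on its
    own. *)
Lemma collapse_family (K K' : set {set 'I_n}) (D : 'I_n -> set {set 'I_n}) (r : seq 'I_n) :
  uniq r -> is_complex K' ->
  (forall w s t, w \in r -> D w s -> t \subset s -> t != finset.set0 -> K' t \/ D w t) ->
  (forall w, w \in r -> K' (finset.set1 w)) ->
  (forall w s, w \in r -> D w s -> D w (w |: s)%SET /\ D w (s :\ w)%SET) ->
  (forall w s, w \in r -> D w s -> ~ K' s) ->
  (forall w w' s, w \in r -> w' \in r -> D w s -> D w' s -> w = w') ->
  (forall s, K s <-> K' s \/ exists2 w, w \in r & D w s) ->
  sdr K K' /\ is_complex K.
Proof.
elim: r K => [|w r IH] K; first move=> _ cK' _ _ _ _ _ KE.
  have -> : K = K'.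
    by apply/seteqP; split=> s; [move/KE => [//|[]]|move=> ?; apply/KE; left].
  by split=> //; exact: sdr_refl.
move=> /= /andP[wr ur] cK' Dface Kw Dtog DK' Ddisj KE.
have sub u : u \in r -> u \in w :: r by rewrite inE orbC => ->.
have wwr : w \in w :: r by rewrite inE eqxx.
pose K1 : set {set 'I_n} := [set s | K' s \/ exists2 u, u \in r & D u s].
have [||||||s1 cK1] := IH K1 ur cK'.
- by move=> u s t /sub; exact: Dface.
- by move=> u /sub; exact: Kw.
- by move=> u s /sub; exact: Dtog.
- by move=> u s /sub; exact: DK'.
- by move=> u u' s /sub h /sub; exact: Ddisj.
- by [].
have KE1 s : K s <-> K1 s \/ D w s.
  split=> [/KE[?|[u]]|].
  - by left; left.
  - by rewrite inE => /predU1P[->|ur' Du]; [right|left; right; exists u].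
  - move=> [[K's|[u ur' Du]]|Dw]; apply/KE; [by left|right; exists u => //; exact: sub|].
    by right; exists w.
have cK : is_complex K.
  move=> s t /KE1[K1s|Dw] ts t0; apply/KE1; first by left; exact: cK1 ts t0.
  by have [K't|Dt] := Dface w s t wwr Dw ts t0; [left; left|right].
split=> //; apply: sdr_trans s1; apply: (@collapse_sdr _ _ w) => //.
- by move=> s K1s; apply/KE1; left.
- by left; exact: Kw.
- move=> s s0 /KE1[//|Dw] nK1; have [Dw1 Dw2] := Dtog w s wwr Dw.
  split; first by apply/KE1; right.
  move=> [K's|[u ur' Du]]; first exact: DK' wwr Dw2 K's.
  by move: wr; rewrite (Ddisj w u _ wwr (sub u ur') Dw2 Du) ur'.
Qed.

End Complex.

(** * Null-homotopic triangles *)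

Lemma cts_glue3 (X Y : topologicalType) (A B C : set X) (f g h k : X -> Y) :
  closed A -> closed B -> closed C -> (forall x, [\/ A x, B x | C x]) ->
  cts f -> cts g -> cts h -> (forall x, A x -> k x = f x) ->
  (forall x, B x -> k x = g x) -> (forall x, C x -> k x = h x) -> cts k.
Proof.
move=> cA cB cC cov cf cg ch kf kg kh.
apply: (@cts_closed2 _ _ (A `|` B) C) => //.
- exact: closedU.
- by move=> x; case: (cov x) => ?; [left; left|left; right|right].
- by apply: withinU_continuous => //; [exact: within_eq cf _|exact: within_eq cg _].
- exact: within_eq ch _.
Qed.

Section Triangles.
Context {R : realType} {n : nat}.
Implicit Types (a b c d : 'I_n) (K : set {set 'I_n}).

Definition tpt a b c (p q : R) : 'rV[R]_n :=
  \row_i (p * (i == a)%:R + q * (i == b)%:R + (1 - p - q) * (i == c)%:R).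

Lemma cts_tpt (X : topologicalType) a b c (p q : X -> R) :
  cts p -> cts q -> cts (fun x => tpt a b c (p x) (q x)).
Proof. by move=> cp cq; apply: cts_row => i; cts. Qed.

Lemma tpt_simplex a b c (p q : R) : 0 <= p -> 0 <= q -> p + q <= 1 ->
  geom_simplex [set a; b; c]%SET (tpt a b c p q).
Proof.
move=> p0 q0 pq; have r0 : 0 <= 1 - p - q by lra.
have sd (k : 'I_n) : \sum_i (i == k)%:R = 1 :> R.
  by rewrite (bigD1 k) //= eqxx big1 ?addr0 // => i /negbTE ->.
split.
- by move=> i; rewrite mxE !addr_ge0 // mulr_ge0.
- rewrite (eq_bigr (fun i => p * (i == a)%:R + q * (i == b)%:R + (1 - p - q) * (i == c)%:R)).
    by rewrite !big_split /= -!mulr_sumr !sd; lra.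
  by move=> i _; rewrite mxE.
- move=> i; rewrite !inE !negb_or => /andP[/andP[/negbTE ia /negbTE ib] /negbTE ic].
  by rewrite mxE ia ib ic !mulr0 !addr0.
Qed.

Definition cellpt a b c (y : R * R) : 'rV[R]_n :=
  tpt a b c (3^-1 + (clamp y).1) (3^-1 + (clamp y).2).

Lemma rho_le1P (y : R * R) : (rho y <= 1) =
  [&& 0 <= 3^-1 + y.1, 0 <= 3^-1 + y.2 & (3^-1 + y.1) + (3^-1 + y.2) <= 1].
Proof.
rewrite /rho -ler_pdivlMl // mulr1 !ge_max -andbA.
by congr [&& _, _ & _]; apply/idP/idP; lra.
Qed.

Lemma cellpt_simplex a b c y : geom_simplex [set a; b; c]%SET (cellpt a b c y).
Proof.
by have := rho_clamp_le1 y; rewrite rho_le1P => /and3P[*]; exact: tpt_simplex.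
Qed.

Definition bcl (z : R * R) : R * R :=
  let y := clamp (z.1 - 3^-1, z.2 - 3^-1) in (3^-1 + y.1, 3^-1 + y.2).

Lemma bcl_cts : cts bcl.
Proof. by have cc := @clamp_cts R; rewrite /bcl; cts. Qed.

Lemma bclP z : [/\ 0 <= (bcl z).1, 0 <= (bcl z).2 & (bcl z).1 + (bcl z).2 <= 1].
Proof.
by have := rho_clamp_le1 (z.1 - 3^-1, z.2 - 3^-1); rewrite rho_le1P => /and3P[].
Qed.

Lemma bcl_id p q : 0 <= p -> 0 <= q -> p + q <= 1 -> bcl (p, q) = (p, q).
Proof.
move=> p0 q0 pq; have e : clamp (p - 3^-1, q - 3^-1) = (p - 3^-1, q - 3^-1).
  by apply: clamp_id; rewrite rho_le1P /=; apply/and3P; split; lra.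
by rewrite /bcl e; congr pair => /=; ring.
Qed.

(** Null-homotopy of the boundary of the triangle inside [K]: the triangle itself need not be a
    simplex, so only the values on its boundary are prescribed. *)
Definition null K a b c := exists Psi : R * R -> set_type (@realization R n K),
  cts Psi /\ forall p q : R, 0 <= p -> 0 <= q -> p + q <= 1 ->
    [\/ p = 0, q = 0 | p + q = 1] -> \val (Psi (p, q)) = tpt a b c p q.

Lemma null_simplex K a b c : K [set a; b; c]%SET -> null K a b c.
Proof.
move=> Kabc; have P z : tpt a b c (bcl z).1 (bcl z).2 \in realization K.
  rewrite inE; exists [set a; b; c]%SET => //.
  by have [*] := bclP z; exact: tpt_simplex.
exists (fun z => SigSub (P z)); split.
  apply: cts_sub; have bc := bcl_cts.
  apply: (@cts_tpt _ a b c (fun z => (bcl z).1) (fun z => (bcl z).2)).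
    exact: cts_fst.
  exact: cts_snd.
move=> p q p0 q0 pq _.
have -> : \val (SigSub (P (p, q))) = tpt a b c (bcl (p, q)).1 (bcl (p, q)).2 by [].
by rewrite bcl_id.
Qed.

(** Subdivide the triangle at its barycentre and send the barycentre to [d]. Where [r] is the
    smallest coordinate the image has coordinates [p - r], [q - r] on [a], [b] and [3 r] on [d], and
    cyclically. On the inner edges the fillings agree because their boundary values are
    prescribed. *)
Lemma null_cone K a b c d : null K a b d -> null K b c d -> null K c a d ->
  null K a b c.
Proof.
move=> [P1 [cP1 e1]] [P2 [cP2 e2]] [P3 [cP3 e3]].
have bc := bcl_cts.
pose r z : R := 1 - (bcl z).1 - (bcl z).2.
pose p z : R := (bcl z).1; pose q z : R := (bcl z).2.
have rc : cts r.
  by apply: ctsD; [apply: ctsD; [exact: cts_cst|exact/ctsN/cts_fst]|exact/ctsN/cts_snd].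
have pc : cts p by exact: cts_fst.
have qc : cts q by exact: cts_snd.
have pqr z : [/\ 0 <= p z, 0 <= q z, 0 <= r z & p z + q z + r z = 1].
  by have [*] := bclP z; split=> //; rewrite /r /p /q; lra.
pose f1 z := P1 (p z - r z, q z - r z).
pose f2 z := P2 (q z - p z, r z - p z).
pose f3 z := P3 (r z - q z, p z - q z).
pose k z := if (r z <= p z) && (r z <= q z) then f1 z
            else if (p z <= q z) && (p z <= r z) then f2 z else f3 z.
have k1 z : r z <= p z -> r z <= q z -> k z = f1 z by move=> h1 h2; rewrite /k h1 h2.
have k2 z : p z <= q z -> p z <= r z -> k z = f2 z.
  move=> h1 h2; rewrite /k h1 h2 /=; case: ifP => // /andP[h3 h4].
  have e : p z = r z by apply/eqP; rewrite eq_le h2.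
  have [p0 q0 r0 s1] := pqr z; apply: val_inj; rewrite /f1 /f2.
  rewrite e1; [|lra|lra|lra|by apply: Or31; lra].
  rewrite e2; [|lra|lra|lra|by apply: Or32; lra].
  by apply/rowP => i; rewrite !mxE e; ring.
have k3 z : q z <= p z -> q z <= r z -> k z = f3 z.
  move=> h1 h2; rewrite /k; have [p0 q0 r0 s1] := pqr z.
  case: ifP => [/andP[h3 h4]|_].
    have e : q z = r z by apply/eqP; rewrite eq_le h2.
    apply: val_inj; rewrite /f1 /f3.
    rewrite e1; [|lra|lra|lra|by apply: Or32; lra].
    rewrite e3; [|lra|lra|lra|by apply: Or31; lra].
    by apply/rowP => i; rewrite !mxE e; ring.
  case: ifP => [/andP[h3 h4]|_] //.
  have e : p z = q z by apply/eqP; rewrite eq_le h3.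
  apply: val_inj; rewrite /f2 /f3.
  rewrite e2; [|lra|lra|lra|by apply: Or31; lra].
  rewrite e3; [|lra|lra|lra|by apply: Or32; lra].
  by apply/rowP => i; rewrite !mxE e; ring.
have cl (u v : R * R -> R) : cts u -> cts v -> closed [set z | u z <= v z].
  by move=> cu cv; exact: closed_le_fun.
exists k; split.
  apply: (@cts_glue3 _ _ [set z | r z <= p z /\ r z <= q z] [set z | p z <= q z /\ p z <= r z]
    [set z | q z <= p z /\ q z <= r z] f1 f2 f3).
  - by apply: closedI; exact: cl.
  - by apply: closedI; exact: cl.
  - by apply: closedI; exact: cl.
  - move=> z /=; have [h1|/ltW h1] := leP (r z) (p z); have [h2|/ltW h2] := leP (p z) (q z).
    + have [h3|/ltW h3] := leP (r z) (q z); first by apply: Or31.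
      by apply: Or33; split=> //; exact: le_trans h3 h1.
    + have [h3|/ltW h3] := leP (r z) (q z); first by apply: Or31.
      by apply: Or33.
    + by apply: Or32.
    + by apply: Or33; split=> //; exact: le_trans h2 h1.
  - by rewrite /f1; cts.
  - by rewrite /f2; cts.
  - by rewrite /f3; cts.
  - by move=> z /= [*]; exact: k1.
  - by move=> z /= [*]; exact: k2.
  - by move=> z /= [*]; exact: k3.
move=> u v u0 v0 uv h.
have [pE qE rE] : [/\ p (u, v) = u, q (u, v) = v & r (u, v) = 1 - u - v].
  by rewrite /p /q /r bcl_id.
case: h => h.
- rewrite k2 ?pE ?qE ?rE; [|lra|lra].
  rewrite /f2 pE qE rE e2; [|lra|lra|lra|by apply: Or33; lra].
  by apply/rowP => i; rewrite !mxE h; ring.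
- rewrite k3 ?pE ?qE ?rE; [|lra|lra].
  rewrite /f3 pE qE rE e3; [|lra|lra|lra|by apply: Or33; lra].
  by apply/rowP => i; rewrite !mxE h; ring.
- rewrite k1 ?pE ?qE ?rE; [|lra|lra].
  rewrite /f1 pE qE rE e1; [|lra|lra|lra|by apply: Or33; lra].
  have -> : u - (1 - u - v) = u by lra.
  have -> : v - (1 - u - v) = v by lra.
  by apply/rowP => i; rewrite !mxE (_ : 1 - u - v = 0); [ring|lra].
Qed.

Definition joined (X : topologicalType) (x y : X) :=
  exists g : R -> X, [/\ cts g, g 0 = x & g 1 = y].

Lemma joined_sym (X : topologicalType) (x y : X) : joined x y -> joined y x.
Proof.
move=> [g [cg g0 g1]]; exists (fun t => g (1 - t)).
by rewrite subr0 subrr; split=> //; cts.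
Qed.

Lemma joined_trans (X : topologicalType) (y x z : X) : joined x y -> joined y z -> joined x z.
Proof.
move=> [g [cg g0 g1]] [h [ch h0 h1]].
exists (fun t => if t <= 2^-1 then g (2 * t) else h (2 * t - 1)); split.
- apply: cts_ifle; cts.
  by move=> t /= ->; rewrite mulfV // subrr g1 h0.
- by rewrite invr_ge0 ler0n mulr0.
- rewrite ifF; last by apply/negbTE; rewrite -ltNge; lra.
  by rewrite (_ : 2 * 1 - 1 = 1) //; lra.
Qed.

Lemma joined_simplex K s (x y : set_type (@realization R n K)) : K s ->
  geom_simplex s (\val x) -> geom_simplex s (\val y) -> joined x y.
Proof.
move=> Ks [x0 x1 xs] [y0 y1 ys].
pose cl (t : R) : R := Num.max 0 (Num.min 1 t).
have clC : cts cl by rewrite /cl; cts.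
have cl01 t : 0 <= cl t <= 1.
  by rewrite /cl le_max lexx /= ge_max ler01 ge_min lexx.
pose g t : 'rV[R]_n := \row_i ((1 - cl t) * (\val x) ord0 i + cl t * (\val y) ord0 i).
have P t : g t \in realization K.
  have /andP[t0 t1] := cl01 t; rewrite inE; exists s => //; split.
  - by move=> i; rewrite mxE addr_ge0 // mulr_ge0 // subr_ge0.
  - rewrite (eq_bigr (fun i => (1 - cl t) * (\val x) 0 i + cl t * (\val y) 0 i)).
      by rewrite big_split /= -!mulr_sumr x1 y1; lra.
    by move=> i _; rewrite mxE.
  - by move=> i si; rewrite mxE xs // ys // !mulr0 addr0.
exists (fun t => SigSub (P t)); split.
- by apply: cts_sub => /=; apply: cts_row => i; cts.
- apply: val_inj; apply/rowP => i /=; rewrite mxE /cl min_r // maxxx subr0 mul1r mul0r.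
  by rewrite addr0.
- apply: val_inj; apply/rowP => i /=; rewrite mxE /cl minxx max_r // subrr mul1r mul0r.
  by rewrite add0r.
Qed.

(** Connectedness makes a free filling based: the inner half of the triangle runs along a path from
    [x0] to the centre of the given filling, the outer half carries that filling. *)
Lemma null_filling K a b c (x0 : set_type (@realization R n K)) :
  (forall x y : set_type (@realization R n K), joined x y) -> null K a b c ->
  exists Psi : R * R -> set_type (@realization R n K), [/\ cts Psi,
    Psi (0, 0) = x0 & forall y, 1 <= rho y -> \val (Psi y) = cellpt a b c y].
Proof.
move=> conn [P [cP eP]].
pose G y := P (3^-1 + (clamp y).1, 3^-1 + (clamp y).2).
have cc := @clamp_cts R; have rc := @rho_cts R.
have cG : cts G by rewrite /G; cts.
have [g [cg g0 g1]] := conn x0 (G (0, 0)).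
exists (fun y => if rho y <= 2^-1 then g (2 * rho y) else G (sc (2 * rho y - 1) y)).
split.
- apply: cts_ifle; cts.
    by apply: cts_sc; cts.
  by move=> y /= ->; rewrite mulfV // subrr sc0.
- by rewrite rho0 invr_ge0 ler0n mulr0.
- move=> y y1; rewrite ifF; last by apply/negbTE; rewrite -ltNge; lra.
  rewrite /G clamp_sc //; last by lra.
  have r1 := rho_clamp1 y1; have := rho_clamp_le1 y; rewrite rho_le1P => /and3P[h1 h2 h3].
  rewrite eP //; move: r1 h1 h2 h3; rewrite /rho; case: (clamp y) => u v /=.
  rewrite /Num.max; case: (ltP (- u) (- v)) => _; case: ltP => _ e h1 h2 h3.
  + by apply: Or33; lra.
  + by apply: Or32; lra.
  + by apply: Or33; lra.
  + by apply: Or31; lra.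
Qed.

End Triangles.

(** * Attaching triangles to a simplicial complex *)

Section AttachComplex.
Context {R : realType} {n N : nat}.
Variables (A B : set {set 'I_n}) (ta tb tc : 'I_N -> 'I_n).
Let T l : {set 'I_n} := [set ta l; tb l; tc l]%SET.

Hypothesis cA : is_complex A.
Hypothesis tri_card : forall l, #|T l| = 3.
Hypothesis nAT : forall l, ~ A (T l).
Hypothesis T_inj : forall l l', T l = T l' -> l = l'.
Hypothesis T_face : forall l (s : {set 'I_n}), s \proper T l -> s != finset.set0 -> A s.
Hypothesis BE : forall s, B s <-> A s \/ exists l, s = T l.
Hypothesis nullT : forall l, @null R n A (ta l) (tb l) (tc l).
Hypothesis conn : forall x y : set_type (@realization R n A), joined (R := R) x y.

Let tri_neq l : [/\ ta l != tb l, ta l != tc l & tb l != tc l].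
Proof.
have le2 (u v : 'I_n) : T l \subset [set u; v]%SET -> False.
  by move=> /subset_leq_card; rewrite tri_card cards2; case: (u != v).
by split; apply/eqP => e; [apply: (le2 (ta l) (tc l))|apply: (le2 (ta l) (tb l))|
  apply: (le2 (ta l) (tb l))]; apply/fintype.subsetP => k;
  rewrite !inE ?e => /orP[/orP[]|] ->; rewrite ?orbT.
Qed.

Let cB : is_complex B.
Proof.
move=> s t /BE[As|[l ->]] ts t0; apply/BE; first by left; exact: cA ts t0.
have [->|tT] := eqVneq t (T l); first by right; exists l.
by left; apply: (@T_face l) => //; rewrite finset.properEneq tT.
Qed.

Let AB : A `<=` B.
Proof. by move=> s As; apply/BE; left. Qed.

Lemma attach_complex x (h : x \in realization B) (h' : x \in @realization R n A) :
  phe R (SigSub h : set_type (realization B))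
    (@wbase R 2 N (set_type (realization A)) (SigSub h') (SigSub h')).
Proof.
pose X := set_type (@realization R n A); pose Y := set_type (@realization R n B).
pose x0 : X := SigSub h'.
have iP (z : X) : \val z \in @realization R n B.
  by have := valP z; rewrite !inE; exact: realizationS.
pose i (z : X) : Y := SigSub (iP z).
pose j (y : Y) : X := insubd x0 (\val y).
have rangeE (y : Y) : range i y <-> realization A (\val y).
  split=> [[z _ <-]|yA]; first by have := valP z; rewrite inE.
  have yA' : \val y \in realization A by rewrite inE.
  by exists (SigSub yA') => //; apply: val_inj.
have cP l (y : R * R) : cellpt (ta l) (tb l) (tc l) y \in @realization R n B.
  rewrite inE; exists (T l); last exact: cellpt_simplex.
  by apply/BE; right; exists l.
pose c l (y : R * R) : Y := SigSub (cP l y).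
pose d l (y : Y) : R * R := ((\val y) ord0 (ta l) - 3^-1, (\val y) ord0 (tb l) - 3^-1).
pose C l : set Y := [set y | geom_simplex (T l) (\val y)].
have /choice[Psi PsiP] : forall l, exists Psi : R * R -> X, [/\ cts Psi,
    Psi (0, 0) = x0 & forall y, 1 <= rho y ->
      \val (Psi y) = cellpt (ta l) (tb l) (tc l) y].
  by move=> l; exact: null_filling.
have CE l (y : Y) : C l y -> [/\ 0 <= (\val y) ord0 (ta l), 0 <= (\val y) ord0 (tb l),
    0 <= (\val y) ord0 (tc l),
    (\val y) ord0 (ta l) + (\val y) ord0 (tb l) + (\val y) ord0 (tc l) = 1 &
    \val y = tpt (ta l) (tb l) (tc l) ((\val y) ord0 (ta l)) ((\val y) ord0 (tb l))].
  move=> [y0 y1 ys]; have [ab ac bc] := tri_neq l.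
  have s1 : (\val y) ord0 (ta l) + (\val y) ord0 (tb l) + (\val y) ord0 (tc l) = 1.
    have {}y1 : \sum_i (\val y) ord0 i = 1 := y1.
    rewrite -y1 (bigD1 (ta l)) //= (bigD1 (tb l)) 1?eq_sym //= (bigD1 (tc l)) /=; last first.
      by rewrite (eq_sym (tc l)) ac eq_sym.
    rewrite big1 ?addr0 ?addrA // => k /andP[/andP[ka kb] kc]; apply: ys.
    by rewrite !inE !negb_or ka kb.
  split=> //; try exact: y0.
  apply/rowP => k; rewrite mxE.
  have [->|ka] := eqVneq k (ta l).
    by rewrite (negbTE ab) (negbTE ac) !mulr0 !addr0 mulr1.
  have [->|kb] := eqVneq k (tb l).
    by rewrite (negbTE bc) !mulr0 add0r addr0 mulr1.
  have [->|kc] := eqVneq k (tc l).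
    by rewrite !mulr0 !add0r mulr1; lra.
  rewrite !mulr0 !addr0; apply: ys; by rewrite !inE !negb_or ka kb.
have tptE l p q : [/\ tpt (ta l) (tb l) (tc l) p q ord0 (ta l) = p :> R &
    tpt (ta l) (tb l) (tc l) p q ord0 (tb l) = q].
  have [ab ac bc] := tri_neq l.
  rewrite !mxE !eqxx (negbTE ab) (eq_sym (tb l)) (negbTE ab) (negbTE ac) (negbTE bc).
  by rewrite !mulr0 !mulr1 !addr0 add0r.
have rho_d l y : C l y -> rho (d l y) <= 1.
  by move=> /CE[a0 b0 c0 s1 _]; rewrite rho_le1P /d /=; apply/and3P; split; lra.
have dK l y : C l y -> c l (d l y) = y.
  move=> Cy; apply: val_inj; have [a0 b0 c0 s1 e] := CE l y Cy.
  by rewrite [RHS]e /= /cellpt clamp_id ?rho_d // /d /=; congr tpt; ring.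
rewrite (_ : SigSub h = i x0); last exact: val_inj.
apply: (@attach_phe R N X Y x0 i j C c d Psi).
- exact/sub_hausdorff/norm_hausdorff.
- by apply: cts_sub => /=; exact: cts_val.
- by move=> z; apply: val_inj; rewrite /j insubdK //; exact: (valP z).
- move=> S p cp pr; apply: cts_sub; rewrite (_ : (fun y => _) = fun y => \val (p y)).
    exact: (cts_comp (@cts_val _ _) cp).
  by apply/funext => t; rewrite /j insubdK // inE; exact/rangeE.
- rewrite (_ : range i = (fun y : Y => \val y) @^-1` realization A).
    by apply: closed_comp; [move=> y _; exact: cts_val|exact: closed_realization].
  by apply/seteqP; split=> y /rangeE.
- move=> l; rewrite (_ : C l = (fun y : Y => \val y) @^-1` geom_simplex (T l)) //.
  by apply: closed_comp; [move=> y _; exact: cts_val|exact: closed_geom_simplex].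
- move=> y; have := valP y; rewrite inE => /(realizationP _ cB)[y0 y1 /BE[ys|[l ys]]].
    by left; apply/rangeE/(realizationP _ cA).
  by right; exists l; apply/geom_simplexP; rewrite ys.
- move=> l l' y /geom_simplexP[y0 y1 ys] /geom_simplexP[_ _ ys'] ll'.
  apply/rangeE/(realizationP _ cA); split=> //; apply: (@T_face l); last exact: supp_neq0.
  rewrite finset.properEneq ys andbT; apply: contra_neq ll' => e; apply: T_inj.
  by apply/eqP; rewrite eqEcard -{1}e ys' !tri_card.
- move=> l; apply: cts_sub => /=; have cc := @clamp_cts R.
  by apply: cts_tpt; cts.
- move=> l; have cv := @cts_val _ (@realization R n B).
  by apply: cts_pair; (apply: ctsD; last exact: cts_cst); exact: cts_entry.
- by move=> l y; exact: cellpt_simplex.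
- exact: dK.
- move=> l y; rewrite /d /= /cellpt.
  have [-> ->] := tptE l (3^-1 + (clamp y).1) (3^-1 + (clamp y).2).
  by rewrite [RHS]surjective_pairing; congr pair; ring.
(* A point of the cell lying in the old realization is supported on a proper face of [T l], so one
   of its three barycentric coordinates is 0, which forces gauge 1. *)
- move=> l z Cz; have /rangeE/(realizationP _ cA)[z0 z1 As] : range i (i z) by exists z.
  have [a0 b0 c0 s1 _] := CE l _ Cz.
  have /geom_simplexP[_ _ zT] := Cz.
  have nT : supp (\val (i z)) != T l by apply/eqP => e; apply: (nAT (l := l)); rewrite -e.
  have : [|| (\val (i z)) ord0 (ta l) == 0, (\val (i z)) ord0 (tb l) == 0 |
             (\val (i z)) ord0 (tc l) == 0].
    apply: contraNT nT; rewrite !negb_or => /and3P[za zb zc].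
    rewrite finset.eqEsubset zT; apply/fintype.subsetP => k; rewrite !inE.
    by move=> /orP[/orP[/eqP->|/eqP->]|/eqP->].
  move=> z0'; apply/eqP; rewrite eq_le rho_d //= /rho -ler_pdivrMl // mulr1 !le_max /d /=.
  by case/or3P: z0' => /eqP e; apply/orP; [left; apply/orP; left|left; apply/orP; right|right]; lra.
- by move=> l; have [] := PsiP l.
- by move=> l; have [] := PsiP l.
- by move=> l y y1; apply: val_inj => /=; have [_ _ ->] := PsiP l.
Qed.

End AttachComplex.

(** * Adding one vertex to the neighbourhood complex *)

Section NewVertex.
Context {R : realType} {n : nat}.
Variables (e : rel 'I_n) (v w0 : 'I_n).
Implicit Types (w x y u c : 'I_n) (s t : {set 'I_n}).

Hypothesis e_sym : symmetric e.
Hypothesis e_irr : irreflexive e.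
Hypothesis tf : forall x y c, e x y -> e y c -> e x c -> False.
Hypothesis two : forall w w' x y, e v w -> e v w' -> w != w' -> x != v -> y != v ->
  e w x -> e w' x -> e w y -> e w' y -> x = y.
Hypothesis three : forall x w1 w2 w3, x != v -> e v w1 -> e v w2 -> e v w3 ->
  e x w1 -> e x w2 -> e x w3 -> [\/ w1 = w2, w1 = w3 | w2 = w3].
Hypothesis common : forall w w', e v w -> e v w' -> w != w' ->
  exists u, [/\ u != v, e w u & e w' u].
Hypothesis vw0 : e v w0.
Hypothesis w0_min : forall w, e v w -> (w0 <= w)%N.

(* [cplx0] and [cplx5] are the complexes before and after adding [v]. The
   function sending [x] to the [w] with [own w x] makes each vertex of the link of
   [v] belong to a single neighbour of [v]. *)
Definition inb c x := (x == c) || e c x.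

Definition own w x := (x == w) ||
  (e w x && [forall w', (e v w' && e w' x) ==> (w <= w')%N]).

Definition cplx5 : set {set 'I_n} :=
  [set s | s != finset.set0 /\ exists c, {in s, forall x, inb c x}].
Definition cplx0 : set {set 'I_n} :=
  [set s | [/\ s != finset.set0, v \notin s &
     exists2 c, c != v & {in s, forall x, inb c x}]].
Definition over (s : {set 'I_n}) (P : 'I_n -> Prop) :=
  v \in s /\ forall x, x \in s -> x != v -> P x.
Definition cplx1 : set {set 'I_n} :=
  [set s | cplx0 s \/ exists2 w, e v w & over s (fun x => x = w0 \/ x = w)].
Definition cplxA : set {set 'I_n} :=
  [set s | cplx1 s \/ exists2 w, e v w & over s (own w)].
Definition tri1 : set {set 'I_n} :=
  [set s | exists w w', [/\ e v w, e v w', w != w', w != w0 /\ w' != w0 &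
     s = [set v; w; w']%SET]].
Definition tri2 : set {set 'I_n} :=
  [set s | exists u w, [/\ u != v, e v w, e w u, ~~ own w u & s = [set v; u; w]%SET]].
Definition cplxB : set {set 'I_n} := [set s | [\/ cplxA s, tri1 s | tri2 s]].
(** Of the new simplices inside N[v] only those with at most two neighbours of [v] remain; this
    makes that part of the link of [v] a graph. *)
Definition cplx4 : set {set 'I_n} :=
  [set s | [\/ cplx0 s, exists2 w, e v w & over s (inb w) |
     exists w w', [/\ e v w, e v w' & over s (fun x => x = w \/ x = w')]]].

Lemma eC x y : e x y -> e y x. Proof. by rewrite e_sym. Qed.

Lemma eW w w' : e v w -> e v w' -> e w w' -> False.
Proof. by move=> h h' ww'; exact: tf h ww' h'. Qed.

Lemma vW w : e v w -> w != v.
Proof. by apply: contraTneq => ->; rewrite e_irr. Qed.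

Lemma own_id w : own w w. Proof. by rewrite /own eqxx. Qed.

Lemma own_inb w x : own w x -> inb w x.
Proof. by rewrite /own /inb => /orP[->//|/andP[-> _]]; rewrite orbT. Qed.

Lemma ownW w x : e v w -> e v x -> inb w x -> x = w.
Proof. by move=> vw vx /orP[/eqP//|/(eW vw vx)]. Qed.

Lemma own_uniq w w' x : e v w -> e v w' -> own w x -> own w' x -> w = w'.
Proof.
move=> vw vw' /orP[/eqP-> /own_inb /(ownW vw' vw)//|/andP[wx /forallP mw]].
move=> /orP[/eqP xw'|/andP[w'x /forallP mw']].
  by move: wx; rewrite xw' => /(eW vw vw').
apply/val_inj/eqP; rewrite eqn_leq.
by have := mw w'; have := mw' w; rewrite vw vw' wx w'x /= => -> ->.
Qed.

Lemma own_ex w x : e v w -> inb w x -> exists2 w', e v w' & own w' x.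
Proof.
move=> vw /orP[/eqP->|wx]; first by exists w => //; exact: own_id.
have Pw : (fun w' => e v w' && e w' x) w by rewrite vw.
have := @arg_minnP _ w (fun w' => e v w' && e w' x) (fun w' => nat_of_ord w') Pw.
case=> w' /andP[vw' w'x] mw'; exists w' => //; rewrite /own w'x /=.
by apply/orP; right; apply/forallP => z; apply/implyP; exact: mw'.
Qed.

Lemma over_sub s t P : over s P -> t \subset s -> v \in t -> over t P.
Proof. by move=> [_ h] /fintype.subsetP ts vt; split=> // x /ts; exact: h. Qed.

Lemma over_imp s (P Q : 'I_n -> Prop) : (forall x, P x -> Q x) -> over s P -> over s Q.
Proof. by move=> PQ [vs h]; split=> // x xs xv; exact/PQ/h. Qed.

Lemma over_inb0 s t w : e v w -> over s (inb w) -> t \subset s -> v \notin t ->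
  t != finset.set0 -> cplx0 t.
Proof.
move=> vw [_ h] /fintype.subsetP ts vt t0; split=> //; exists w; first exact: vW.
by move=> x xt; apply: h; [exact: ts|apply: contraNneq vt => <-].
Qed.

(** Two neighbours of [v] already span a simplex of the old complex, centred at their further common
    neighbour. *)
Lemma over_pair0 s t w w' : e v w -> e v w' -> over s (fun x => x = w \/ x = w') ->
  t \subset s -> v \notin t -> t != finset.set0 -> cplx0 t.
Proof.
move=> vw vw' [_ h] /fintype.subsetP ts vt t0; split=> //.
have xv x : x \in t -> x != v by move=> xt; apply: contraNneq vt => <-.
have [ww'|ww'] := eqVneq w w'.
  exists w; first exact: vW.
  move=> x xt; have := h x (ts _ xt) (xv _ xt).
  by rewrite -ww' /inb => -[]->; rewrite eqxx.
have [u [uv wu w'u]] := common vw vw' ww'; exists u => // x xt.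
by have [->|->] := h x (ts _ xt) (xv _ xt); rewrite /inb e_sym ?wu ?w'u orbT.
Qed.

Lemma cplx0_complex : is_complex cplx0.
Proof.
move=> s t [s0 vs [c cv h]] /fintype.subsetP ts t0; split=> //.
  by apply: contra vs; exact: ts.
by exists c => // x /ts; exact: h.
Qed.

Lemma cplx5_complex : is_complex cplx5.
Proof.
move=> s t [s0 [c h]] /fintype.subsetP ts t0.
by split=> //; exists c => x /ts; exact: h.
Qed.

Lemma cplx1_complex : is_complex cplx1.
Proof.
move=> s t [s0|[w vw o]] ts t0; first by left; exact: cplx0_complex s0 ts t0.
have [vt|vt] := boolP (v \in t); last by left; exact: over_pair0 o ts vt t0.
by right; exists w => //; exact: over_sub o ts vt.
Qed.

Lemma cplxA_complex : is_complex cplxA.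
Proof.
move=> s t [s0|[w vw o]] ts t0; first by left; exact: cplx1_complex s0 ts t0.
have [vt|vt] := boolP (v \in t); first by right; exists w => //; exact: over_sub o ts vt.
by left; left; apply: over_inb0 vw (over_imp _ o) ts vt t0 => x; exact: own_inb.
Qed.

Lemma cplx4_complex : is_complex cplx4.
Proof.
move=> s t [s0|[w vw o]|[w [w' [vw vw' o]]]] ts t0.
- by apply: Or31; exact: cplx0_complex s0 ts t0.
- have [vt|vt] := boolP (v \in t); last by apply: Or31; exact: over_inb0 o ts vt t0.
  by apply: Or32; exists w => //; exact: over_sub o ts vt.
- have [vt|vt] := boolP (v \in t); last by apply: Or31; exact: over_pair0 o ts vt t0.
  by apply: Or33; exists w, w'; split=> //; exact: over_sub o ts vt.
Qed.

Lemma cplx0_single x : x != v -> cplx0 (finset.set1 x).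
Proof.
move=> xv; split; last by exists x => // y; rewrite inE /inb => ->.
- by apply/finset.set0Pn; exists x; rewrite inE.
- by rewrite inE eq_sym.
Qed.

(** A simplex outside [cplx4] has [v] as its only centre, so adding [v] keeps it in N[v]. *)
Lemma sdr54 : sdr (R := R) cplx5 cplx4.
Proof.
apply: (@collapse_sdr _ _ _ _ v).
- exact: cplx5_complex.
- exact: cplx4_complex.
- move=> s [[s0 _ [c _ h]]|[w vw [vs h]]|[w [w' [vw vw' [vs h]]]]].
  + by split=> //; exists c.
  + split; first by apply/finset.set0Pn; exists v.
    exists w => x xs; have [->|xv] := eqVneq x v; first by rewrite /inb e_sym vw orbT.
    exact: h.
  + split; first by apply/finset.set0Pn; exists v.
    exists v => x xs; have [->|xv] := eqVneq x v; first by rewrite /inb eqxx.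
    by have [->|->] := h x xs xv; rewrite /inb ?vw ?vw' orbT.
- apply: Or32; exists w0 => //; split; first by rewrite inE.
  by move=> x; rewrite inE => /eqP->; rewrite eqxx.
- move=> s s0 [_ [c h]] n4.
  have cv : c = v.
    apply/eqP/negPn/negP => cv; apply: n4; have [vs|vs] := boolP (v \in s).
      have := h v vs; rewrite /inb eq_sym (negbTE cv) /= e_sym => vc.
      by apply: Or32; exists c => //; split=> // x xs _; exact: h.
    by apply: Or31; split=> //; exists c.
  rewrite {c}cv in h; split.
    split; first by apply/finset.set0Pn; exists v; rewrite !inE eqxx.
    by exists v => x; rewrite !inE => /predU1P[->|/h//]; rewrite /inb eqxx.
  have sW x : x \in s -> x != v -> e v x.
    by move=> /h /orP[/eqP->|//]; rewrite eqxx.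
  (* If the face without [v] were in [cplx4] it would have a centre [c] other than [v]. Either [c]
     is a neighbour of [v], or by [three] at most two neighbours of [v] occur; both put [s] into
     [cplx4]. *)
  move=> n4'; apply: n4; have vsv : v \notin (s :\ v)%SET by rewrite !inE eqxx.
  have {n4'} [_ _ [c cv hc]] : cplx0 (s :\ v)%SET.
    by case: n4' => [//|[w _ [vs]]|[w [w' [_ _ [vs]]]]]; move: vs; rewrite (negbTE vsv).
  have hc' x : x \in s -> x != v -> inb c x by move=> xs xv; apply: hc; rewrite !inE xv.
  have [vs|vs] := boolP (v \in s); last first.
    apply: Or31; split=> //; exists c => // x xs; apply: hc' => //.
    by apply: contraNneq vs => <-.
  have [vc|vc] := boolP (e v c).
    apply: Or32; exists c => //.
  apply: Or33.
  have ec x : x \in s -> x != v -> e c x.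
    move=> xs xv; have /orP[/eqP xc|//] := hc' x xs xv.
    by move: vc; rewrite -xc (sW x xs xv).
  have [x /andP[xs xv]|nx] := pickP [pred x | (x \in s) && (x != v)]; last first.
    exists w0, w0; split=> //; split=> // x xs xv.
    by have := nx x; rewrite /= xs xv.
  have [y /and3P[ys yv yx]|ny] := pickP [pred y | [&& y \in s, y != v & y != x]]; last first.
    exists x, x; split; [exact: sW|exact: sW|split=> // z zs zv; left].
    by have := ny z; rewrite /= zs zv /= => /negbT; rewrite negbK => /eqP.
  exists x, y; split; [exact: sW|exact: sW|split=> // z zs zv].
  have [xy|xz|yz] := three cv (sW x xs xv) (sW y ys yv) (sW z zs zv) (ec x xs xv)
    (ec y ys yv) (ec z zs zv).
  + by rewrite xy eqxx in yx.
  + by left.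
  + by right.
Qed.

(** The simplices in the star of [v] inside N[w] that are absent from [cplxB]: a vertex not owned by
    [w], plus another besides [v] and [w]. The second vertex makes the family stable under toggling
    [w] and leaves the triangles of [tri2] out of it. *)
Let D w : set {set 'I_n} := [set s | over s (inb w) /\
  exists x y, [/\ x \in s /\ y \in s, x != v /\ y != v, x != w /\ y != w, x != y &
    ~~ own w x]].

Lemma over_inbBD s w : e v w -> over s (inb w) -> cplxB s \/ D w s.
Proof.
move=> vw o; have [vs h] := o.
have [x /and3P[xs xv nx]|nx] := pickP [pred x | [&& x \in s, x != v & ~~ own w x]]; last first.
  left; apply: Or31; right; exists w => //; split=> // x xs xv.
  by have := nx x; rewrite /= xs xv /= => /negbT; rewrite negbK.
have xw : x != w by apply: contraNneq nx => ->; exact: own_id.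
have [y /and4P[ys yv yx yw]|ny] := pickP [pred y | [&& y \in s, y != v, y != x & y != w]].
  by right; split=> //; exists x, y; split=> //; rewrite eq_sym.
have sxw y : y \in s -> y != v -> y = x \/ y = w.
  move=> ys yv; have := ny y; rewrite /= ys yv /=.
  by case: eqVneq => [->|_]; [left|case: eqVneq => [->|_] //; right].
have wx : e w x by have := h x xs xv; rewrite /inb (negbTE xw).
left; have [ws|ws] := boolP (w \in s).
  apply: Or33; exists x, w; split=> //; apply/setP => y; rewrite !inE.
  apply/idP/idP => [ys|/orP[/orP[]|] /eqP-> //].
  by have [//|yv] := eqVneq y v; have [->|->] := sxw y ys yv; rewrite eqxx ?orbT.
have [w' vw' ow'] := own_ex vw (h x xs xv).
apply: Or31; right; exists w' => //; split=> // y ys yv.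
by have [->//|yw] := sxw y ys yv; rewrite -yw ys in ws.
Qed.

Lemma cplxB_complex : is_complex cplxB.
Proof.
have face s t w : over s (inb w) -> e v w -> t \subset s -> v \notin t ->
    t != finset.set0 -> cplxB t.
  by move=> o vw ts vt t0; apply: Or31; left; left; exact: over_inb0 o ts vt t0.
move=> s t [As|[w [w' [vw vw' ww' [w00 w0'] sE]]]|[u [w [uv vw wu nu sE]]]] ts t0.
- by apply: Or31; exact: cplxA_complex As ts t0.
- have os : over s (fun x => x = w \/ x = w').
    split; first by rewrite sE !inE eqxx.
    move=> x; rewrite sE !inE => /orP[/orP[/eqP->|/eqP->]|/eqP->]; rewrite ?eqxx //.
      by left.
    by right.
  have [vt|vt] := boolP (v \in t); last first.
    by apply: Or31; left; left; exact: over_pair0 os ts vt t0.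
  have ot := over_sub os ts vt.
  have [wt|wt] := boolP (w \in t); have [wt'|wt'] := boolP (w' \in t).
  + apply: Or32; exists w, w'; split=> //; apply/eqP; rewrite finset.eqEsubset -sE ts /= sE.
    by apply/fintype.subsetP => x; rewrite !inE => /orP[/orP[]|] /eqP->.
  + apply: Or31; left; right; exists w => //; split=> // x xt xv.
    by have [->|xw] := ot.2 x xt xv; [right|rewrite -xw xt in wt'].
  + apply: Or31; left; right; exists w' => //; split=> // x xt xv.
    by have [xw|->] := ot.2 x xt xv; [rewrite -xw xt in wt|right].
  + apply: Or31; left; right; exists w => //; split=> // x xt xv.
    by have [xw|xw] := ot.2 x xt xv; [rewrite -xw xt in wt|rewrite -xw xt in wt'].
- have os : over s (fun x => x = u \/ x = w).
    split; first by rewrite sE !inE eqxx.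
    move=> x; rewrite sE !inE => /orP[/orP[/eqP->|/eqP->]|/eqP->]; rewrite ?eqxx //.
      by left.
    by right.
  have os' : over s (inb w).
    by apply: over_imp os => x [->|->]; rewrite /inb ?wu ?orbT ?eqxx.
  have [vt|vt] := boolP (v \in t); last exact: face os' vw ts vt t0.
  have [//|[_ [x [y [[xt yt] [xv yv] [xw yw] xy _]]]]] := over_inbBD vw (over_sub os' ts vt).
  have ot := over_sub os ts vt.
  have [xu|xw'] := ot.2 x xt xv; last by rewrite xw' eqxx in xw.
  have [yu|yw'] := ot.2 y yt yv; last by rewrite yw' eqxx in yw.
  by rewrite xu yu eqxx in xy.
Qed.

(** The two vertices that place a simplex in [D w] are both adjacent to [w]; by [two] they cannot
    both be adjacent to another neighbour of [v]. This makes the families disjoint and separates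
    them from the simplices owned by another neighbour. *)
Lemma sdr4B : sdr (R := R) cplx4 cplxB.
Proof.
suff: sdr (R := R) cplx4 cplxB /\ is_complex cplx4 by case.
apply: (@collapse_family R n cplx4 cplxB D (enum [pred w | e v w])).
- exact: enum_uniq.
- exact: cplxB_complex.
- move=> w s t; rewrite mem_enum /= => vw [ho _] ts t0.
  have [vt|vt] := boolP (v \in t); first exact: over_inbBD vw (over_sub ho ts vt).
  by left; apply: Or31; left; left; exact: over_inb0 ho ts vt t0.
- by move=> w; rewrite mem_enum /= => vw; apply: Or31; left; left; exact/cplx0_single/vW.
- move=> w s; rewrite mem_enum /= => vw [[vs h] [x [y [[xs ys] [xv yv] [xw yw] xy ox]]]].
  have vw' : v != w by rewrite eq_sym vW.
  split; split; try split.
  + by rewrite !inE vs orbT.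
  + by move=> z; rewrite !inE => /predU1P[-> _|]; [rewrite /inb eqxx|exact: h].
  + by exists x, y; rewrite !inE xs ys !orbT.
  + by rewrite !inE vs andbT eq_sym vW.
  + by move=> z; rewrite !inE => /andP[_]; exact: h.
  + by exists x, y; rewrite !inE xs ys xw yw.
- move=> w s; rewrite mem_enum /= => vw [[vs h] [x [y [[xs ys] [xv yv] [xw yw] xy ox]]]].
  have wx : e w x by have := h x xs xv; rewrite /inb (negbTE xw).
  have wy : e w y by have := h y ys yv; rewrite /inb (negbTE yw).
  have nW z : e w z -> e v z -> False by move=> wz vz; exact: eW vw vz wz.
  case=> [[[[_ nvs _]|[w' vw' [_ h']]]|[w' vw' [_ h']]]|[w1 [w2 [v1 v2 _ _ sE]]]|[u [w1 [uv v1 w1u _ sE]]]].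
  + by rewrite vs in nvs.
  + by have [xx|xx] := h' x xs xv; apply: (nW x wx); rewrite xx.
  + have ww' : w != w' by apply: contraNneq ox => ->; exact: h'.
    have w'z z : z \in s -> z != v -> e w z -> e w' z.
      move=> zs zv wz; have /own_inb/orP[/eqP zw'|//] := h' z zs zv.
      by case: (nW z wz); rewrite zw'.
    by move/eqP: xy; apply; apply: (two vw vw' ww') => //; exact: w'z.
  + move: xs; rewrite sE !inE (negbTE xv) /= => /orP[/eqP xx|/eqP xx];
      by apply: (nW x wx); rewrite xx.
  + move: xs ys xy; rewrite sE !inE (negbTE xv) (negbTE yv) /=.
    have nw z : e w z -> z != w1 by move=> wz; apply/eqP => zz; apply: (nW z wz); rewrite zz.
    rewrite (negbTE (nw x wx)) (negbTE (nw y wy)) !orbF => /eqP-> /eqP->.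
    by rewrite eqxx.
- move=> w w' s; rewrite !mem_enum /= => vw vw'.
  move=> [[vs h] [x [y [[xs ys] [xv yv] [xw yw] xy _]]]] [[_ h'] _].
  have wx : e w x by have := h x xs xv; rewrite /inb (negbTE xw).
  have wy : e w y by have := h y ys yv; rewrite /inb (negbTE yw).
  have w'z z : z \in s -> z != v -> e w z -> e w' z.
    move=> zs zv wz; have /orP[/eqP zw'|//] := h' z zs zv.
    by case: (eW vw vw'); rewrite -zw'.
  apply/eqP/negPn/negP => ww'; move/eqP: xy; apply.
  by apply: (two vw vw' ww') => //; exact: w'z.
- move=> s; split.
    case=> [s0|[w vw o]|[w [w' [vw vw' o]]]].
    + by left; apply: Or31; left; left.
    + have [Bs|Ds] := over_inbBD vw o; [by left|right].
      by exists w => //; rewrite mem_enum.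
    + have [vs h] := o; left.
      have [ws|ws] := boolP ((w \in s) && (w != w0)); last first.
        apply: Or31; left; right; exists w' => //; split=> // x xs xv.
        have [xw|->] := h x xs xv; last by right.
        by move: ws; rewrite -xw xs negbK => /eqP; left.
      have [ws'|ws'] := boolP ((w' \in s) && (w' != w0)); last first.
        apply: Or31; left; right; exists w => //; split=> // x xs xv.
        have [->|xw] := h x xs xv; first by right.
        by move: ws'; rewrite -xw xs negbK => /eqP; left.
      move: ws ws' => /andP[ws w00] /andP[ws' w0'].
      have [ww'|ww'] := eqVneq w w'.
        apply: Or31; left; right; exists w => //; split=> // x xs xv.
        by rewrite -ww' in h; have [->|->] := h x xs xv; right.
      apply: Or32; exists w, w'; split=> //; apply/setP => x; rewrite !inE.
      apply/idP/idP => [xs|/orP[/orP[]|] /eqP-> //].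
      by have [//|xv] := eqVneq x v; have [->|->] := h x xs xv; rewrite eqxx ?orbT.
  case=> [|[w]]; last by rewrite mem_enum /= => vw [ho _]; apply: Or32; exists w.
  case=> [[[s0|[w vw o]]|[w vw o]]|[w [w' [vw vw' _ _ ->]]]|[u [w [uv vw wu _ ->]]]].
  + exact: Or31.
  + by apply: Or33; exists w0, w.
  + by apply: Or32; exists w => //; apply: over_imp o => x; exact: own_inb.
  + apply: Or33; exists w, w'; split=> //; split; first by rewrite !inE eqxx.
    move=> x; rewrite !inE => /orP[/orP[]|] /eqP->; rewrite ?eqxx //; [by left|by right].
  + apply: Or32; exists w => //; split; first by rewrite !inE eqxx.
    by move=> x; rewrite !inE => /orP[/orP[]|] /eqP->; rewrite ?eqxx // /inb ?wu ?orbT ?eqxx.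
Qed.

(** A vertex other than [v] and [w] that [w] owns distinguishes these simplices from those of
    [cplx1], and uniqueness of owners makes the families disjoint. *)
Let D' w : set {set 'I_n} := [set s | over s (own w) /\
  exists x, [/\ x \in s, x != v & x != w]].

Lemma sdrA1 : sdr (R := R) cplxA cplx1.
Proof.
have dich s w : e v w -> over s (own w) -> cplx1 s \/ D' w s.
  move=> vw o; have [vs h] := o.
  have [x /and3P[xs xv xw]|nx] := pickP [pred x | [&& x \in s, x != v & x != w]].
    by right; split=> //; exists x.
  left; right; exists w => //; split=> // x xs xv; right.
  by have := nx x; rewrite /= xs xv /= => /negbT; rewrite negbK => /eqP.
suff: sdr (R := R) cplxA cplx1 /\ is_complex cplxA by case.
apply: (@collapse_family R n cplxA cplx1 D' (enum [pred w | e v w])).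
- exact: enum_uniq.
- exact: cplx1_complex.
- move=> w s t; rewrite mem_enum /= => vw [ho _] ts t0.
  have [vt|vt] := boolP (v \in t); first exact: dich vw (over_sub ho ts vt).
  by left; left; apply: over_inb0 vw (over_imp _ ho) ts vt t0 => x; exact: own_inb.
- by move=> w; rewrite mem_enum /= => vw; left; exact/cplx0_single/vW.
- move=> w s; rewrite mem_enum /= => vw [[vs h] [x [xs xv xw]]].
  have vw' : v != w by rewrite eq_sym vW.
  split; split; try split.
  + by rewrite !inE vs orbT.
  + by move=> z; rewrite !inE => /predU1P[-> _|]; [exact: own_id|exact: h].
  + by exists x; rewrite !inE xs orbT.
  + by rewrite !inE vs andbT eq_sym vW.
  + by move=> z; rewrite !inE => /andP[_]; exact: h.
  + by exists x; rewrite !inE xs xw.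
- move=> w s; rewrite mem_enum /= => vw [[vs h] [x [xs xv xw]]].
  case=> [[_ nvs _]|[w' vw' [_ h']]]; first by rewrite vs in nvs.
  have vx : e v x by have [->|->] := h' x xs xv.
  by move/eqP: xw; apply; exact: ownW vw vx (own_inb (h x xs xv)).
- move=> w w' s; rewrite !mem_enum /= => vw vw' [[vs h] [x [xs xv xw]]] [[_ h'] _].
  exact: own_uniq vw vw' (h x xs xv) (h' x xs xv).
- move=> s; split=> [[s1|[w vw o]]|[s1|[w]]].
  + by left.
  + by have [s1|Ds] := dich s w vw o; [left|right; exists w => //; rewrite mem_enum].
  + by left.
  + by rewrite mem_enum /= => vw [ho _]; right; exists w.
Qed.

(** The remaining simplices through [v] form a cone over a star with centre [w0], so toggling [w0]
    matches them. *)
Lemma sdr10 : sdr (R := R) cplx1 cplx0.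
Proof.
apply: (@collapse_sdr _ _ _ _ w0).
- exact: cplx1_complex.
- exact: cplx0_complex.
- by move=> s; left.
- exact/cplx0_single/vW.
- move=> s s0 [//|[w vw [vs h]]] _; split.
    right; exists w => //; split; first by rewrite !inE vs orbT.
    by move=> x; rewrite !inE => /predU1P[->|xs]; [left|exact: h].
  by move=> [_]; rewrite !inE vs andbT negbK => /eqP vw0'; move: vw0; rewrite -vw0' e_irr.
Qed.

Lemma sdr5B : sdr (R := R) cplx5 cplxB.
Proof. exact: sdr_trans sdr54 sdr4B. Qed.

Lemma sdrA0 : sdr (R := R) cplxA cplx0.
Proof. exact: sdr_trans sdrA1 sdr10. Qed.

(** * Null-homotopic boundaries, the coding of the triangles, and connectedness *)

Hypothesis cube : forall w1 w2 w3, e v w1 -> e v w2 -> e v w3 ->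
  w1 != w2 -> w2 != w3 -> w1 != w3 ->
  exists (t u12 u23 u13 : 'I_n), [/\ t != v, [/\ u12 != v, e u12 t, e u12 w1 & e u12 w2],
    [/\ u23 != v, e u23 t, e u23 w2 & e u23 w3] &
    [/\ u13 != v, e u13 t, e u13 w1 & e u13 w3]].
Hypothesis descend : forall x, (0 < x)%N -> exists2 y : 'I_n, (y < x)%N & e x y.

Lemma cplxA_inb x y z c : c != v -> x != v -> y != v -> z != v ->
  inb c x -> inb c y -> inb c z -> cplxA [set x; y; z]%SET.
Proof.
move=> cv xv yv zv cx cy cz; left; left; split.
- by apply/finset.set0Pn; exists x; rewrite !inE eqxx.
- by rewrite !inE !negb_or !(eq_sym v) xv yv.
- by exists c => // k; rewrite !inE => /orP[/orP[]|] /eqP->.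
Qed.

Lemma cplxA_w0 s w : e v w -> v \in s ->
  (forall x, x \in s -> [\/ x = v, x = w0 | x = w]) -> cplxA s.
Proof.
move=> vw vs h; left; right; exists w => //; split=> // x xs.
by have [->|->|->] := h x xs; rewrite ?eqxx // => _; [left|right].
Qed.

(** The face on two of the neighbours and the apex [t] lies in the closed neighbourhood of the cube
    vertex adjacent to all three, so it belongs to the old complex. *)
Lemma null_www w1 w2 w3 : e v w1 -> e v w2 -> e v w3 ->
  w1 != w2 -> w2 != w3 -> w1 != w3 -> null (R := R) cplxA w1 w2 w3.
Proof.
move=> v1 v2 v3 n12 n23 n13.
have [t [u12 [u23 [u13 [tv [a1 a2 a3 a4] [b1 b2 b3 b4] [c1 c2 c3 c4]]]]]] :=
  cube v1 v2 v3 n12 n23 n13.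
have P x c : e c x -> inb c x by rewrite /inb => ->; rewrite orbT.
by apply: (@null_cone _ _ _ _ _ _ t); apply: null_simplex;
  [apply: (@cplxA_inb _ _ _ u12)|apply: (@cplxA_inb _ _ _ u23)|
   apply: (@cplxA_inb _ _ _ u13)]; first [assumption|exact: vW|exact: P].
Qed.

Lemma null_vw0 w : e v w -> [/\ null (R := R) cplxA v w w0 & null (R := R) cplxA w v w0].
Proof.
move=> vw; split; apply: null_simplex; apply: (cplxA_w0 vw).
- by rewrite !inE eqxx.
- by move=> x; rewrite !inE => /orP[/orP[]|] /eqP->; [exact: Or31|exact: Or33|exact: Or32].
- by rewrite !inE eqxx orbT.
- by move=> x; rewrite !inE => /orP[/orP[]|] /eqP->; [exact: Or33|exact: Or31|exact: Or32].
Qed.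

Lemma null_vww w w' : e v w -> e v w' -> w != w' -> w != w0 -> w' != w0 ->
  null (R := R) cplxA v w w' /\ null (R := R) cplxA w v w'.
Proof.
move=> vw vw' ww' w00 w0'; have [a b] := null_vw0 vw; have [a' b'] := null_vw0 vw'.
split; apply: (@null_cone _ _ _ _ _ _ w0) => //; apply: null_www => //.
by rewrite eq_sym.
Qed.

(** The default [v] is never taken for distinct neighbours of [v], by [common]. *)
Definition ucom w1 w := odflt v [pick u | [&& u != v, e w1 u & e w u]].

(** By [three], [w1] and [w] are the only neighbours of [v] adjacent to this vertex, so the smaller
    one owns it. *)
Lemma ucomP w1 w : e v w1 -> e v w -> (w1 < w)%N ->
  [/\ ucom w1 w != v, e w1 (ucom w1 w), e w (ucom w1 w), ~~ own w (ucom w1 w) &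
      own w1 (ucom w1 w) /\ ~~ e v (ucom w1 w)].
Proof.
move=> v1 vw lt; have ne : w1 != w by apply: contraTneq lt => ->; rewrite ltnn.
rewrite /ucom; case: pickP => [u /and3P[uv e1 ew] /=|nu]; last first.
  by have [u [uv e1 ew]] := common v1 vw ne; have := nu u; rewrite uv e1 ew.
split=> //.
- rewrite /own negb_or; apply/andP; split; first by apply: contraTneq ew => ->; rewrite e_irr.
  rewrite ew /=; apply/negP => /forallP/(_ w1); rewrite v1 e1 /=.
  by rewrite leqNgt lt.
- split; last by apply/negP => /(eW v1)/(_ e1).
  rewrite /own e1 /=; apply/orP; right; apply/forallP => w2; apply/implyP => /andP[v2 e2].
  have [] := three uv v1 vw v2 (eC e1) (eC ew) (eC e2).
  + by move=> h; rewrite h eqxx in ne.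
  + by move=> ->.
  + by move=> <-; exact: ltnW.
Qed.

(* A pair [(w, w')] with [w < w'] codes the triangle [{v, w, w'}]; one with
   [w' <= w] codes [{v, ucom w1 w, w}], where [w1] is [w'], or [w0] if [w = w']. *)
Let W' : {set 'I_n} := ([set w | e v w] :\ w0)%SET.
Let I2 : {set 'I_n * 'I_n} := finset.setX W' W'.
Let prm (p : 'I_n * 'I_n) := if p.1 == p.2 then w0 else p.2.
Let fb (p : 'I_n * 'I_n) := if (p.1 < p.2)%N then p.1 else ucom (prm p) p.1.
Let fc (p : 'I_n * 'I_n) := if (p.1 < p.2)%N then p.2 else p.1.

Let I2P p : p \in I2 -> [/\ e v p.1, e v p.2, p.1 != w0 & p.2 != w0].
Proof. by case: p => w w'; rewrite !inE /= => /andP[/andP[-> ->] /andP[-> ->]]. Qed.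

Let prmP p : p \in I2 -> ~~ (p.1 < p.2)%N -> e v (prm p) /\ (prm p < p.1)%N.
Proof.
move=> /I2P[v1 v2 n1 n2]; rewrite -leqNgt /prm; case: eqVneq => [_ _|ne le].
  by split=> //; rewrite ltn_neqAle w0_min // andbT eq_sym.
by split=> //; rewrite ltn_neqAle le andbT eq_sym.
Qed.

Variant I2_spec (p : 'I_n * 'I_n) : 'I_n -> 'I_n -> Prop :=
  | I2_tri1 of (p.1 < p.2)%N & p.1 != p.2 & e v p.1 & e v p.2 & p.1 != w0 & p.2 != w0 :
      I2_spec p p.1 p.2
  | I2_tri2 u w1 of u = ucom w1 p.1 & w1 = prm p & ~~ (p.1 < p.2)%N & e v w1 & e v p.1 &
      (w1 < p.1)%N : I2_spec p u p.1.

Let I2_case p : p \in I2 -> I2_spec p (fb p) (fc p).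
Proof.
move=> pI; have [v1 v2 n1 n2] := I2P pI; rewrite /fb /fc.
have [lt|ge] := boolP (p.1 < p.2)%N.
  by apply: I2_tri1 => //; apply: contraTneq lt => ->; rewrite ltnn.
by have [vp lt] := prmP pI ge; exact: I2_tri2.
Qed.

Let T (p : 'I_n * 'I_n) : {set 'I_n} := [set v; fb p; fc p]%SET.

Let in_T p x : (x \in T p) = [|| x == v, x == fb p | x == fc p].
Proof. by rewrite !inE orbA. Qed.

Let T_neq p : p \in I2 -> [/\ fb p != v, fc p != v & fb p != fc p].
Proof.
move=> /I2_case[_ ne v1 v2 _ _|u w1 -> _ _ v1 vp lt]; first by rewrite !vW.
have [uv _ eu _ _] := ucomP v1 vp lt; rewrite uv vW //; split=> //.
by apply: contraTneq eu => ->; rewrite e_irr.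
Qed.

Let T_card p : p \in I2 -> #|T p| = 3.
Proof.
move=> /T_neq[bv cv bc]; rewrite /T finset.setUC cardsU1 cards2 !inE negb_or.
by rewrite cv (eq_sym (fc p)) bc (eq_sym v) bv.
Qed.

(** A neighbour of [v] is owned only by itself, so two distinct ones, both different from [w0], fit
    neither part of A. In the second kind of triangle [u] is not adjacent to [v], which excludes
    [cplx1], and it is not owned by the neighbour beside it. *)
Let T_notA p : p \in I2 -> ~ cplxA (T p).
Proof.
move=> pI; have [bv cv bc] := T_neq pI.
have vT : v \in T p by rewrite in_T eqxx.
have bT : fb p \in T p by rewrite in_T eqxx orbT.
have cT : fc p \in T p by rewrite in_T eqxx !orbT.
have := I2_case pI; move: bT cT bv cv bc.
move: (fb p) (fc p) => b c bT cT bv cv bc bcs.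
case=> [[[_ nv _]|[w vw [_ h]]]|[w vw [_ h]]]; first by rewrite vT in nv.
- have := h _ bT bv; have := h _ cT cv; case: bcs bc => [_ _ _ _ n1 n2|u w1 -> _ _ v1 vp lt] bc.
    move=> [/eqP|ec]; first by rewrite (negbTE n2).
    by move=> [/eqP|eb]; [rewrite (negbTE n1)|rewrite eb ec eqxx in bc].
  have [_ _ _ _ [_ nvu]] := ucomP v1 vp lt.
  by move=> _ [eu|eu]; rewrite eu ?vw0 ?vw in nvu.
- have := h _ bT bv; have := h _ cT cv; case: bcs bc => [_ _ v1 v2 _ _|u w1 -> _ _ v1 vp lt] bc.
    move=> /own_inb/(ownW vw v2) e2 /own_inb/(ownW vw v1) e1.
    by rewrite e1 e2 eqxx in bc.
  have [_ _ _ nu _] := ucomP v1 vp lt.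
  by move=> /own_inb/(ownW vw vp) <-; rewrite (negbTE nu).
Qed.

Let T_inj p p' : p \in I2 -> p' \in I2 -> T p = T p' -> p = p'.
Proof.
move=> pI pI' TT.
have [bv cv bc] := T_neq pI; have [bv' cv' bc'] := T_neq pI'.
have b1 : (fb p == fb p') || (fb p == fc p').
  have : fb p \in T p' by rewrite -TT in_T eqxx orbT.
  by rewrite in_T (negbTE bv).
have c1 : (fc p == fb p') || (fc p == fc p').
  have : fc p \in T p' by rewrite -TT in_T eqxx !orbT.
  by rewrite in_T (negbTE cv).
have := I2_case pI; have := I2_case pI'.
move: bv cv bc bv' cv' bc' b1 c1.
move: (fb p) (fc p) (fb p') (fc p') => b c b' c' bv cv bc bv' cv' bc' b1 c1.
move=> spec' spec; move: b1 c1 bv cv bc bv' cv' bc'.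
case: spec' => [lt' _ v1' v2' _ _|u' w1' -> w1'E nlt' v1' vp' lt'];
case: spec => [lt _ v1 v2 _ _|u w1 -> w1E nlt v1 vp lt] b1 c1 bv cv bc bv' cv' bc'.
- case/orP: b1 => /eqP b1; case/orP: c1 => /eqP c1.
  + by rewrite b1 c1 eqxx in bc.
  + by rewrite [p]surjective_pairing [p']surjective_pairing b1 c1.
  + by rewrite b1 c1 in lt; have := ltn_trans lt' lt; rewrite ltnn.
  + by rewrite b1 c1 eqxx in bc.
- have [_ _ _ _ [_ nvu]] := ucomP v1 vp lt.
  by case/orP: b1 => /eqP b1; rewrite b1 ?v1' ?v2' in nvu.
- have [_ _ _ _ [_ nvu]] := ucomP v1' vp' lt'.
  case/orP: b1 => /eqP b1; first by rewrite -b1 v1 in nvu.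
  case/orP: c1 => /eqP c1; first by rewrite -c1 v2 in nvu.
  by rewrite b1 c1 eqxx in bc.
- have [uv e1 eu nu [_ nvu]] := ucomP v1 vp lt.
  have [uv' e1' eu' nu' [_ nvu']] := ucomP v1' vp' lt'.
  case/orP: b1 => /eqP b1; last by rewrite b1 vp' in nvu.
  case/orP: c1 => /eqP c1; first by rewrite -c1 vp in nvu'.
  (* Both triangles now share [u] and the larger neighbour; by [three] the smaller neighbour
     adjacent to [u] is determined. Since [w0] is excluded from the pairs, the diagonal code for
     [w0] is unambiguous. *)
  have pr : prm p = prm p'.
    rewrite -w1E -w1'E; rewrite -b1 in e1' eu'; rewrite -c1 in eu' lt'.
    have [//|h|h] := three uv v1 v1' vp (eC e1) (eC e1') (eC eu).
    + by rewrite h ltnn in lt.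
    + by rewrite h ltnn in lt'.
  have [_ _ _ n2] := I2P pI; have [_ _ _ n2'] := I2P pI'.
  rewrite [p]surjective_pairing [p']surjective_pairing c1; congr pair.
  move: pr; rewrite /prm c1.
  case: eqVneq => [<-|_]; case: eqVneq => [<-|_] // h; first by rewrite -h eqxx in n2'.
  by rewrite h eqxx in n2.
Qed.

Let T_face p (s : {set 'I_n}) : p \in I2 -> s \proper T p -> s != finset.set0 -> cplxA s.
Proof.
move=> pI sT s0.
have sTs := proper_sub sT.
have [vs|vs] := boolP (v \in s); last first.
  have sbc x : x \in s -> x = fb p \/ x = fc p.
    move=> xs; move/fintype.subsetP: sTs => /(_ x xs); rewrite in_T.
    have xv : x != v by apply: contraNneq vs => <-.
    by rewrite (negbTE xv) /= => /orP[] /eqP; [left|right].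
  left; left; split=> //.
  have := I2_case pI; move: sbc; move: (fb p) (fc p) => b c sbc.
  move=> spec; move: sbc; case: spec => [_ ne v1 v2 _ _|u w1 -> _ _ v1 vp lt] sbc.
    have [u [uv e1 e2]] := common v1 v2 ne; exists u => // x /sbc[->|->];
      by rewrite /inb e_sym ?e1 ?e2 orbT.
  have [uv e1 eu nu _] := ucomP v1 vp lt; exists p.1; first exact: vW.
  by move=> x /sbc[->|->]; rewrite /inb ?eqxx ?eu ?orbT.
have : (fb p \notin s) || (fc p \notin s).
  rewrite -negb_and; apply: contraL sT => /andP[bs cs].
  rewrite properE negb_and negbK sTs /=; apply/fintype.subsetP => x; rewrite in_T.
  by move=> /or3P[] /eqP->.
have sbc x : x \in s -> x != v -> x = fb p \/ x = fc p.
  move=> xs xv; move/fintype.subsetP: sTs => /(_ x xs); rewrite in_T.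
  by rewrite (negbTE xv) /= => /orP[] /eqP; [left|right].
have one z : e v z -> (forall x, x \in s -> x != v -> x = z) -> cplxA s.
  by move=> vz h; left; right; exists z => //; split=> // x xs xv; right; exact: h.
move: sbc; case: (I2_case pI) => [_ ne v1 v2 _ _|u w1 uE _ _ v1 vp lt] sbc /orP[ns|ns].
- by apply: (one _ v2) => x xs /(sbc x xs)[xx|//]; rewrite -xx xs in ns.
- by apply: (one _ v1) => x xs /(sbc x xs)[//|xx]; rewrite -xx xs in ns.
- by apply: (one _ vp) => x xs /(sbc x xs)[xx|//]; rewrite -xx xs in ns.
- have [uv e1 eu nu [ow _]] := ucomP v1 vp lt.
  right; exists w1 => //; split=> // x xs /(sbc x xs)[->|xx]; first by rewrite uE.
  by rewrite -xx xs in ns.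
Qed.

Let T_B s : cplxB s <-> cplxA s \/ exists2 p, p \in I2 & s = T p.
Proof.
split=> [[As|[w [w' [vw vw' ww' [wn wn'] ->]]]|[u [w [uv vw wu nu ->]]]]|[As|[p pI ->]]].
- by left.
- right; have pI (a b : 'I_n) : e v a -> e v b -> a != w0 -> b != w0 -> (a, b) \in I2.
    by move=> va vb an bn; rewrite !inE /= va vb an bn.
  have [lt|lt|eq] := ltngtP w w'.
  + by exists (w, w'); [exact: pI|rewrite /T /fb /fc /= lt].
  + exists (w', w); first exact: pI.
    by rewrite /T /fb /fc /= lt -!finset.setUA [X in finset.setU _ X]finset.setUC.
  + by move/eqP: ww'; case; exact: val_inj.
(* The code of such a triangle is found through the owner [w1] of [u], which is smaller than [w];
   [two] then identifies [u] with [ucom w1 w]. *)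
- right; have [w1 v1 ow1] : exists2 w', e v w' & own w' u.
    by apply: (own_ex vw); rewrite /inb wu orbT.
  have ne : w1 != w by apply: contraNneq nu => <-.
  have e1 : e w1 u.
    case/orP: ow1 => [/eqP uw1|/andP[]//].
    by case: (eW vw v1); rewrite -uw1.
  have lt : (w1 < w)%N.
    case/orP: ow1 => [/eqP uw1|/andP[_ /forallP/(_ w)]].
      by rewrite uw1 e_irr in e1.
    by rewrite vw wu /= leq_eqVlt => /orP[/eqP/val_inj/eqP|//]; rewrite (negbTE ne).
  have wn : w != w0.
    by apply: contraTneq lt => ->; rewrite -leqNgt w0_min.
  have uE : ucom w1 w = u.
    by have [uv' e1' eu' _ _] := ucomP v1 vw lt; exact: (two v1 vw ne).
  have [w1E|w1n] := eqVneq w1 w0.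
    exists (w, w); first by rewrite !inE /= vw wn.
    by rewrite /T /fb /fc /prm /= ltnn eqxx -w1E uE.
  exists (w, w1); first by rewrite !inE /= vw v1 wn w1n.
  by rewrite /T /fb /fc /prm /= ltnNge ltnW //= (eq_sym w) (negbTE ne) uE.
- exact: Or31.
- rewrite /T; case: (I2_case pI) => [_ ne v1 v2 n1 n2|u w1 -> _ _ v1 vp lt].
    by apply: Or32; exists p.1, p.2.
  have [uv e1 eu nu _] := ucomP v1 vp lt.
  by apply: Or33; exists (ucom w1 p.1), p.1.
Qed.

(** The second kind of triangle is coned off from [w1]: one face is owned by [w1], one lies in N[u],
    and the face through [v], [w1] and the larger neighbour is of the kind already treated, or a
    simplex of A when [w1 = w0]. *)
Let T_null p : p \in I2 -> null (R := R) cplxA v (fb p) (fc p).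
Proof.
move=> /I2_case[_ ne v1 v2 n1 n2|u w1 -> _ _ v1 vp lt].
  by have [] := null_vww v1 v2 ne n1 n2.
have [uv e1 eu nu [ow _]] := ucomP v1 vp lt.
have ne : p.1 != w1 by apply: contraTneq lt => <-; rewrite ltnn.
have pn : p.1 != w0 by apply: contraTneq lt => ->; rewrite -leqNgt w0_min.
apply: (@null_cone _ _ _ _ _ _ w1).
- apply: null_simplex; right; exists w1 => //; split; first by rewrite !inE eqxx.
  by move=> x; rewrite !inE => /orP[/orP[]|] /eqP->; rewrite ?eqxx // => _; exact: own_id.
- apply: null_simplex; apply: (@cplxA_inb _ _ _ (ucom w1 p.1)) => //; try exact: vW.
  + by rewrite /inb eqxx.
  + by rewrite /inb e_sym eu orbT.
  + by rewrite /inb e_sym e1 orbT.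
- have [->|w1n] := eqVneq w1 w0; first by have [] := null_vw0 vp.
  by have [] := null_vww vp v1 ne pn w1n.
Qed.

Lemma vertex_in_A x : cplxA (finset.set1 x).
Proof.
have [->|xv] := eqVneq x v; last by left; left; exact: cplx0_single.
by apply: (cplxA_w0 vw0); [rewrite inE|move=> y; rewrite inE => /eqP->; exact: Or31].
Qed.

Lemma edge_in_A x y : e x y -> cplxA [set x; y]%SET.
Proof.
move=> xy; have s0 : [set x; y]%SET != finset.set0.
  by apply/finset.set0Pn; exists x; rewrite !inE eqxx.
have vA w : e v w -> cplxA [set v; w]%SET.
  move=> vw; apply: (cplxA_w0 vw); first by rewrite !inE eqxx.
  by move=> z; rewrite !inE => /orP[] /eqP->; [exact: Or31|exact: Or33].
have [xv|xv] := eqVneq x v; first by rewrite xv; apply: vA; rewrite -xv.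
have [yv|yv] := eqVneq y v.
  by rewrite yv finset.setUC; apply: vA; rewrite e_sym -yv.
left; left; split=> //; first by rewrite !inE !negb_or !(eq_sym v) xv.
by exists x => // z; rewrite !inE /inb => /orP[]/eqP->; rewrite ?eqxx ?xy ?orbT.
Qed.

(** Every edge of the graph is a simplex of A, and [descend] gives each vertex a decreasing path to
    0. *)
Lemma conn_A (x y : set_type (@realization R n cplxA)) : joined (R := R) x y.
Proof.
have dP k : (delta_mx 0 k : 'rV[R]_n) \in realization cplxA.
  rewrite inE; exists (finset.set1 k); first exact: vertex_in_A.
  by apply: delta_simplex; rewrite inE.
pose del k : set_type (@realization R n cplxA) := SigSub (dP k).
have dS k (s : {set 'I_n}) : k \in s -> geom_simplex s (\val (del k)).
  exact: delta_simplex.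
have to0 : forall k l : 'I_n, (k : nat) = 0%N -> joined (R := R) (del l) (del k).
  move=> k l k0; have [m] := ubnP (l : nat); elim: m l => // m IH l lm.
  have [l0|l0] := posnP l.
    have -> : l = k by apply: val_inj; rewrite /= l0 k0.
    by exists (fun=> del k); split=> //; exact: cts_cst.
  have [z zl ez] := descend l0; apply: (@joined_trans _ _ (del z)); last first.
    by apply: IH; exact: leq_trans zl _.
  by apply: (joined_simplex (edge_in_A ez)); apply: dS; rewrite !inE eqxx ?orbT.
have toV z : exists k, joined (R := R) z (del k).
  have := valP z; rewrite inE => /(realizationP _ cplxA_complex)[z0 z1 zs].
  have [k ks] := finset.set0Pn _ (supp_neq0 z1); exists k.
  by apply: (joined_simplex zs); [apply/geom_simplexP|exact: dS].
have n0 : (0 < n)%N by apply: leq_ltn_trans (ltn_ord v).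
have [k xk] := toV x; have [l yl] := toV y.
apply: (joined_trans xk); apply: (joined_trans (to0 (Ordinal n0) k erefl)).
by apply: joined_sym; apply: (joined_trans yl); exact: to0.
Qed.

Lemma new_vertex (x : 'rV[R]_n) (h5 : x \in realization cplx5)
    (h0 : x \in @realization R n cplx0) :
  phe R (SigSub h5 : set_type (realization cplx5))
    (@wbase R 2 ((#|[set w | e v w]%SET| - 1) ^ 2) (set_type (realization cplx0))
       (SigSub h0) (SigSub h0)).
Proof.
have cardI : #|I2| = ((#|[set w | e v w]%SET| - 1) ^ 2)%N.
  by rewrite cardsX [in RHS](cardsD1 w0) inE vw0 add1n subn1 /= mulnn.
rewrite -cardI.
have [A0 pA0] := sdrA0.
have hA : x \in realization cplxA by move: h0; rewrite !inE; exact: realizationS.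
have hB : x \in realization cplxB.
  by move: hA; rewrite !inE; apply: realizationS => s; exact: Or31.
have hs (K : set {set 'I_n}) : hausdorff_space (set_type (@realization R n K)).
  exact/sub_hausdorff/norm_hausdorff.
apply: (phe_trans (sdr5B.2 x h5 hB)).
apply: (phe_trans _ (phe_wedge_spheres (hs _) (hs _) (pA0 x hA h0))).
pose l2p (l : 'I_#|I2|) := enum_val l.
have lP l : l2p l \in I2 by exact: enum_valP.
apply: (@attach_complex R n #|I2| cplxA cplxB (fun=> v) (fb \o l2p) (fc \o l2p)).
- exact: cplxA_complex.
- by move=> l; exact: T_card.
- by move=> l; exact: T_notA.
- by move=> l l' /(T_inj (lP l) (lP l')); exact: enum_val_inj.
- by move=> l s; exact: T_face.
- move=> s; split=> [/T_B[As|[p pI ->]]|[As|[l ->]]].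
  + by left.
  + by right; exists (enum_rank_in pI p); rewrite /l2p /= enum_rankK_in.
  + exact: Or31.
  + by apply/T_B; right; exists (l2p l).
- by move=> l; exact: T_null.
- exact: conn_A.
Qed.

End NewVertex.

(** * The Čech complex at scale two *)

Section Cech.
Context {R : realType} {n : nat} (e : rel 'I_n).
Implicit Types (a b c u v w : 'I_n) (x y : 'rV[R]_n).
Hypothesis e_sym : symmetric e.
Hypothesis e_irr : irreflexive e.

(* Graph distance to [v], truncated at 2; its affine extension [height v] to the
   realization is 1-Lipschitz along edges. *)
Definition tdist v u : R := if u == v then 0 else if e v u then 1 else 2.
Definition height v x : R := \sum_k x ord0 k * tdist v k.

Lemma tdist_edge v a b : e a b -> `|tdist v a - tdist v b| <= 1.
Proof.
move=> ab; rewrite /tdist ler_norml.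
have [av|av] := eqVneq a v; have [bv|bv] := eqVneq b v.
- by apply/andP; split; lra.
- by rewrite -av ab; apply/andP; split; lra.
- by rewrite -bv e_sym ab; apply/andP; split; lra.
- by case: (e v a); case: (e v b); apply/andP; split; lra.
Qed.

Lemma edge_sum a b x (F : 'I_n -> R) : a != b -> geom_simplex [set a; b]%SET x ->
  \sum_k x ord0 k * F k = x ord0 a * F a + x ord0 b * F b.
Proof.
move=> ab [_ _ xs]; rewrite (bigD1 a) //= (bigD1 b) 1?eq_sym //= big1 ?addr0 //.
by move=> k /andP[ka kb]; rewrite xs ?mul0r // !inE negb_or ka.
Qed.

Lemma edge_coord a b x : a != b -> geom_simplex [set a; b]%SET x ->
  x ord0 a + x ord0 b = 1.
Proof.
move=> ab xs; have [_ <- _] := xs; have := edge_sum (fun=> 1) ab xs.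
by rewrite !mulr1 => <-; apply: eq_bigr => k _; rewrite mulr1.
Qed.

Lemma edge_neq a b : e a b -> a != b.
Proof. by apply: contraTneq => ->; rewrite e_irr. Qed.

Lemma coord_le_norm x k : `|x ord0 k| <= `|x|.
Proof.
rewrite [leRHS]/Num.Def.normr /= mx_normrE.
by apply/bigmax_geP; right => /=; exists (ord0, k).
Qed.

Lemma height_edge v x y : same_edge e x y -> height v y - height v x <= `|y - x|.
Proof.
move=> [a [b [ab xs ys]]]; have ne := edge_neq ab.
rewrite /height (edge_sum _ ne xs) (edge_sum _ ne ys).
have := edge_coord ne xs; have := edge_coord ne ys => y1 x1.
have -> : y ord0 a * tdist v a + y ord0 b * tdist v b -
  (x ord0 a * tdist v a + x ord0 b * tdist v b) =
  (y - x) ord0 a * (tdist v a - tdist v b).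
  have -> : y ord0 b = 1 - y ord0 a by lra.
  have -> : x ord0 b = 1 - x ord0 a by lra.
  by rewrite !mxE; ring.
apply: le_trans (ler_norm _) _; rewrite normrM.
apply: le_trans (ler_pM _ _ (coord_le_norm _ _) (tdist_edge v ab)) _ => //.
by rewrite mulr1.
Qed.

Lemma height_path v x y l : edge_path e x y l -> height v y - height v x <= l.
Proof.
elim=> [z|z1 z2 z3 k z12 _ IH]; first by rewrite subrr.
by have := height_edge v z12; lra.
Qed.

Lemma height_delta v u : height v (delta_mx 0 u) = tdist v u.
Proof.
rewrite /height (bigD1 u) //= mxE !eqxx mul1r big1 ?addr0 // => k /negbTE ku.
by rewrite mxE ku andbF mul0r.
Qed.

Lemma ball_height v x : graph_closed_ball e (delta_mx 0 v) 1 x -> height v x <= 1.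
Proof.
move=> [_ d1]; rewrite -lee_fin; apply: le_trans d1.
apply: le_ereal_inf_tmp => _ /= [l lp <-]; rewrite lee_fin.
by have := height_path v lp; rewrite height_delta /tdist eqxx; lra.
Qed.

(** A centre [c] is itself a witness for the balls of radius 1. Conversely only a lower bound on
    distances is needed, which [height] provides. *)
Lemma cech_nbhd : cech e (2 : R) = cplx5 e.
Proof.
apply/seteqP; split=> s [s0].
  rewrite divff // => -[p pb]; split=> //.
  have hp v : v \in s -> height v p <= 1 by move=> /pb/ball_height.
  have [z zs] := finset.set0Pn _ s0; have [[t tE pt] _] := pb z zs.
  case: tE => [[u tE]|[u [w [uw tE]]]]; rewrite {t}tE in pt.
    exists u => v vs; have := hp v vs.
    have -> : p = delta_mx 0 u.
      have [p0 p1 ps] := pt; apply/rowP => k; rewrite mxE eqxx /=.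
      have [->|ku] := eqVneq k u; last by rewrite ps // inE.
      rewrite -p1 (bigD1 u) //= big1 ?addr0 // => i iu.
      by rewrite ps // inE.
    rewrite height_delta /tdist /inb eq_sym e_sym.
    by case: eqVneq => //= _; case: (e u v) => //; lra.
  have ne := edge_neq uw; have p1 := edge_coord ne pt.
  have [p0 _ _] := pt.
  have {}hp v : v \in s -> p ord0 u * tdist v u + p ord0 w * tdist v w <= 1.
    by move=> /hp; rewrite /height (edge_sum _ ne pt).
  have near v z' : tdist v z' <= 1 -> inb e z' v.
    rewrite /tdist /inb eq_sym e_sym.
    by case: eqVneq => //= _; case: (e z' v) => //; lra.
  (* Any endpoint carrying positive weight is a centre: a vertex at truncated distance 2 from [u] is
     at distance at least 1 from [w], so its height at [p] would be at least [1 + p u]. *)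
  have [pu|pu] := eqVneq (p ord0 u) 0.
    exists w => v vs; apply: near; have := hp v vs.
    by rewrite pu mul0r add0r; have -> : p ord0 w = 1; [lra|rewrite mul1r].
  have {}pu : 0 < p ord0 u by rewrite lt_neqAle eq_sym pu p0.
  exists u => v vs; have h := hp v vs; apply: near.
  have pw : 0 <= p ord0 w := p0 w.
  have [->|wv] := eqVneq v w; first by rewrite /tdist e_sym uw; case: ifP => _; lra.
  have [du|du] := leP (tdist v u) 1 => //.
  have dw : 1 <= tdist v w.
    by rewrite /tdist eq_sym (negbTE wv); case: (e v w); lra.
  by nra.
move=> [c hc]; split=> //; exists (delta_mx 0 c) => v vs.
rewrite divff //; split.
  exists (finset.set1 c); first by left; exists c.
  by apply: delta_simplex; rewrite inE.
have [->|vc] := eqVneq v c.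
  apply: (@le_trans _ _ 0%:E); last by rewrite lee_fin.
  by apply: ereal_inf_lbound; exists 0 => //; exact: edge_path_nil.
have cv : e c v by have := hc v vs; rewrite /inb (negbTE vc).
apply: (@le_trans _ _ (`|delta_mx 0 c - delta_mx 0 v : 'rV[R]_n| + 0)%:E).
  apply: ereal_inf_lbound; exists (`|delta_mx 0 c - delta_mx 0 v : 'rV[R]_n| + 0) => //.
  apply: edge_path_cons (edge_path_nil _ _); exists v, c; split.
  - by rewrite e_sym.
  - by apply: delta_simplex; rewrite !inE eqxx.
  - by apply: delta_simplex; rewrite !inE eqxx orbT.
rewrite lee_fin addr0 [leLHS]/Num.Def.normr /= mx_normrE.
apply: bigmax_le => // -[i k] _ /=; rewrite !mxE (ord1 i) eqxx /= ler_norml.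
by case: (k == c); case: (k == v); rewrite /=; apply/andP; split; lra.
Qed.

End Cech.

(** * Binary expansions *)

Section Bits.
Implicit Types a b c p q r k : nat.

Lemma bit0 a : bit a 0 = odd a.
Proof. by rewrite /bit expn0 divn1. Qed.

Lemma bitS a q : bit a q.+1 = bit (a %/ 2) q.
Proof. by rewrite /bit expnS divnMA. Qed.

Lemma bit_inj a b : (forall q, bit a q = bit b q) -> a = b.
Proof.
elim/ltn_ind: a b => a IH b h; have [a0|a0] := posnP a.
  case: (posnP b) => [->//|b0].
  suff: False by [].
  elim/ltn_ind: b b0 h => b IHb b0 h.
  have ob : odd b = false by have := h 0%N; rewrite !bit0 a0.
  have b2 : (0 < b %/ 2)%N by lia.
  apply: (IHb (b %/ 2)%N) => //; first by lia.
  by move=> q; have := h q.+1; rewrite !bitS a0 div0n => ->.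
have e : (a %/ 2)%N = (b %/ 2)%N.
  by apply: IH => [|q]; [lia|have := h q.+1; rewrite !bitS].
by have := h 0%N; rewrite !bit0; lia.
Qed.

Lemma bit_small a p : (a < 2 ^ p)%N -> bit a p = false.
Proof. by move=> h; rewrite /bit divn_small. Qed.

Lemma bit_ge a p : bit a p -> (2 ^ p <= a)%N.
Proof. by apply: contraTT; rewrite -ltnNge => /bit_small ->. Qed.

Lemma bit_ltn a p : bit a p -> (p < a)%N.
Proof. by move=> /bit_ge; apply: leq_trans; exact: ltn_expl. Qed.

Lemma bit_ex a : (0 < a)%N -> exists p, bit a p.
Proof.
elim/ltn_ind: a => a IH a0; case oa: (odd a); first by exists 0%N; rewrite bit0.
have [||p hp] := IH (a %/ 2)%N; [lia|lia|].
by exists p.+1; rewrite bitS.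
Qed.

Lemma bit_add a p q : ~~ bit a p -> bit (a + 2 ^ p) q = bit a q (+) (q == p).
Proof.
elim: p a q => [|p IH] a [|q]; rewrite ?bit0 ?bitS ?expn0 //=.
- by move=> h; rewrite addn1 /= addbT.
- by move=> h; rewrite addbF; congr (bit _ q); lia.
- by move=> _; rewrite oddD oddX /= addbF.
- move=> h; rewrite -IH //; congr (bit _ q); rewrite expnS; lia.
Qed.

Lemma bit_sub a p q : bit a p -> bit (a - 2 ^ p) q = bit a q (+) (q == p).
Proof.
move=> ap; have le := bit_ge ap.
suff np : ~~ bit (a - 2 ^ p) p by rewrite -{2}(subnK le) bit_add // -addbA addbb addbF.
have : bit (a - 2 ^ p + 2 ^ p) p by rewrite subnK.
by rewrite /bit divnDr ?dvdnn // divnn expn_gt0 /= oddD addbT.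
Qed.

(** Flipping the bit at [p], stated at all positions, so that paths in the cube become identities
    between exclusive ors. *)
Definition adjp a b p := forall q, bit b q = bit a q (+) (q == p).

Lemma adjp_sym a b p : adjp a b p -> adjp b a p.
Proof. by move=> h q; rewrite h -addbA addbb addbF. Qed.

Lemma adjp_inj a b c p : adjp a b p -> adjp a c p -> b = c.
Proof. by move=> hb hc; apply: bit_inj => q; rewrite hb hc. Qed.

Lemma adjp_sub a p : bit a p -> adjp a (a - 2 ^ p) p.
Proof. by move=> ap q; exact: bit_sub. Qed.

Lemma adjp_ltn a b p : adjp a b p -> (b < a)%N -> bit a p.
Proof.
move=> h lt; apply: contraLR (lt) => nap; have bp : bit b p by rewrite h eqxx (negbTE nap).
have -> : a = (b - 2 ^ p)%N by apply: adjp_inj (adjp_sym h) (adjp_sub bp).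
by rewrite -leqNgt leq_subr.
Qed.

(** Two successive flips change an even number of bits, one flip an odd number. *)
Lemma adjp_tri a b c p q r : adjp a b p -> adjp b c q -> adjp a c r -> False.
Proof.
move=> h1 h2 h3.
have h k : (k == p) (+) (k == q) = (k == r).
  have := h3 k; rewrite h2 h1 -addbA => /addbI; exact.
have := h p; have := h q; have := h r.
rewrite !eqxx (eq_sym r p) (eq_sym r q) (eq_sym q p).
by case: (p == q); case: (p == r); case: (q == r).
Qed.

(** In a square of the cube opposite sides flip the same bit. Hence the corner opposite to [v] is
    determined by [w] and [w'], which is behind both [nbr_two] and [nbr_three]. *)
Lemma adjp_square v w w' x p q a b : adjp v w p -> adjp v w' q -> p <> q ->
  adjp w x a -> adjp w' x b -> x <> v -> a = q.
Proof.
move=> hw hw' pq hx hx' xv.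
have ap : p != a.
  by apply/eqP => ap; apply: xv; apply: adjp_inj (adjp_sym hw); rewrite ap.
have h k : (k == p) (+) (k == a) = (k == q) (+) (k == b).
  have := hx' k; rewrite hx hw hw' -!addbA => /addbI; exact.
have {}pq : p == q = false by apply/eqP.
have := h p; have := h q; rewrite !eqxx (negbTE ap) pq (eq_sym q p) pq /=.
case: (eqVneq p b) => [<-|//]; rewrite (eq_sym q p) pq /=.
by case: eqVneq.
Qed.

Lemma bingraphP m (u v : 'I_m) : reflect (exists p, adjp u v p) (bingraph m u v).
Proof.
have big (x : 'I_m) q : bit x q -> (q < m)%N.
  by move=> /bit_ltn h; exact: ltn_trans h (ltn_ord x).
apply: (iffP eqP) => [/mem_card1[p hp]|[p hp]].
  exists p => q; have [qm|qm] := ltnP q m.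
    have := hp (Ordinal qm); rewrite !inE /= -val_eqE /= => <-.
    by case: (bit u q); case: (bit v q).
  have -> : bit v q = false by apply: contraTF qm => /big; rewrite ltnNge.
  have -> : bit u q = false by apply: contraTF qm => /big; rewrite ltnNge.
  by rewrite gtn_eqF //; exact: leq_trans (ltn_ord p) qm.
have pm : (p < m)%N.
  have := hp p; rewrite eqxx addbT => h.
  by have [/big//|nu] := boolP (bit u p); apply: (big v); rewrite h nu.
rewrite (eq_card (B := pred1 (Ordinal pm))) ?card1 // => q; rewrite !inE /= -val_eqE /= hp.
by case: (bit u q); case: (nat_of_ord q == p).
Qed.

Lemma bit_sum (s : seq nat) q : uniq s -> bit (\sum_(i <- s) 2 ^ i) q = (q \in s).
Proof.
elim: s q => [|i s IH] q /=; first by rewrite big_nil /bit div0n.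
move=> /andP[si us]; rewrite big_cons addnC bit_add ?IH // inE.
by case: eqVneq => [->|_]; rewrite ?addbF // (negbTE si).
Qed.

End Bits.

(** * The graphs [G_m] *)

Lemma bingraph_tf m (x y z : 'I_m) :
  bingraph m x y -> bingraph m y z -> bingraph m x z -> False.
Proof. by move=> /bingraphP[p hp] /bingraphP[q hq] /bingraphP[r]; exact: adjp_tri. Qed.

Lemma cechG2E (R : realType) m :
  cechG2 R m = set_type (@realization R m (cplx5 (bingraph m))).
Proof.
by rewrite /cechG2 (cech_nbhd (@bingraph_sym m) (@bingraph_irrefl m)).
Qed.

Section LastVertex.
Variable v : nat.
Hypothesis v_gt0 : (0 < v)%N.
Local Notation V := (@ord_max v).
Local Notation e := (bingraph v.+1).
Implicit Types (w x y u : 'I_v.+1) (p q r : nat).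

Lemma last_nbr w : e V w -> exists2 p, bit v p & adjp v w p.
Proof.
move=> h; have /bingraphP[p hp] := h; exists p => //; apply: adjp_ltn hp _.
rewrite ltn_neqAle -ltnS ltn_ord andbT; apply: contraTneq h => wv.
by rewrite (_ : w = V) ?bingraph_irrefl //; exact: val_inj.
Qed.

Lemma down_nbr x p : bit x p -> exists y, [/\ (y < x)%N, adjp x y p & e x y].
Proof.
move=> xp; have x0 : (x - 2 ^ p < x)%N.
  by rewrite ltn_subrL expn_gt0 /= (leq_trans _ (bit_ge xp)) // expn_gt0.
have h : (x - 2 ^ p < v.+1)%N := ltn_trans x0 (ltn_ord x).
exists (Ordinal h); split=> //; first exact: adjp_sub.
by apply/bingraphP; exists p; exact: adjp_sub.
Qed.

Lemma last_edge w p : adjp v w p -> e V w.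
Proof. by move=> h; apply/bingraphP; exists p. Qed.

Lemma neq_last x : (x < v)%N -> x != V.
Proof. by move=> h; rewrite -val_eqE /= ltn_eqF. Qed.

Lemma val_neq_last x : x != V -> (x : nat) <> v.
Proof. by move=> /eqP h xv; apply: h; exact: val_inj. Qed.

Lemma nbr_two w w' x y : e V w -> e V w' -> w != w' -> x != V -> y != V ->
  e w x -> e w' x -> e w y -> e w' y -> x = y.
Proof.
move=> /last_nbr[p _ hp] /last_nbr[q _ hq] ww' xV yV.
move=> /bingraphP[a ha] /bingraphP[b hb] /bingraphP[c hc] /bingraphP[d hd].
have pq : p <> q.
  by move=> pq; move/eqP: ww'; apply; apply: val_inj; apply: (adjp_inj hp); rewrite pq.
have aq : a = q := adjp_square hp hq pq ha hb (val_neq_last xV).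
have cq : c = q := adjp_square hp hq pq hc hd (val_neq_last yV).
by apply: val_inj; apply: (adjp_inj ha); rewrite aq -cq.
Qed.

Lemma nbr_three x w1 w2 w3 : x != V -> e V w1 -> e V w2 -> e V w3 ->
  e x w1 -> e x w2 -> e x w3 -> [\/ w1 = w2, w1 = w3 | w2 = w3].
Proof.
move=> xV /last_nbr[p _ hp] /last_nbr[q _ hq] /last_nbr[r _ hr].
rewrite !(bingraph_sym x) => /bingraphP[a ha] /bingraphP[b hb] /bingraphP[c hc].
have xv := val_neq_last xV.
have [pq|/eqP pq] := eqVneq p q.
  by apply: Or31; apply: val_inj; apply: (adjp_inj hp); rewrite pq.
have [pr|/eqP pr] := eqVneq p r.
  by apply: Or32; apply: val_inj; apply: (adjp_inj hp); rewrite pr.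
apply: Or33; apply: val_inj; apply: (adjp_inj hq).
by rewrite -(adjp_square hp hq pq ha hb xv) (adjp_square hp hr pr ha hc xv).
Qed.

(** Deleting ones only decreases a number, so the subcubes below the last vertex lie entirely in the
    graph. The corner here is [v] with the ones at [p] and [q] deleted. *)
Lemma square_below w w' p q : bit v p -> bit v q -> p != q -> adjp v w p -> adjp v w' q ->
  exists u, [/\ u != V, e w u, e w' u, adjp w u q & (u < v)%N].
Proof.
move=> vp vq pq hp hq; have wq : bit w q by rewrite hp vq eq_sym (negbTE pq).
have wv : (w < v)%N.
  by rewrite (adjp_inj hp (adjp_sub vp)) ltn_subrL expn_gt0.
have [u [uw hu wu]] := down_nbr wq; have uv := ltn_trans uw wv.
exists u; split=> //; first exact: neq_last.
by apply/bingraphP; exists p => k; rewrite hu hp hq -!addbA [(k == p) (+) _]addbC.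
Qed.

Lemma nbr_common w w' : e V w -> e V w' -> w != w' ->
  exists u, [/\ u != V, e w u & e w' u].
Proof.
move=> /last_nbr[p vp hp] /last_nbr[q vq hq] ww'.
have pq : p != q.
  by apply: contra_neq ww' => pq; apply: val_inj; apply: (adjp_inj hp); rewrite pq.
by have [u [? ? ? _ _]] := square_below vp vq pq hp hq; exists u.
Qed.

Lemma nbr_cube w1 w2 w3 : e V w1 -> e V w2 -> e V w3 ->
  w1 != w2 -> w2 != w3 -> w1 != w3 ->
  exists (t u12 u23 u13 : 'I_v.+1), [/\ t != V,
    [/\ u12 != V, e u12 t, e u12 w1 & e u12 w2],
    [/\ u23 != V, e u23 t, e u23 w2 & e u23 w3] &
    [/\ u13 != V, e u13 t, e u13 w1 & e u13 w3]].
Proof.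
move=> /last_nbr[p vp hp] /last_nbr[q vq hq] /last_nbr[r vr hr] w12 w23 w13.
have ne (w w' : 'I_v.+1) a b : adjp v w a -> adjp v w' b -> w != w' -> a != b.
  move=> ha hb; apply: contra_neq => ab; apply: val_inj; apply: (adjp_inj ha).
  by rewrite ab.
have pq := ne _ _ _ _ hp hq w12; have qr := ne _ _ _ _ hq hr w23.
have pr := ne _ _ _ _ hp hr w13.
have [u12 [n12 a1 a2 h12 l12]] := square_below vp vq pq hp hq.
have [u23 [n23 b1 b2 h23 l23]] := square_below vq vr qr hq hr.
have [u13 [n13 c1 c2 h13 l13]] := square_below vp vr pr hp hr.
have u12r : bit u12 r.
  by rewrite h12 hp vr (eq_sym r) (negbTE pr) (eq_sym r) (negbTE qr).
(* [t] is [v] with all three ones deleted, the corner of the 3-cube opposite to [v]. *)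
have [t [tl ht et]] := down_nbr u12r.
exists t, u12, u23, u13; split.
- exact/neq_last/(ltn_trans tl).
- by rewrite !(bingraph_sym u12 w1) !(bingraph_sym u12 w2).
- rewrite (bingraph_sym u23 w2) (bingraph_sym u23 w3); split=> //.
  apply/bingraphP; exists p => k; rewrite ht h12 hp h23 hq -!addbA.
  by congr (_ (+) _); rewrite addbC -addbA.
- rewrite (bingraph_sym u13 w1) (bingraph_sym u13 w3); split=> //.
  apply/bingraphP; exists q => k; rewrite ht h12 hp h13 hp -!addbA.
  by do 2 congr (_ (+) _); rewrite addbC.
Qed.

Lemma descend_nbr x : (0 < x)%N -> exists2 y : 'I_v.+1, (y < x)%N & e x y.
Proof. by move=> /bit_ex[p /down_nbr[y [? _ ?]]]; exists y. Qed.

Lemma least_nbr : exists2 w0, e V w0 & forall w, e V w -> (w0 <= w)%N.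
Proof.
have [w _ Vw] := descend_nbr (x := V) v_gt0.
have := @arg_minnP _ w (fun w => e V w) (fun w => nat_of_ord w) Vw.
by case=> w0 Vw0 mw0; exists w0.
Qed.

Lemma card_nbr (s : seq nat) : uniq s -> v = (\sum_(i <- s) 2 ^ i)%N ->
  #|[set w | e V w]%SET| = size s.
Proof.
move=> us vE; have vs p : bit v p = (p \in s) by rewrite {1}vE bit_sum.
pose f p : 'I_v.+1 := inord (v - 2 ^ p).
have fE p : nat_of_ord (f p) = (v - 2 ^ p)%N.
  by rewrite /f inordK // ltnS leq_subr.
have fadj p : p \in s -> adjp v (f p) p by rewrite -vs fE; exact: adjp_sub.
have fi : {in s &, injective f}.
  move=> p q ps qs pq; have := fadj p ps q; rewrite pq (fadj q qs) eqxx => /addbI.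
  by move=> /esym/eqP.
rewrite -(size_map f) -(card_uniqP _) ?map_inj_in_uniq //.
apply: eq_card => w; rewrite inE; apply/idP/mapP => [/last_nbr[p vp hp]|[p ps ->]].
  exists p; first by rewrite -vs.
  by apply: val_inj; rewrite /= fE; exact: adjp_inj hp (adjp_sub vp).
exact: last_edge (fadj p ps).
Qed.

(** * Identifying the old complex with the one on one vertex fewer *)

Section Embed.
Context {R : realType}.
Let lf : 'I_v -> 'I_v.+1 := widen_ord (leqnSn v).
Let up (x : 'rV[R]_v) : 'rV[R]_v.+1 :=
  \row_i (if insub (nat_of_ord i) is Some j then x ord0 j else 0).
Let down (y : 'rV[R]_v.+1) : 'rV[R]_v := \row_j y ord0 (lf j).

Let up_lf (x : 'rV[R]_v) j : up x ord0 (lf j) = x ord0 j.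
Proof. by rewrite mxE (_ : nat_of_ord (lf j) = val j) ?valK. Qed.

Let up_max (x : 'rV[R]_v) : up x ord0 ord_max = 0.
Proof. by rewrite mxE insubN //= ltnn. Qed.

Let up_cts : cts up.
Proof. by apply: cts_row => i; case: insub => [j|]; cts. Qed.

Let down_cts : cts down.
Proof. by apply: cts_row => j; cts. Qed.

Let lfP (i : 'I_v.+1) : i != ord_max -> exists j, i = lf j.
Proof.
rewrite -val_eqE /= => iv; have h : (i < v)%N by rewrite ltn_neqAle iv -ltnS ltn_ord.
by exists (Ordinal h); apply: val_inj.
Qed.

Let lf_max j : lf j != ord_max.
Proof. by rewrite -val_eqE /= ltn_eqF. Qed.

Let lf_edge i j : e (lf i) (lf j) = bingraph v i j.
Proof. by apply/bingraphP/bingraphP. Qed.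

Let lf_inb c j : inb e (lf c) (lf j) = inb (bingraph v) c j.
Proof. by rewrite /inb lf_edge -val_eqE. Qed.

Let sum_lf (y : 'rV[R]_v.+1) :
  \sum_i y ord0 i = \sum_j down y ord0 j + y ord0 ord_max.
Proof. by rewrite big_ord_recr /=; congr (_ + _); apply: eq_bigr => j _; rewrite mxE. Qed.

Let downK (x : 'rV[R]_v) : down (up x) = x.
Proof. by apply/rowP => j; rewrite mxE up_lf. Qed.

Let upK (y : 'rV[R]_v.+1) : y ord0 ord_max = 0 -> up (down y) = y.
Proof.
move=> y0; apply/rowP => i; have [->|/lfP[j ->]] := eqVneq i ord_max.
  by rewrite up_max y0.
by rewrite up_lf mxE.
Qed.

Let cplx5v := cplx5_complex (e := bingraph v).
Let cplx0v := cplx0_complex (e := e) (v := ord_max).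

Let up_in (x : 'rV[R]_v) :
  realization (cplx5 (bingraph v)) x -> realization (cplx0 e ord_max) (up x).
Proof.
move=> /(realizationP _ cplx5v)[x0 x1 [s0 [c hc]]].
have us : \sum_i up x ord0 i = 1 by rewrite sum_lf up_max addr0 downK.
apply/(realizationP _ cplx0v); split=> //.
  by move=> i; have [->|/lfP[j ->]] := eqVneq i ord_max; rewrite ?up_max ?up_lf.
split; first exact: supp_neq0.
  by rewrite inE up_max eqxx.
exists (lf c) => // i; have [->|/lfP[j ->]] := eqVneq i ord_max.
  by rewrite inE up_max eqxx.
by rewrite inE up_lf lf_inb => xj; apply: hc; rewrite inE.
Qed.

Let cplx0_max (y : 'rV[R]_v.+1) : realization (cplx0 e ord_max) y -> y ord0 ord_max = 0.
Proof.
by move=> /(realizationP _ cplx0v)[_ _ [_ + _]]; rewrite inE negbK => /eqP.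
Qed.

Let down_in (y : 'rV[R]_v.+1) :
  realization (cplx0 e ord_max) y -> realization (cplx5 (bingraph v)) (down y).
Proof.
move=> Ky; have ym := cplx0_max Ky.
have [y0 y1 [s0 _ [c cv hc]]] := (realizationP _ cplx0v).1 Ky.
have ds : \sum_j down y ord0 j = 1 by rewrite -y1 sum_lf ym addr0.
apply/(realizationP _ cplx5v); split=> //; first by move=> j; rewrite mxE.
split; first exact: supp_neq0.
have [c' cE] := lfP cv; exists c' => j; rewrite inE mxE => yj.
by rewrite -lf_inb -cE; apply: hc; rewrite inE.
Qed.

(** A homeomorphism: points of the old complex have last coordinate 0, which is inserted or dropped.
    Any centre of an old simplex differs from the last vertex, so it survives in the smaller
    graph. *)
Lemma phe_embed (x0 : set_type (@realization R v (cplx5 (bingraph v)))) :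
  exists x1 : set_type (@realization R v.+1 (cplx0 e ord_max)), phe R x1 x0.
Proof.
have uP (x : set_type (@realization R v (cplx5 (bingraph v)))) :
    up (\val x) \in realization (cplx0 e ord_max).
  by have := valP x; rewrite !inE; exact: up_in.
have dP (y : set_type (@realization R v.+1 (cplx0 e ord_max))) :
    down (\val y) \in realization (cplx5 (bingraph v)).
  by have := valP y; rewrite !inE; exact: down_in.
pose g (z : set_type (@realization R v (cplx5 (bingraph v)))) :
  set_type (@realization R v.+1 (cplx0 e ord_max)) := SigSub (uP z).
pose f (z : set_type (@realization R v.+1 (cplx0 e ord_max))) :
  set_type (@realization R v (cplx5 (bingraph v))) := SigSub (dP z).
exists (g x0); apply: (@phe_homeo _ _ _ _ _ f g).
- by apply: cts_sub => /=; apply: (cts_comp down_cts); exact: cts_val.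
- by apply: cts_sub => /=; apply: (cts_comp up_cts); exact: cts_val.
- by move=> y; apply: val_inj => /=; rewrite upK // cplx0_max //; exact: set_mem (valP y).
- by move=> x; apply: val_inj => /=; rewrite downK.
- by apply: val_inj => /=; rewrite downK.
Qed.

Lemma phe_step (x0 : cechG2 R v) : exists x1 : cechG2 R v.+1,
  phe R x1 (@wbase R 2 ((#|[set w | e V w]%SET| - 1) ^ 2) _ x0 x0).
Proof.
move: x0; rewrite !cechG2E => x0.
have hs n (K : set {set 'I_n}) : hausdorff_space (set_type (@realization R n K)).
  exact/sub_hausdorff/norm_hausdorff.
have [[x xh] h1] := phe_embed x0.
have [w0 Vw0 w0m] := least_nbr.
have x5 : x \in realization (cplx5 e).
  move: (xh); rewrite !inE; apply: realizationS => s [s0 _ [c _ hc]].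
  by split=> //; exists c.
exists (SigSub x5); apply: (phe_trans _ (phe_wedge_spheres (hs _ _) (hs _ _) h1)).
apply: (@new_vertex R v.+1 e V w0).
- exact: bingraph_sym.
- exact: bingraph_irrefl.
- exact: bingraph_tf.
- exact: nbr_two.
- exact: nbr_three.
- exact: nbr_common.
- exact: Vw0.
- exact: w0m.
- exact: nbr_cube.
- exact: descend_nbr.
Qed.

End Embed.
End LastVertex.

(** The induction starts at the one-vertex graph, whose realization is a point, and adds the spheres
    of each step to those found before. *)
Lemma cechG2_bouquet (R : realType) v :
  exists (x : cechG2 R v.+1) n, phe R x (@bouquet_pt R 2 n).
Proof.
elim: v => [|v [x [n IH]]]; last first.
  have [x1 h1] := phe_step (ltn0Sn v) x.
  have hs : hausdorff_space (cechG2 R v.+1) by exact/sub_hausdorff/norm_hausdorff.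
  move: h1; set a := (_ ^ 2)%N => h1; exists x1, (n + a)%N; apply: (phe_trans h1).
  have h2 := phe_wedge_spheres (d := 2) (n := a) hs (@bouquet_hausdorff R 2 n) IH.
  exact: phe_trans h2 (phe_bouquet_add n a).
rewrite cechG2E.
have cK := cplx5_complex (e := bingraph 1).
have dP : (delta_mx 0 0 : 'rV[R]_1) \in realization (cplx5 (bingraph 1)).
  rewrite inE; exists (finset.set1 0); last by apply: delta_simplex; rewrite inE.
  split; first by apply/finset.set0Pn; exists 0; rewrite inE.
  by exists 0 => y; rewrite inE /inb => ->.
pose pt : set_type (@realization R 1 (cplx5 (bingraph 1))) := SigSub dP.
exists pt, 0%N; apply: (@phe_homeo _ _ _ _ _ (fun=> bouquet_pt 0) (fun=> pt)) => //.
- exact: cts_cst.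
- exact: cts_cst.
- move=> y; apply: val_inj => /=; apply/rowP => k; rewrite (ord1 k) mxE !eqxx.
  have := valP y; rewrite inE => /(realizationP _ cK)[_ + _].
  by rewrite big_ord_recl big_ord0 addr0 => <-.
- by apply: wedge_spheres_ind => [[]|[]].
Qed.

Local Close Scope ring_scope.
Local Close Scope classical_set_scope.

Theorem theorem4p2 (R : realType) (m : nat) (s : seq nat)
    (m_ge2 : (2 <= m)%N) (s_incr : sorted ltn s)
    (s_sum : m.-1 = (\sum_(i <- s) 2 ^ i)%N) :
  let alpha := ((size s - 1) ^ 2)%N in
  (exists n : nat, homotopy_equivalent R (cechG2 R m) (bouquet R 2 n)) /\
  (forall x0 : cechG2 R m.-1,
     homotopy_equivalent R (cechG2 R m) (wedge_spheres R 2 alpha x0)).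
Proof.
(* With m = v + 1, the bound [2 <= m] computes to the positivity of [v], as the step lemma wants
   it. *)
case: m m_ge2 s_sum => [//|v] v0 s_sum alpha; split.
  have [x [n h]] := cechG2_bouquet R v; exists n.
  exact: phe_homotopy_equivalent h.
move=> x0; have us : uniq s := sorted_uniq ltn_trans ltnn s_incr.
have [x1] := phe_step v0 x0; rewrite (card_nbr us s_sum) => h.
exact: phe_homotopy_equivalent h.
Qed.
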